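(* Assume the standing hypotheses (A1)–(A4) on $\varphi,\psi,g,h$ and the conditions (D) on the data $(\alpha_0,\beta_0,\gamma_0,v_0)\in X$ stated in the context. Then there exists $(\alpha,\beta,\gamma,v)\in\mathcal{A}_\lambda$ satisfying $$I(\alpha,\beta,\gamma,v)=\inf_{(\bar\alpha,\bar\beta,\bar\gamma,\bar v)\in\mathcal{A}_\lambda} I(\bar\alpha,\bar\beta,\bar\gamma,\bar v).$$
   Context: Constants: $1<p,q<\infty$, $\lambda>0$, time step $\tau>0$. All functions of $\rho$ live on $(0,1)$, and $'$ denotes the (weak) derivative in $\rho$ (or the ordinary derivative for $\varphi,\psi,g,h$). $\mathbb{R}_+=(0,\infty)$. Constitutive functions $\varphi,g:\mathbb{R}\to\mathbb{R}$, $h:\mathbb{R}_+\to\mathbb{R}$, and $\psi(x)=\varphi(x^{1/3})$ for $x\in\mathbb{R}$ (real cube root), satisfy: (A1) $\lim_{\delta\to0+}h(\delta)=\lim_{\delta\to+\infty}h(\delta)/\delta=+\infty$; (A2) $\varphi,\psi,g\in C^2(\mathbb{R})$, $h\in C^2(\mathbb{R}_+)$, $\varphi,\psi,g,h,\varphi'',\psi'',g''\ge0$ and $h''>0$; (A3) for some constants $c_1,c_2>0$, $\lim_{|x|\to\infty}\frac{\varphi(x)}{|x|^{3p}}=\lim_{|x|\to\infty}\frac{\psi(x)}{|x|^p}=c_1$ and $\lim_{|x|\to\infty}\frac{g(x)}{|x|^q}=c_2$; (A4) for some constants $C_1,C_2,C_3>0$, $\limsup_{|x|\to\infty}\frac{|\varphi'(x)|}{|x|^{3p-1}}\le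 C_1$, $\limsup_{|x|\to\infty}\frac{|\psi'(x)|}{|x|^{p-1}}\le C_2$, $\limsup_{|x|\to\infty}\frac{|g'(x)|}{|x|^{q-1}}\le C_3$. Function spaces: $X_1=\{f\in W^{1,1}(0,1): f/\rho\in L^p(0,1)\}$, $X_2=\{f\in L^1_{loc}(0,1): f\rho^{2/3}\in L^{3p}(0,1)\}$, $X_3=\{f\in W^{1,1}_{loc}(0,1): f/\rho^{2/3}\in L^q(0,1),\ f'\rho^{1/3}\in L^q(0,1)\}$, $Y=\{f\in W^{1,1}_{loc}(0,1): f\in L^2(0,1),\ f'\rho^{2/3}\in L^{3p}(0,1)\}$, $X=X_1\times X_2\times X_3\times Y$. Values such as $\alpha(0),\alpha(1)$ refer to the continuous representative. Energy density: for $(\alpha,\beta,\gamma)$ with $\alpha'>0$ a.e., $$E(\alpha,\beta,\gamma)(\rho)=\varphi(\beta\rho^{2/3})+2\psi(\alpha/\rho)+g(\gamma/\rho^{2/3})+2g\big(\tfrac32\gamma'\rho^{1/3}\big)+h(\alpha').$$ Data conditions (D): $(\alpha_0,\beta_0,\gamma_0,v_0)\in X$, $\alpha_0(1)=\lambda$, $\alpha_0\ge0$, $\alpha_0'>0$ a.e. on $(0,1)$, and $\int_0^1\big(\tfrac12v_0^2+E(\alpha_0,\beta_0,\gamma_0)\big)d\rho<\infty$. Functional: $I(\alpha,\beta,\gamma,v)=\int_0^1\big(\tfrac12(v-v_0)^2+E(\alpha,\beta,\gamma)\big)d\rho\in[0,\infty]$ for $(\alpha,\beta,\gamma,v)\in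 X$ with $\alpha'>0$ a.e. Admissible set: $\mathcal{A}_\lambda$ is the set of $(\alpha,\beta,\gamma,v)\in X$ such that $\alpha(0)\ge0$, $\alpha(1)=\lambda$, $\alpha'>0$ a.e., $I(\alpha,\beta,\gamma,v)<\infty$, and $$\frac{\beta-\beta_0}{\tau}=3v',\qquad \frac{\alpha-\alpha_0}{\tau}=3\alpha_0^{2/3}v,\qquad \frac{\gamma-\gamma_0}{\tau}=2\alpha_0^{1/3}v.$$ *)

(* Defs.v *)
From HB Require Import structures.
From mathcomp Require Import all_boot all_order all_algebra.
From mathcomp Require Import all_classical all_reals all_analysis.

Set Implicit Arguments.
Unset Strict Implicit.
Unset Printing Implicit Defensive.

Import Order.TTheory GRing.Theory Num.Theory.
Import numFieldNormedType.Exports.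

Local Open Scope ring_scope.
Local Open Scope classical_set_scope.

(* Elements of the function spaces are represented by functions R -> R, of
   which only the values on ]0, 1[ matter; every definition below is invariant
   under a modification on a null set, up to Borel measurability. *)
Section function_spaces.
Context {R : realType}.
Implicit Types (f u w : R -> R) (r : R).

Local Notation mu := (@lebesgue_measure R).

Definition I01 : set R := `]0, 1[.

Definition ae01 (P : R -> Prop) : Prop := {ae mu, forall x, I01 x -> P x}.

(* The restriction f \_ I01 is the extension of f|I01 by 0. *)
Definition Lp01 r f : Prop := f \_ I01 \in Lfun mu r%:E.

Definition L1loc01 f : Prop := locally_integrable I01 f.

Definition test_function (phi : R -> R) : Prop :=
  [/\ forall n x, derivable (phi^`(n)) x 1,
      compact (closure [set x | phi x != 0]) &
      closure [set x | phi x != 0] `<=` I01].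

Definition is_weak_derivative f u : Prop :=
  [/\ L1loc01 f, L1loc01 u &
      forall phi, test_function phi ->
        \int[mu]_(x in I01) (f x * derive1 phi x) =
        - \int[mu]_(x in I01) (u x * phi x)].

(* A weak derivative of f, arbitrary up to a.e. equality; the junk value 0 is
   taken when f has none. *)
Definition wderiv f : R -> R := xget (fun=> 0) [set u | is_weak_derivative f u].

Definition W11loc f : Prop := exists u, is_weak_derivative f u.

Definition W11 f : Prop := [/\ W11loc f, Lp01 1 f & Lp01 1 (wderiv f)].

(* The representative of f that is continuous on [0, 1] (unique there), giving
   a meaning to the boundary values; it exists as soon as W11 f. *)
Definition crep f : R -> R :=
  xget (fun=> 0)
    [set u : R -> R | {within `[0, 1], continuous u} /\ ae01 (fun x => u x = f x)].

Definition X1 (p : R) : set (R -> R) :=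
  [set f | W11 f /\ Lp01 p (fun x => f x / x)].

Definition X2 (p : R) : set (R -> R) :=
  [set f | L1loc01 f /\ Lp01 (3 * p) (fun x => f x * x `^ (2 / 3))].

Definition X3 (q : R) : set (R -> R) :=
  [set f | [/\ W11loc f, Lp01 q (fun x => f x / x `^ (2 / 3)) &
               Lp01 q (fun x => wderiv f x * x `^ (1 / 3))]].

Definition Y (p : R) : set (R -> R) :=
  [set f | [/\ W11loc f, Lp01 2 f &
               Lp01 (3 * p) (fun x => wderiv f x * x `^ (2 / 3))]].

Definition state : Type := (R -> R) * (R -> R) * (R -> R) * (R -> R).

Definition X (p q : R) : set state :=
  [set s | let: (alpha, beta, gamma, v) := s in
    [/\ X1 p alpha, X2 p beta, X3 q gamma & Y p v]].

End function_spaces.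

Section constitutive_functions.
Context {R : realType}.
Implicit Types (phi g h f : R -> R) (p q : R).

Definition cbrt (x : R) : R := Num.sg x * `|x| `^ (1 / 3).

Definition psi_of phi (x : R) : R := phi (cbrt x).

(* The filter of neighborhoods of infinity in both directions. *)
Definition abs_infty : set_system R :=
  filter_from [set: R] (fun M => [set x | M < `|x|]).

Definition C2_on (U : set R) f : Prop :=
  forall x, U x ->
    [/\ derivable f x 1, derivable (f^`()) x 1 & {for x, continuous f^`(2)}].

Definition A1 h : Prop :=
  (h d @[d --> 0^'+] --> +oo) /\ (h d / d @[d --> +oo] --> +oo).

Definition A2 phi g h : Prop :=
  [/\ [/\ C2_on [set: R] phi, C2_on [set: R] (psi_of phi), C2_on [set: R] g &
          C2_on `]0, +oo[ h],
      [/\ forall x, 0 <= phi x, forall x, 0 <= psi_of phi x,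
          forall x, 0 <= g x & forall x : R, 0 < x -> 0 <= h x],
      [/\ forall x, 0 <= phi^`(2) x, forall x, 0 <= (psi_of phi)^`(2) x &
          forall x, 0 <= g^`(2) x] &
      forall x : R, 0 < x -> 0 < h^`(2) x].

Definition A3 p q phi g : Prop :=
  exists c1 c2 : R, 0 < c1 /\ 0 < c2 /\
    [/\ phi x / `|x| `^ (3 * p) @[x --> abs_infty] --> c1,
        psi_of phi x / `|x| `^ p @[x --> abs_infty] --> c1 &
        g x / `|x| `^ q @[x --> abs_infty] --> c2].

Definition A4 p q phi g : Prop :=
  exists C1 C2 C3 : R, [/\ 0 < C1, 0 < C2 & 0 < C3] /\
    [/\ (limf_esup (fun x : R => (`|derive1 phi x| / `|x| `^ (3 * p - 1))%:E)
           abs_infty <= C1%:E)%E,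
        (limf_esup (fun x : R => (`|derive1 (psi_of phi) x| / `|x| `^ (p - 1))%:E)
           abs_infty <= C2%:E)%E &
        (limf_esup (fun x : R => (`|derive1 g x| / `|x| `^ (q - 1))%:E)
           abs_infty <= C3%:E)%E].

End constitutive_functions.

Section variational_problem.
Context {R : realType}.
Variables (p q lambda tau : R) (phi g h : R -> R).

Local Notation mu := (@lebesgue_measure R).

(* h is a function on ]0, +oo[ : its values elsewhere are discarded, which is
   immaterial when wderiv alpha > 0 a.e. *)
Definition energy (alpha beta gamma : R -> R) (x : R) : R :=
  phi (beta x * x `^ (2 / 3)) + 2 * psi_of phi (alpha x / x)
  + g (gamma x / x `^ (2 / 3)) + 2 * g (3 / 2 * wderiv gamma x * x `^ (1 / 3))
  + (h \_ `]0, +oo[) (wderiv alpha x).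

Definition functional (v0 : R -> R) (s : state) : \bar R :=
  let: (alpha, beta, gamma, v) := s in
  (\int[mu]_(x in I01)
     (1 / 2 * (v x - v0 x) ^+ 2 + energy alpha beta gamma x)%:E)%E.

Definition data_condition (s0 : state) : Prop :=
  let: (alpha0, beta0, gamma0, v0) := s0 in
  X p q s0 /\
  [/\ crep alpha0 1 = lambda,
      ae01 (fun x => 0 <= alpha0 x),
      ae01 (fun x => 0 < wderiv alpha0 x) &
      (\int[mu]_(x in I01)
         (1 / 2 * v0 x ^+ 2 + energy alpha0 beta0 gamma0 x)%:E < +oo)%E].

Definition admissible (s0 : state) : set state :=
  let: (alpha0, beta0, gamma0, v0) := s0 in
  [set s | let: (alpha, beta, gamma, v) := s in
    X p q s /\
    [/\ 0 <= crep alpha 0,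
        crep alpha 1 = lambda,
        ae01 (fun x => 0 < wderiv alpha x) &
        (functional v0 s < +oo)%E] /\
    [/\ ae01 (fun x => (beta x - beta0 x) / tau = 3 * wderiv v x),
        ae01 (fun x => (alpha x - alpha0 x) / tau
                       = 3 * alpha0 x `^ (2 / 3) * v x) &
        ae01 (fun x => (gamma x - gamma0 x) / tau
                       = 2 * alpha0 x `^ (1 / 3) * v x)]].

End variational_problem.

(* Main.v *)
(* The constraints are affine in the state, so the near-minimal sublevel sets of
   the functional are convex; among near-minimizers, choose one that nearly
   minimizes the strictly convex auxiliary functional \int \sum_i sqrt(1 + F_i^2)
   of the strain fields F_i.  Since midpoints of near-minimizers are
   near-minimizers, the midpoint gap of sqrt(1 + s^2), which dominates
   (theta a - theta b)^2 / 8 for theta s = s / sqrt(1 + s^2), makes the increments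
   of theta(F_i) square-summable.  Hence the strain fields converge a.e., with
   finite limits by Fatou's lemma.  Fatou's lemma also yields lower
   semicontinuity, and superlinear growth upgrades convergence a.e. to
   convergence in L^1, under which the weak-derivative and boundary constraints
   are closed: no weak compactness is needed.

   Extending h by +oo on ]-oo, 0] encodes alpha' > 0 in the energy.  Boundary
   values enter through alpha(x) = lambda - \int_x^1 alpha', which follows from
   testing the weak derivative against
   exp(-1/(k(x - a))) exp(-1/(k(b - x))) -> 1_]a,b[ as k -> +oo. *)

Require Import Defs.
From HB Require Import structures.
From mathcomp Require Import all_boot all_order all_algebra.
From mathcomp Require Import all_classical all_reals all_analysis.
From mathcomp Require Import measurable_realfun ring lra.

Set Implicit Arguments.
Unset Strict Implicit.
Unset Printing Implicit Defensive.

Import Order.TTheory GRing.Theory Num.Theory.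
Import numFieldNormedType.Exports.

Local Open Scope ring_scope.
Local Open Scope classical_set_scope.

(** * Minimization of convex integrals *)

(** The densities [phi], [psi_of phi] and [g] may be affine on intervals, so near-minimality of the
    energy alone does not control the distance between near-minimizers; the auxiliary functional
    supplies that control. Its integrand grows only linearly, which is what lets the superlinear
    energy bound it. The price is that only the bounded quantities theta(F_i) are seen to converge,
    and escape to infinity has to be excluded separately.

    The unknown is the family of the six arguments of the densities, not the state. Each density
    then depends on a single real variable, and the singular powers of x move into linear relations
    between the fields. There they are harmless: on a compact subset of ]0, 1[ they are bounded and
    bounded away from 0, and a test function sees nothing else.

    The energy takes real values in [functional] but extended values in the abstract problem. The
    two agree as soon as alpha' > 0 a.e., and finiteness of the extended energy forces this sign;
    the strict inequality, which is not preserved by limits, is therefore never imposed on the class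
    over which the minimization runs. *)

Section sqrt_gauge.
Context {R : realType}.
Implicit Types a b s t : R.

Definition gauge s := Num.sqrt (1 + s ^+ 2).
(** This is the derivative of [gauge], an increasing homeomorphism of the line onto ]-1, 1[. *)
Definition softsign s := s / gauge s.

Lemma gauge_sqr s : gauge s ^+ 2 = 1 + s ^+ 2.
Proof. by rewrite sqr_sqrtr// addr_ge0// sqr_ge0. Qed.

Lemma gauge_ge1 s : 1 <= gauge s.
Proof. by rewrite -sqrtr1 ler_wsqrtr// lerDl sqr_ge0. Qed.

Lemma gauge_gt0 s : 0 < gauge s.
Proof. exact: lt_le_trans (gauge_ge1 s). Qed.

Lemma gauge_le s : gauge s <= 1 + `|s|.
Proof.
rewrite -(@ler_pXn2r _ 2)// ?nnegrE ?(ltW (gauge_gt0 s))// ?addr_ge0//.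
rewrite gauge_sqr sqrrD expr1n mul1r real_normK ?num_real//.
by rewrite addrAC lerDl mulrn_wge0.
Qed.

(** With A, B, M the three values of [gauge] and u, v those of [softsign], (A + B)^2 - (2M)^2 >= AB
    (u - v)^2. Here AB >= (A + B) / 2 since A, B >= 1, and A + B + 2M <= 2 (A + B) by convexity, so
    A + B - 2M >= (u - v)^2 / 4; halving produces the 8. *)
Lemma gauge_midpoint a b :
  gauge ((a + b) / 2) + (softsign a - softsign b) ^+ 2 / 8 <= (gauge a + gauge b) / 2.
Proof.
have ga := gauge_ge1 a; have gb := gauge_ge1 b; have gm := gauge_ge1 ((a + b) / 2).
have sa := gauge_sqr a; have sb := gauge_sqr b.
have sm := gauge_sqr ((a + b) / 2).
have ta : a = softsign a * gauge a by rewrite /softsign divfK// gt_eqF// gauge_gt0.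
have tb : b = softsign b * gauge b by rewrite /softsign divfK// gt_eqF// gauge_gt0.
move: ga gb gm sa sb sm ta tb.
set A := gauge a; set B := gauge b; set M := gauge _.
set u := softsign a; set v := softsign b => A1 B1 M1 sA sB sM aE bE.
(* (A + B)^2 - (2 M)^2 = A B (u - v)^2 + A B (1/A - 1/B)^2, because 1 - u^2 = 1/A^2. *)
have D_ge : A * B * (u - v) ^+ 2 <= (A + B) ^+ 2 - 4 * M ^+ 2.
  rewrite sM aE bE; rewrite aE in sA; rewrite bE in sB.
  set c := A^-1; set e := B^-1.
  have cE : A * c = 1 by rewrite mulfV// gt_eqF//; lra.
  have eE : B * e = 1 by rewrite mulfV// gt_eqF//; lra.
  have hA : 1 - u ^+ 2 = c ^+ 2.
    have -> : 1 - u ^+ 2 = (A ^+ 2 - (u * A) ^+ 2) * c ^+ 2.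
      rewrite -[LHS]mulr1 -[X in _ * X](expr1n _ 2) -[X in _ * X ^+ 2]cE; ring.
    by rewrite sA addrK mul1r.
  have hB : 1 - v ^+ 2 = e ^+ 2.
    have -> : 1 - v ^+ 2 = (B ^+ 2 - (v * B) ^+ 2) * e ^+ 2.
      rewrite -[LHS]mulr1 -[X in _ * X](expr1n _ 2) -[X in _ * X ^+ 2]eE; ring.
    by rewrite sB addrK mul1r.
  have -> : (A + B) ^+ 2 - 4 * (1 + ((u * A + v * B) / 2) ^+ 2) =
      A * B * (u - v) ^+ 2 + A * B * (c - e) ^+ 2.
    have -> : (A + B) ^+ 2 - 4 * (1 + ((u * A + v * B) / 2) ^+ 2) =
      (A ^+ 2 - (u * A) ^+ 2) + (B ^+ 2 - (v * B) ^+ 2)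
      + 2 * (A * B * (1 - u * v)) - 4 by field.
    have -> : A * B * (c - e) ^+ 2 = A * B * (c ^+ 2 + e ^+ 2) - 2 * (A * c) * (B * e) by ring.
    by rewrite cE eE -hA -hB sA sB; ring.
  by rewrite lerDl mulr_ge0 ?sqr_ge0// mulr_ge0//; lra.
have M_le : 2 * M <= A + B.
  have h : 0 <= A * B * (u - v) ^+ 2 by rewrite mulr_ge0 ?sqr_ge0// mulr_ge0//; lra.
  rewrite -(@ler_pXn2r _ 2)// ?nnegrE; [|lra|lra].
  rewrite exprMn; lra.
have AB : A + B <= 2 * (A * B).
  have : 0 <= (A - 1) * B by rewrite mulr_ge0//; lra.
  have : 0 <= (B - 1) * A by rewrite mulr_ge0//; lra.
  lra.
have d0 : 0 <= (u - v) ^+ 2 by exact: sqr_ge0.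
have h1 : (A + B) * ((u - v) ^+ 2 / 2) <= A * B * (u - v) ^+ 2.
  have : (A + B) * (u - v) ^+ 2 <= 2 * (A * B) * (u - v) ^+ 2 by exact: ler_wpM2r.
  lra.
have h2 : (A + B) ^+ 2 - 4 * M ^+ 2 <= (A + B) * (2 * (A + B - 2 * M)).
  have : 0 <= (A + B - 2 * M) * (A + B - 2 * M) by rewrite mulr_ge0//; lra.
  lra.
have := le_trans h1 (le_trans D_ge h2).
rewrite ler_pM2l; last lra.
by lra.
Qed.

(** The inverse of theta, from 1 - theta(s)^2 = 1 / gauge(s)^2. It is continuous on ]-1, 1[, so
    convergence of theta(s_n) to an interior point gives convergence of s_n. *)
Lemma softsign_gauge s : s = softsign s / Num.sqrt (1 - softsign s ^+ 2).
Proof.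
have g0 := gauge_gt0 s.
have -> : 1 - softsign s ^+ 2 = (gauge s)^-1 ^+ 2.
  apply: (@mulIf _ (gauge s ^+ 2)); first by rewrite expf_neq0// gt_eqF.
  rewrite mulrBl -!exprMn mulVf ?gt_eqF// divfK ?gt_eqF// gauge_sqr.
  by rewrite mul1r addrK expr1n.
by rewrite sqrtr_sqr ger0_norm ?invr_ge0 ?ltW// invrK divfK// gt_eqF.
Qed.

Lemma softsign_norm_le s L : `|s| <= L -> softsign s ^+ 2 <= 1 - (1 + L ^+ 2)^-1.
Proof.
move=> sL; have L0 : 0 <= L by exact: le_trans sL.
have s1 : 0 < 1 + s ^+ 2 by rewrite ltr_wpDr// sqr_ge0.
rewrite /softsign exprMn exprVn gauge_sqr.
have -> : s ^+ 2 / (1 + s ^+ 2) = 1 - (1 + s ^+ 2)^-1.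
  by apply: (@mulIf _ (1 + s ^+ 2)); rewrite ?gt_eqF// mulrBl divfK ?mulVf ?gt_eqF//; ring.
rewrite lerD2l lerN2 lef_pV2 ?posrE ?ltr_wpDr ?sqr_ge0// lerD2l.
by rewrite -(real_normK (num_real s)) ler_pXn2r ?nnegrE.
Qed.

Lemma continuous_gauge : continuous gauge.
Proof.
move=> s; apply: (@continuous_comp _ _ _ (fun t => 1 + t ^+ 2) Num.sqrt).
  by apply: cvgD; [exact: cvg_cst|exact: exprn_continuous].
exact: sqrt_continuous.
Qed.

Lemma continuous_softsign : continuous softsign.
Proof.
move=> s; apply: cvgM; first exact: cvg_id.
by apply: cvgV; [rewrite gt_eqF// gauge_gt0|exact: continuous_gauge].
Qed.

End sqrt_gauge.

(** * Superlinear growth and convergence in mean *)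

Section superlinear.
Context d (T : measurableType d) (R : realType) (mu : {measure set T -> \bar R}).
Variables (D : set T) (mD : measurable D) (muD : (mu D < +oo)%E).

(** Additive form of |s| / Phi(s) -> 0 at infinity. It involves no quotient, so [Phi] may vanish or
    take the value +oo. *)
Definition superlinear (Phi : R -> \bar R) := forall e : R, 0 < e ->
  exists M : R, forall s, (`|s|%:E <= M%:E + e%:E * Phi s)%E.

(** The criterion of de la Vallee Poussin: truncated differences tend to 0 by dominated convergence
    on a set of finite measure, and the excess over the truncation is a small multiple of the
    bounded integrals of [Phi]. *)
Lemma superlinear_L1_cvg (Phi : R -> \bar R) (f_ : nat -> T -> R) (f : T -> R) (B : R) :
    measurable_fun setT Phi -> (forall s, 0 <= Phi s)%E -> superlinear Phi ->
    (forall n, measurable_fun D (f_ n)) -> measurable_fun D f ->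
    {ae mu, forall x, D x -> f_ ^~ x @ \oo --> f x} ->
    (forall n, \int[mu]_(x in D) Phi (f_ n x) <= B%:E)%E ->
    (\int[mu]_(x in D) Phi (f x) <= B%:E)%E ->
  (\int[mu]_(x in D) `|f_ n x - f x|%:E @[n --> \oo] --> 0)%E.
Proof.
move=> mPhi Phi0 sPhi mf_ mf f_f B_ Bf.
have mPf_ n : measurable_fun D (fun x => Phi (f_ n x)) by exact: measurableT_comp.
have mPf : measurable_fun D (fun x => Phi (f x)) by exact: measurableT_comp.
have md n : measurable_fun D (fun x => `|f_ n x - f x|).
  by apply: measurableT_comp => //; exact: measurable_funB.
have B0 : 0 <= B by rewrite -lee_fin; apply: le_trans Bf; exact: integral_ge0.
have main e : 0 < e ->
    \forall n \near \oo, (\int[mu]_(x in D) `|f_ n x - f x|%:E <= e%:E)%E.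
  (* The two integrals of [Phi] contribute at most e' * 2B <= e / 2; the added 1 covers B = 0. *)
  move=> e0; pose e' := e / 2 / (2 * B + 1).
  have B1 : 0 < 2 * B + 1 by rewrite ltr_wpDl// mulr_ge0.
  have e'0 : 0 < e' by rewrite !divr_gt0.
  have [M0 hM0] := sPhi _ e'0; pose M := Num.max 0 M0.
  have M_ge0 : 0 <= M by rewrite le_max lexx.
  have hM s : (`|s|%:E <= M%:E + e'%:E * Phi s)%E.
    apply: (le_trans (hM0 s)); rewrite leeD2r// lee_fin le_max lexx orbT //.
  (* Truncation at 2M, because each of |f_n| and |f| is at most M plus its [Phi] term. *)
  pose g n x := Num.min `|f_ n x - f x| (2 * M).
  have mg n : measurable_fun D (g n).
    by apply: measurable_minr => //; exact: measurable_cst.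
  have g0 n x : 0 <= g n x by rewrite le_min normr_ge0 mulr_ge0.
  have dom n x : (`|f_ n x - f x|%:E <=
      (g n x)%:E + (e'%:E * Phi (f_ n x) + e'%:E * Phi (f x)))%E.
    have P0 : (0 <= e'%:E * Phi (f_ n x) + e'%:E * Phi (f x))%E.
      by apply: adde_ge0; apply: mule_ge0 => //; rewrite lee_fin ltW.
    rewrite /g /Num.min; case: ifPn => _; first by rewrite leeDl.
    apply: (@le_trans _ _ (`|f_ n x| + `|f x|)%:E); first by rewrite lee_fin ler_normB.
    rewrite EFinD; apply: le_trans (leeD (hM _) (hM _)) _.
    by rewrite addeACA -EFinD mulr_natl mulr2n.
  have [_ _ lim_g] : [/\ mu.-integrable D (cst 0%E : T -> \bar R),
      ([sequence \int[mu]_(x in D) `|(g n x)%:E - (cst 0 x)|]_n @ \oo --> 0)%E &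
      ([sequence \int[mu]_(x in D) (g n x)%:E]_n @ \oo --> \int[mu]_(x in D) (cst 0 x))%E].
    apply: (@dominated_convergence _ _ _ mu D mD _ _ (cst (2 * M)%:E)).
    - by move=> n; exact/measurable_EFinP.
    - exact: measurable_cst.
    - apply: filterS f_f => x /[apply] fx; apply/cvg_EFin; first exact: nearW.
      apply: (@squeeze_cvgr _ _ _ _ (cst 0) (fun n => `|f_ n x - f x|)).
      + by apply: nearW => n; rewrite g0/= ge_min lexx.
      + exact: cvg_cst.
      + rewrite -[X in _ --> X](@normr0 _ R); apply: cvg_norm; exact/subr_cvg0.
    - apply/integrableP; split; first exact: measurable_cst.
      rewrite [ltLHS](_ : _ = (2 * M)%:E * mu D)%E.
        by rewrite lte_mul_pinfty// ?fin_numE// lee_fin mulr_ge0.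
      by rewrite -integral_cst//; apply: eq_integral => x _ /=; rewrite ger0_norm// mulr_ge0.
    - by apply: aeW => x n _ /=; rewrite lee_fin ger0_norm// ge_min lexx orbT.
  rewrite integral0 in lim_g.
  have : \forall n \near \oo, (\int[mu]_(x in D) (g n x)%:E <= (e / 2)%:E)%E.
    move/fine_cvgP : lim_g => [finN /cvgrPdist_le/(_ (e / 2))]; rewrite divr_gt0// => /(_ erefl) leN.
    near=> n.
    have fn : (\int[mu]_(x in D) (g n x)%:E)%E \is a fin_num by near: n; exact: finN.
    rewrite -(fineK fn) lee_fin.
    have : `|0 - fine (\int[mu]_(x in D) (g n x)%:E)%E| <= e / 2 by near: n; exact: leN.
    by rewrite sub0r normrN; exact/le_trans/ler_norm.
  apply: filterS => n gn.
  apply: (@le_trans _ _ (\int[mu]_(x in D) ((g n x)%:E +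
      (e'%:E * Phi (f_ n x) + e'%:E * Phi (f x)))))%E.
    apply: ge0_le_integral => //; first exact/measurable_EFinP.
    - apply: emeasurable_funD; first exact/measurable_EFinP.
      by apply: emeasurable_funD; exact: measurable_funeM.
  rewrite ge0_integralD//; last 4 first.
  - by move=> x _; rewrite lee_fin.
  - exact/measurable_EFinP.
  - by move=> x _; apply: adde_ge0; apply: mule_ge0 => //; rewrite lee_fin ltW.
  - by apply: emeasurable_funD; exact: measurable_funeM.
  rewrite ge0_integralD//; last 4 first.
  - by move=> x _; apply: mule_ge0 => //; rewrite lee_fin ltW.
  - exact: measurable_funeM.
  - by move=> x _; apply: mule_ge0 => //; rewrite lee_fin ltW.
  - exact: measurable_funeM.
  rewrite !ge0_integralZl//; [|by rewrite lee_fin ltW..].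
  apply: (@le_trans _ _ ((e / 2)%:E + (e'%:E * B%:E + e'%:E * B%:E))%E).
    apply: leeD => //; apply: leeD; apply: lee_wpmul2l => //; by rewrite lee_fin ltW.
  rewrite -!EFinM -!EFinD lee_fin.
  have -> : e' * B + e' * B = e / 2 * (2 * B / (2 * B + 1)) by rewrite /e'; field; exact: lt0r_neq0.
  rewrite [leRHS](splitr e) lerD2l ler_piMr//; first by rewrite divr_ge0 ?ltW.
  by rewrite ler_pdivrMr// mul1r lerDl.
have ge0 n : (0 <= \int[mu]_(x in D) `|f_ n x - f x|%:E)%E by exact: integral_ge0.
have finN : \forall n \near \oo, (\int[mu]_(x in D) `|f_ n x - f x|%:E)%E \is a fin_num.
  by apply: filterS (main 1 ltr01) => n h; rewrite ge0_fin_numE// (le_lt_trans h)// ltry.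
apply/fine_cvgP; split => //; apply/cvgrPdist_le => e e0.
near=> n; rewrite sub0r normrN ger0_norm ?fine_ge0//.
rewrite -lee_fin fineK; first by near: n; exact: main.
by near: n; exact: finN.
Unshelve. all: by end_near. Qed.

End superlinear.

(** The infima of [J] over the shrinking sets increase to a finite [N]. Far enough along, such an
    infimum exceeds N - e n, while a near-minimizer there stays below N + e n: one number [N] bounds
    all stages from both sides. *)
Lemma nested_almost_infimum (R : realType) (X : Type) (S : nat -> set X)
    (J : X -> R) (B : R) (e : nat -> R) :
    (forall n, S n !=set0) -> (forall m n, (m <= n)%N -> S n `<=` S m) ->
    (forall x, S 0%N x -> 0 <= J x <= B) -> (forall n, 0 < e n) ->
  exists (N : R) (k : nat -> nat) (x : nat -> X), forall n,
    [/\ (n <= k n)%N, S (k n) (x n), J (x n) <= N + e n &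
        forall y, S (k n) y -> N - e n <= J y].
Proof.
move=> S0 Sdec JB e0.
have JBn n x : S n x -> 0 <= J x <= B by move=> Sx; exact/JB/(Sdec 0%N n).
have lbJ n : has_lbound (J @` S n).
  by exists 0 => _ [x /JBn/andP[]] + _ <-.
have hinf n : has_inf (J @` S n).
  by split => //; have [x Sx] := S0 n; exists (J x), x.
pose a n := inf (J @` S n).
have aJ n x : S n x -> a n <= J x by move=> Sx; apply: ge_inf => //; exists x.
have a_nd m n : (m <= n)%N -> a m <= a n.
  move=> mn; apply: lb_le_inf; first exact: (hinf n).1.
  by move=> _ [x Sx <-]; apply: aJ; exact: (Sdec m n).
have hsup : has_sup (range a).
  split; first by exists (a 0%N), 0%N.
  exists B => _ [n _ <-]; have [x Sx] := S0 n.
  by rewrite (le_trans (aJ _ _ Sx))//; case/andP: (JBn _ _ Sx).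
have aN n : a n <= sup (range a) by apply: sup_upper_bound => //; exists n.
have step n : exists kx : nat * X, [/\ (n <= kx.1)%N, S kx.1 kx.2,
    J kx.2 <= sup (range a) + e n & forall y, S kx.1 y -> sup (range a) - e n <= J y].
  have [_ [k0 _ <-] hk0] := sup_adherent (e0 n) hsup.
  pose k := maxn k0 n.
  have [_ [x Sx <-] hx] := inf_adherent (e0 n) (hinf k).
  exists (k, x); split => //=; first exact: leq_maxr.
  - by rewrite (le_trans (ltW hx))// lerD2r aN.
  - move=> y Sy; rewrite (le_trans _ (aJ _ _ Sy))// (le_trans (ltW hk0))//.
    by rewrite a_nd// leq_maxl.
have [kx hkx] := choice step.
by exists (sup (range a)), (fst \o kx), (snd \o kx).
Qed.

(** * Lower limits and pointwise convergence *)

Section ereal_limits.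
Context {R : realType}.
Implicit Types u v : (\bar R)^nat.

Lemma limn_einf_le u v l : (forall n, u n <= v n)%E -> v @ \oo --> l ->
  (limn_einf u <= l)%E.
Proof.
move=> uv vl; rewrite limn_einf_lim -(cvg_lim _ vl)//; apply: lee_lim.
- exact: is_cvg_einfs.
- by apply/cvg_ex; exists l.
- apply: nearW => n; apply: le_trans (uv n); apply: ereal_inf_lbound.
  by exists n => //=.
Qed.

Lemma limn_einf_lty u : (limn_einf u < +oo)%E ->
  exists L : R, forall n, exists2 m, (n <= m)%N & (u m <= L%:E)%E.
Proof.
move=> uoo.
have : exists L : R, (limn_einf u < L%:E)%E.
  move: uoo; case: (limn_einf u) => [r _| //|_].
    by exists (r + 1); rewrite lte_fin ltrDl.
  by exists 0; rewrite ltNyr.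
move=> [L uL]; exists L => n.
have : (einfs u n < L%:E)%E.
  apply: le_lt_trans uL; rewrite limn_einf_lim.
  by rewrite (cvg_lim _ (@cvg_einfs_sup _ u))//; apply: ereal_sup_ubound; exists n.
by move=> /ereal_inf_lt[_ [m /= nm <-] /ltW umL]; exists m.
Qed.

End ereal_limits.

Lemma cvgn_sqr (R : realType) (u : nat -> R) (t : R) :
  u @ \oo --> t -> u n ^+ 2 @[n --> \oo] --> t ^+ 2.
Proof.
move=> ut; rewrite expr2; under eq_fun do rewrite expr2.
exact: cvgM.
Qed.

(** A finite lower limit bounds |f m| by some [L] for infinitely many m, so theta(f m)^2 <= 1 - 1/(1
    + L^2) along a subsequence. The limit of the whole sequence theta(f n) inherits this, stays
    inside ]-1, 1[, and theta can be inverted there. *)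
Lemma softsign_cvgn (R : realType) (f : nat -> R) :
  cvgn (softsign \o f) -> (limn_einf (fun n => `|f n|%:E) < +oo)%E -> cvgn f.
Proof.
move=> /cvg_ex[/= t ft] /limn_einf_lty[L fL].
have t2 : t ^+ 2 <= 1 - (1 + L ^+ 2)^-1.
  have ft2 : (softsign (f n)) ^+ 2 @[n --> \oo] --> t ^+ 2.
    exact: (@cvgn_sqr _ (softsign \o f)).
  apply/ler_addgt0Pr => e e0.
  move/cvgrPdist_le : ft2 => /(_ _ e0)[n _ hn].
  have [m nm] := fL n; rewrite lee_fin => /softsign_norm_le hm.
  have := hn m nm; rewrite /= => h.
  by rewrite -lerBlDr -lerN2 opprB lerBlDl; move: (ler_norm (t ^+ 2 - softsign (f m) ^+ 2)); lra.
have t1 : 0 < 1 - t ^+ 2.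
  have : 0 < (1 + L ^+ 2)^-1 by rewrite invr_gt0 ltr_wpDr// sqr_ge0.
  lra.
apply/cvg_ex; exists (t / Num.sqrt (1 - t ^+ 2)).
rewrite (_ : f = fun n => softsign (f n) / Num.sqrt (1 - softsign (f n) ^+ 2)); last first.
  by apply/funext => n; exact: softsign_gauge.
apply: cvgM => //; apply: cvgV; first by rewrite gt_eqF// sqrtr_gt0.
apply: continuous_cvg; first exact: sqrt_continuous.
apply: cvgB; first exact: cvg_cst.
exact: (@cvgn_sqr _ (softsign \o f)).
Qed.

Section ae_cauchy.
Context d (T : measurableType d) (R : realType) (mu : {measure set T -> \bar R}).
Variables (D : set T) (mD : measurable D).

(** Weighting the squared increments by 4^n leaves integrals at most C 2^-n. The weighted series is
    thus integrable and finite a.e., which forces geometric decay of the increments at almost every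
    point. *)
Lemma ae_cvgn_sqr_increments (u : nat -> T -> R) (C : R) :
    (forall n, measurable_fun D (u n)) ->
    (forall n, \int[mu]_(x in D) ((u n x - u n.+1 x) ^+ 2)%:E <= (C * 8^-1 ^+ n)%:E)%E ->
  {ae mu, forall x, D x -> cvgn (u ^~ x)}.
Proof.
move=> mu_ uC.
pose w n x := (4 ^+ n * (u n x - u n.+1 x) ^+ 2)%:E.
have w0 n x : (0 <= w n x)%E by rewrite lee_fin mulr_ge0 ?sqr_ge0// exprn_ge0.
have md n : measurable_fun D (fun x => (u n x - u n.+1 x) ^+ 2).
  by apply: measurable_funX; exact: measurable_funB.
have mw n : measurable_fun D (w n).
  by apply/measurable_EFinP; apply: measurable_funM => //; exact: measurable_cst.
have C0 : 0 <= C.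
  rewrite -lee_fin -[C]mulr1 -(expr0 8^-1); apply: le_trans (uC 0%N); apply: integral_ge0 => x _.
  by rewrite lee_fin sqr_ge0.
have iw n : (\int[mu]_(x in D) w n x <= (geometric C 2^-1 n)%:E)%E.
  rewrite /w; under eq_integral do rewrite EFinM.
  rewrite ge0_integralZl//=; last 2 first.
  - exact/measurable_EFinP.
  - by move=> x _; rewrite lee_fin sqr_ge0.
  apply: (@le_trans _ _ ((4 ^+ n)%:E * (C * 8^-1 ^+ n)%:E)%E).
    by apply: lee_wpmul2l => //; rewrite lee_fin exprn_ge0.
  rewrite -EFinM lee_fin mulrCA -exprMn.
  by rewrite (_ : 4 * 8^-1 = 2^-1 :> R)//; field.
have sw : (\int[mu]_(x in D) \sum_(0 <= n <oo) w n x < +oo)%E.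
  rewrite integral_nneseries//; apply: (@le_lt_trans _ _ (C / (1 - 2^-1))%:E); last exact: ltry.
  apply: lime_le; first by apply: is_cvg_nneseries => n _ _; exact: integral_ge0.
  apply: nearW => n; apply: (@le_trans _ _ (\sum_(0 <= i < n) (geometric C 2^-1 i)%:E)%E).
    by apply: lee_sum => i _.
  rewrite sumEFin lee_fin; apply: geometric_le_lim => //.
  by rewrite gtr0_norm ?invf_lt1// ltr1n.
have : mu.-integrable D (fun x => \sum_(0 <= n <oo) w n x)%E.
  apply/integrableP; split; first exact: ge0_emeasurable_sum.
  rewrite (_ : integral _ _ _ = (\int[mu]_(x in D) \sum_(0 <= n <oo) w n x)%E)//.
  by apply: eq_integral => x _; rewrite gee0_abs// nneseries_ge0.
move/(integrable_ae mD); apply: filterS => x /[apply] fw.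
set c := fine (\sum_(0 <= n <oo) w n x)%E in fw.
have wc n : 4 ^+ n * (u n x - u n.+1 x) ^+ 2 <= c.
  rewrite -lee_fin /c fineK//.
  apply: le_trans (nneseries_lim_ge n.+1 _); last by move=> *; exact: w0.
  by rewrite big_nat_recr//= leeDr// sume_ge0.
have c0 : 0 <= c by apply: le_trans (wc 0%N); rewrite mulr_ge0 ?sqr_ge0.
(* The factor c + 1 stands in for the square root of c, since c <= (c + 1)^2. *)
have uc n : `|u n x - u n.+1 x| <= geometric (c + 1) 2^-1 n.
  rewrite -(@ler_pXn2r _ 2)// ?nnegrE ?mulr_ge0 ?exprn_ge0 ?addr_ge0//.
  rewrite real_normK ?num_real// exprMn -exprM mulnC exprM.
  rewrite (_ : 2^-1 ^+ 2 = 4^-1 :> R); last by field.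
  rewrite exprVn -ler_pdivrMr ?invr_gt0 ?exprn_gt0// invrK mulrC.
  by rewrite (le_trans (wc n))//; nra.
have cu : cvgn (series (telescope (u ^~ x))).
  apply: normed_cvg; apply: (@series_le_cvg _ _ (geometric (c + 1) 2^-1)).
  - by move=> n /=.
  - by move=> n /=; rewrite mulr_ge0 ?exprn_ge0 ?addr_ge0.
  - by move=> n; rewrite /telescope/= distrC.
  - by apply: is_cvg_geometric_series; rewrite gtr0_norm ?invf_lt1// ltr1n.
rewrite (_ : u ^~ x = fun n => u 0%N x + series (telescope (u ^~ x)) n); last first.
  by apply/funext => n; rewrite -eq_sum_telescope.
by apply: is_cvgD => //; exact: is_cvg_cst.
Qed.

End ae_cauchy.

(** * Minimizers of convex integrals over closed midpoint-convex classes *)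

Section convex_integral_minimum.
Context d (T : measurableType d) (R : realType) (mu : {measure set T -> \bar R}).
Variables (D : set T) (mD : measurable D) (muD : (mu D < +oo)%E).
Variables (k : nat) (Phi : nat -> R -> \bar R).
Hypothesis mPhi : forall i, measurable_fun setT (Phi i).
Hypothesis Phi_ge0 : forall i s, (0 <= Phi i s)%E.
Hypothesis cPhi : forall i, continuous (Phi i).
Hypothesis sPhi : forall i, superlinear (Phi i).
Hypothesis Phi_mid : forall i s t,
  (2%:E * Phi i ((s + t) / 2) <= Phi i s + Phi i t)%E.

Implicit Types F : nat -> T -> R.

Definition convex_integral F := (\int[mu]_(x in D) \sum_(i < k) Phi i (F i x))%E.

Let G := convex_integral.

Definition midpoint F F' : nat -> T -> R := fun i x => (F i x + F' i x) / 2.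

Variable C : set (nat -> T -> R).
Hypothesis mC : forall F, C F -> forall i, measurable_fun D (F i).
Hypothesis C_mid : forall F F', C F -> C F' -> C (midpoint F F').
(** Closedness is required only when both modes of convergence hold: pointwise relations can then
    pass to the limit a.e., and integral relations in L^1. *)
Hypothesis C_closed : forall (F_ : nat -> nat -> T -> R) F,
  (forall n, C (F_ n)) -> (forall i, measurable_fun D (F i)) ->
  (forall i, (i < k)%N -> {ae mu, forall x, D x -> (F_ n i x) @[n --> \oo] --> F i x}) ->
  (forall i, (i < k)%N ->
    (\int[mu]_(x in D) `|F_ n i x - F i x|%:E @[n --> \oo] --> 0)%E) ->
  C F.

Let mPhiF F : (forall i, measurable_fun D (F i)) ->
  forall i, measurable_fun D (fun x => Phi i (F i x)).
Proof. by move=> mF i; exact: measurableT_comp. Qed.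

Let mG F : (forall i, measurable_fun D (F i)) ->
  measurable_fun D (fun x => \sum_(i < k) Phi i (F i x))%E.
Proof. by move=> mF; apply: emeasurable_sum => i; exact: mPhiF. Qed.

Let G_ge0 F : (0 <= G F)%E.
Proof. by apply: integral_ge0 => x _; exact: sume_ge0. Qed.

Let G_mid F F' : (forall i, measurable_fun D (F i)) ->
  (forall i, measurable_fun D (F' i)) ->
  (2%:E * G (midpoint F F') <= G F + G F')%E.
Proof.
move=> mF mF'.
have mm i : measurable_fun D (midpoint F F' i).
  by apply: measurable_funM; [exact: measurable_funD|exact: measurable_cst].
rewrite /G /convex_integral -ge0_integralZl//; last 2 first.
- exact: mG.
- by move=> x _; exact: sume_ge0.
rewrite -ge0_integralD//; last 4 first.
- by move=> x _; exact: sume_ge0.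
- exact: mG.
- by move=> x _; exact: sume_ge0.
- exact: mG.
apply: ge0_le_integral => //.
- by move=> x _; rewrite mule_ge0// sume_ge0.
- by apply: measurable_funeM; exact: mG.
- by apply: emeasurable_funD; exact: mG.
- move=> x _; rewrite -big_split/= ge0_sume_distrr//.
  by apply: lee_sum => i _; exact: Phi_mid.
Qed.

Definition gauge_sum F x := \sum_(i < k) gauge (F i x).

Let mgauge F : (forall i, measurable_fun D (F i)) ->
  measurable_fun D (gauge_sum F).
Proof.
move=> mF; apply: measurable_sum => i; apply: measurableT_comp => //.
by apply: continuous_measurable_fun; exact: continuous_gauge.
Qed.

Let gauge_sum_ge0 F x : 0 <= gauge_sum F x.
Proof. by apply: sumr_ge0 => i _; rewrite ltW// gauge_gt0. Qed.

Let gauge_int F := (\int[mu]_(x in D) (gauge_sum F x)%:E)%E.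

(** Superlinearity with e = 1, together with gauge(s) <= 1 + |s|. *)
Let gauge_bound : exists2 c : R, 0 <= c & forall F x,
  ((gauge_sum F x)%:E <= c%:E + \sum_(i < k) Phi i (F i x))%E.
Proof.
have [M hM] := choice (fun i => @sPhi i 1 ltr01).
exists (\sum_(i < k) (1 + `|M i|)); first by apply: sumr_ge0 => i _; rewrite addr_ge0.
move=> F x; rewrite /gauge_sum -!sumEFin -big_split/=; apply: lee_sum => i _.
apply: (@le_trans _ _ (1 + `|F i x|)%:E); first by rewrite lee_fin gauge_le.
rewrite !EFinD -addeA leeD2l//; apply: (le_trans (hM i (F i x))).
by rewrite mul1e leeD2r// lee_fin ler_norm.
Qed.

Let gauge_int_le : exists2 c : R, 0 <= c & forall F,
  (forall i, measurable_fun D (F i)) -> (gauge_int F <= c%:E + G F)%E.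
Proof.
have [c c0 hc] := gauge_bound.
exists (c * fine (mu D)); first by rewrite mulr_ge0// fine_ge0.
move=> F mF; apply: (@le_trans _ _
    (\int[mu]_(x in D) (c%:E + \sum_(i < k) Phi i (F i x))))%E.
  apply: ge0_le_integral => //.
  - by move=> x _; rewrite lee_fin.
  - by apply/measurable_EFinP; exact: mgauge.
  - by apply: emeasurable_funD; [exact: measurable_cst|exact: mG].
rewrite ge0_integralD//; last 2 first.
- by move=> x _; exact: sume_ge0.
- exact: mG.
rewrite integral_cst// EFinM fineK// ge0_fin_numE//.
Qed.

(** The integral of 8 times [gauge_midpoint], summed over the fields; the squares of all fields
    other than the i-th are dropped. *)
Let gauge_gap F F' : (forall i, measurable_fun D (F i)) ->
  (forall i, measurable_fun D (F' i)) -> forall i, (i < k)%N ->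
  (8%:E * gauge_int (midpoint F F') +
    \int[mu]_(x in D) ((softsign (F i x) - softsign (F' i x)) ^+ 2)%:E
   <= 4%:E * (gauge_int F + gauge_int F'))%E.
Proof.
move=> mF mF' i ik.
have mm j : measurable_fun D (midpoint F F' j).
  by apply: measurable_funM; [exact: measurable_funD|exact: measurable_cst].
have ms f : measurable_fun D f -> measurable_fun D (softsign \o f).
  move=> mf; apply: measurableT_comp => //.
  by apply: continuous_measurable_fun; exact: continuous_softsign.
have mE f : (forall i, measurable_fun D (f i)) -> measurable_fun D (EFin \o gauge_sum f).
  by move=> mf; apply/measurable_EFinP; exact: mgauge.
have msq : measurable_fun D (fun x => ((softsign (F i x) - softsign (F' i x)) ^+ 2)%:E).
  apply/measurable_EFinP; apply: measurable_funX; apply: measurable_funB; exact: ms.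
have g0 f x : (0 <= (gauge_sum f x)%:E)%E by rewrite lee_fin gauge_sum_ge0.
rewrite /gauge_int -(@ge0_integralZl _ _ _ mu D mD _ _ 8%:E)//; last exact: mE.
rewrite -[leLHS]ge0_integralD//; last 3 first.
- by move=> x _; rewrite mule_ge0.
- by apply: measurable_funeM; exact: mE.
- by move=> x _; rewrite lee_fin sqr_ge0.
rewrite -[X in (_ <= _ * X)%E]ge0_integralD//; [|exact: mE..].
rewrite -[leRHS]ge0_integralZl//; last 2 first.
- by apply: emeasurable_funD; exact: mE.
- by move=> x _; rewrite adde_ge0.
apply: ge0_le_integral => //.
- by move=> x _; rewrite adde_ge0 ?mule_ge0// lee_fin sqr_ge0.
- by apply: emeasurable_funD => //; apply: measurable_funeM; exact: mE.
- by apply: measurable_funeM; apply: emeasurable_funD; exact: mE.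
- move=> x _; rewrite -?EFinM -?EFinD -?EFinM lee_fin /gauge_sum -big_split/=.
  rewrite !mulr_sumr (bigD1 (Ordinal ik))//= [leRHS](bigD1 (Ordinal ik))//=.
  rewrite addrAC lerD//.
    by have := gauge_midpoint (F i x) (F' i x); rewrite /midpoint; lra.
  apply: ler_sum => j _.
  have := gauge_midpoint (F j x) (F' j x).
  have := sqr_ge0 (softsign (F j x) - softsign (F' j x)); rewrite /midpoint; lra.
Qed.


(** The increments give convergence of theta(F_n) a.e. Fatou's lemma applied to [gauge_sum], which
    dominates each |F_n i|, makes the lower limit of |F_n i| finite a.e., as [softsign_cvgn]
    demands. *)
Let limits_ae (F_ : nat -> nat -> T -> R) (B A : R) :
    (forall n i, measurable_fun D (F_ n i)) ->
    (forall n, gauge_int (F_ n) <= B%:E)%E ->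
    (forall n i, (i < k)%N ->
      \int[mu]_(x in D) ((softsign (F_ n i x) - softsign (F_ n.+1 i x)) ^+ 2)%:E
      <= (A * 8^-1 ^+ n)%:E)%E ->
  forall i, (i < k)%N -> {ae mu, forall x, D x -> cvgn (F_ ^~ i ^~ x)}.
Proof.
move=> mF FB FA i ik.
have ms f : measurable_fun D f -> measurable_fun D (softsign \o f).
  move=> mf; apply: measurableT_comp => //.
  by apply: continuous_measurable_fun; exact: continuous_softsign.
have cs : {ae mu, forall x, D x -> cvgn (fun n => softsign (F_ n i x))}.
  apply: (@ae_cvgn_sqr_increments _ _ _ mu D mD (fun n x => softsign (F_ n i x)) A).
    by move=> n; exact: ms.
  by move=> n; exact: FA.
have mE n : measurable_fun D (EFin \o gauge_sum (F_ n)).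
  by apply/measurable_EFinP; exact: mgauge.
have g0 n x : (0 <= (gauge_sum (F_ n) x)%:E)%E by rewrite lee_fin gauge_sum_ge0.
have lim_fin : (\int[mu]_(x in D) limn_einf (fun n => (gauge_sum (F_ n) x)%:E) < +oo)%E.
  apply: (@le_lt_trans _ _ B%:E); last exact: ltry.
  apply: (le_trans (fatou mu mD mE (fun n x _ => g0 n x))).
  by apply: (@limn_einf_le _ _ (cst B%:E)); [exact: FB|exact: cvg_cst].
have ge0_lim x : (0 <= limn_einf (fun n => (gauge_sum (F_ n) x)%:E))%E.
  rewrite limn_einf_lim; apply: lime_ge; first exact: is_cvg_einfs.
  by apply: nearW => n; apply: le_ereal_inf_tmp => _ [m /= nm <-].
have mlim : measurable_fun D (fun x => limn_einf (fun n => (gauge_sum (F_ n) x)%:E)).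
  rewrite /limn_einf; apply: measurableT_comp => //.
  by apply: measurable_fun_limn_esup => n; apply: measurableT_comp => //; exact: mE.
have : mu.-integrable D (fun x => limn_einf (fun n => (gauge_sum (F_ n) x)%:E)).
  apply/integrableP; split => //.
  by under eq_integral do rewrite gee0_abs//.
move/(integrable_ae mD); move: cs; apply: filterS2 => x + + Dx => /(_ Dx) csx /(_ Dx) fx.
apply: softsign_cvgn => //.
apply: le_lt_trans (_ : limn_einf (fun n => (gauge_sum (F_ n) x)%:E) < +oo)%E; last first.
  by rewrite -ge0_fin_numE.
rewrite !limn_einf_lim; apply: lee_lim; [exact: is_cvg_einfs..|].
apply: nearW => n; apply: le_ereal_inf_tmp => _ [m /= nm <-].
apply: (@le_trans _ _ (`|F_ m i x|%:E)); first by apply: ereal_inf_lbound; exists m.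
rewrite lee_fin /gauge_sum (bigD1 (Ordinal ik))//=.
apply: (@le_trans _ _ (gauge (F_ m i x))); last first.
  by rewrite lerDl sumr_ge0// => j _; rewrite ltW// gauge_gt0.
rewrite -(@ler_pXn2r _ 2)// ?nnegrE ?(ltW (gauge_gt0 _))//.
by rewrite real_normK ?num_real// gauge_sqr lerDr.
Qed.

Theorem convex_integral_attains : (exists2 F, C F & (G F < +oo)%E) ->
  exists2 F, C F & forall F', C F' -> (G F <= G F')%E.
Proof.
move=> [F0 CF0 GF0].
pose m := fine (ereal_inf (G @` C)).
have inf_fin : ereal_inf (G @` C) \is a fin_num.
  rewrite ge0_fin_numE.
    by apply: le_lt_trans GF0; apply: ereal_inf_lbound; exists F0.
  by apply: le_ereal_inf_tmp => _ [F _ <-].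
have mE : m%:E = ereal_inf (G @` C) by rewrite fineK.
have m_le F : C F -> (m%:E <= G F)%E.
  by move=> CF; rewrite mE; apply: ereal_inf_lbound; exists F.
pose S n := [set F | C F /\ (G F <= (m + n.+1%:R^-1)%:E)%E].
have S_ne n : S n !=set0.
  have n0 : 0 < n.+1%:R^-1 :> R by rewrite invr_gt0.
  have [_ [F CF <-] hF] := lb_ereal_inf_adherent n0 inf_fin.
  by exists F; split => //; rewrite EFinD mE ltW.
have S_dec a b : (a <= b)%N -> S b `<=` S a.
  move=> ab F [CF GF]; split => //; apply: (le_trans GF).
  by rewrite lee_fin lerD2l lef_pV2 ?posrE// ler_nat.
have S_mid n F F' : S n F -> S n F' -> S n (midpoint F F').
  move=> [CF GF] [CF' GF']; split; first exact: C_mid.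
  rewrite -(@lee_pmul2l _ 2%:E)//; apply: (le_trans (G_mid (mC CF) (mC CF'))).
  by apply: (le_trans (leeD GF GF')); rewrite -EFinM -EFinD lee_fin mulr_natl mulr2n.
have [c c0 hc] := gauge_int_le.
have GB n F : S n F -> (G F <= (m + 1)%:E)%E.
  move=> SF; have [_ GF] := S_dec _ _ (leq0n n) _ SF.
  by apply: (le_trans GF); rewrite invr1.
pose B := c + (m + 1).
have gB n F : S n F -> (gauge_int F <= B%:E)%E.
  move=> SF; have [CF _] := SF; apply: (le_trans (hc _ (mC CF))).
  by rewrite EFinD leeD2l// (GB n).
have g_ge0 F : (0 <= gauge_int F)%E.
  by apply: integral_ge0 => x _; rewrite lee_fin.
have g_fin n F : S n F -> gauge_int F \is a fin_num.
  by move=> SF; rewrite ge0_fin_numE// (le_lt_trans (gB n F SF))// ltry.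
(* Any ratio below 1/4 would survive the weights 4^n in [ae_cvgn_sqr_increments]. *)
pose e (n : nat) : R := 8^-1 ^+ n.
have e0 n : 0 < e n by rewrite exprn_gt0// invr_gt0.
have e_dec n : e n.+1 <= e n.
  by rewrite /e exprS ler_piMl ?exprn_ge0 ?invr_ge0// invf_le1// ler1n.
have [N [j [F_ hF]]] := @nested_almost_infimum _ _ S (fine \o gauge_int) B e S_ne S_dec
  (fun F SF => introT andP (conj (fine_ge0 (g_ge0 F))
    (fine_le (g_fin _ _ SF) (erefl : B%:E \is a fin_num) (gB _ _ SF)))) e0.
have SF_ n : S (j n) (F_ n) by have [] := hF n.
have CF_ n : C (F_ n) by have [] := SF_ n.
have mF_ n i : measurable_fun D (F_ n i) by exact: mC.
(* By [gauge_gap] the integral is at most 4 (2N + e n + e n.+1) - 8 (N - e n) = 12 e n + 4 e n.+1 <=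
   16 e n. *)
have incr n i : (i < k)%N ->
    (\int[mu]_(x in D) ((softsign (F_ n i x) - softsign (F_ n.+1 i x)) ^+ 2)%:E
      <= (16 * 8^-1 ^+ n)%:E)%E.
  move=> ik; have := gauge_gap (mF_ n) (mF_ n.+1) ik.
  have [_ _ Jn inf_n] := hF n; have [_ _ Jn1 inf_n1] := hF n.+1.
  pose l := minn (j n) (j n.+1).
  (* The two near-minimizers may live at different stages; both lie in the larger of the two sets,
     where the lower bound for the midpoint is known. *)
  have Smid : S l (midpoint (F_ n) (F_ n.+1)).
    apply: S_mid; first by apply: (S_dec l _ _ _ (SF_ n)); exact: geq_minl.
    by apply: (S_dec l _ _ _ (SF_ n.+1)); exact: geq_minr.
  have Jmid : N - e n <= fine (gauge_int (midpoint (F_ n) (F_ n.+1))).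
    rewrite /l /minn in Smid; case: ifPn Smid => _ Smid; first exact: inf_n.
    by apply: le_trans (inf_n1 _ Smid); rewrite lerD2l lerN2.
  rewrite -(fineK (g_fin _ _ Smid)) -(fineK (g_fin _ _ (SF_ n))) -(fineK (g_fin _ _ (SF_ n.+1))).
  rewrite -!EFinM -leeBrDl// => /le_trans; apply.
  rewrite -EFinB lee_fin.
  move: Jn Jn1 Jmid (e_dec n); rewrite /e /=; lra.
have cF i : (i < k)%N -> {ae mu, forall x, D x -> cvgn (F_ ^~ i ^~ x)}.
  move=> ik; apply: (limits_ae (B := B) mF_ _ incr ik) => n; exact: gB (SF_ n).
(* An upper limit is measurable without any convergence, and it equals the limit wherever one
   exists. *)
pose F i x := fine (limn_esup (fun n => (F_ n i x)%:E)).
have mF i : measurable_fun D (F i).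
  apply: measurableT_comp => //; apply: measurable_fun_limn_esup => n.
  exact/measurable_EFinP.
have F_F i : (i < k)%N -> {ae mu, forall x, D x -> F_ n i x @[n --> \oo] --> F i x}.
  move=> /cF; apply: filterS => x /[apply] cx.
  suff -> : F i x = limn (F_ ^~ i ^~ x) by [].
  rewrite /F (cvg_limn_einf_sup (l := (limn (F_ ^~ i ^~ x))%:E))//.
  by apply/cvg_EFin; [exact: nearW|exact: cx].
have F_F_all : {ae mu, forall x, D x -> forall i, (i < k)%N -> F_ n i x @[n --> \oo] --> F i x}.
  have : {ae mu, forall x, forall i, (i < k)%N -> D x -> F_ n i x @[n --> \oo] --> F i x}.
    apply: ae_foralln => i; have [/F_F|ik] := boolP (i < k)%N.
      by apply: filterS => x h _; exact: h.
    by apply: aeW => x.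
  by apply: filterS => x h Dx i ik; exact: h.
(* Continuity of each [Phi i] into the extended reals identifies the lower limit of the integrands
   with the integrand of [F]; Fatou's lemma does the rest. *)
have GF : (G F <= m%:E)%E.
  apply: (@le_trans _ _ (\int[mu]_(x in D) limn_einf (fun n => \sum_(i < k) Phi i (F_ n i x))))%E.
    rewrite le_eqVlt; apply/orP; left; apply/eqP; apply: ge0_ae_eq_integral => //.
    - exact: mG.
    - rewrite /limn_einf; apply: measurableT_comp => //.
      apply: measurable_fun_limn_esup => n; apply: measurableT_comp => //; exact: mG.
    - by move=> x _; exact: sume_ge0.
    - move=> x _; rewrite limn_einf_lim; apply: lime_ge; first exact: is_cvg_einfs.
      by apply: nearW => n; apply: le_ereal_inf_tmp => _ [p /= np <-]; exact: sume_ge0.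
    - move: F_F_all; apply: filterS => x /[apply] cx.
      have : (\sum_(i < k) Phi i (F_ n i x))%E @[n --> \oo] --> (\sum_(i < k) Phi i (F i x))%E.
        apply: cvg_nnesum => i _; first exact: nearW.
        by apply: continuous_cvg; [exact: cPhi|exact: cx].
      by move/cvg_limn_einf_sup => -[->].
  apply: le_trans (fatou mu mD (fun n => mG (mF_ n)) _) _; first by move=> n x _; exact: sume_ge0.
  apply: (@limn_einf_le _ _ (fun n => (m + n.+1%:R^-1)%:E)).
    move=> n; have [nj _ _ _] := hF n.
    by have [_] := S_dec _ _ nj _ (SF_ n).
  apply/cvg_EFin; first exact: nearW.
  rewrite -[X in _ --> X]addr0; apply: cvgD; [exact: cvg_cst|].
  exact: cvg_harmonic.
suff CF : C F by exists F => // F' /m_le; exact: le_trans.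
apply: (C_closed CF_ mF F_F) => i ik.
have Phi_le F' : (forall i, measurable_fun D (F' i)) ->
    (\int[mu]_(x in D) Phi i (F' i x) <= G F')%E.
  move=> mF'; apply: ge0_le_integral => //; [exact: mPhiF|exact: mG|].
  by move=> x _; rewrite (bigD1 (Ordinal ik))//= leeDl// sume_ge0.
apply: (superlinear_L1_cvg mD muD (mPhi i) (Phi_ge0 i) (sPhi i) (B := m + 1)) => //.
- exact: F_F.
- by move=> n; apply: (le_trans (Phi_le _ (mF_ n))); exact: GB (SF_ n).
- by apply: (le_trans (Phi_le _ mF)); apply: (le_trans GF); rewrite lee_fin lerDl.
Qed.

End convex_integral_minimum.

(** * Smooth cutoff functions *)

Section expinv.
Context {R : realType}.
Implicit Types (f g : R -> R) (x : R).

(** The classical flat function exp(-1/x) is the case n = 0. The powers of 1/x are included because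
    its derivatives are combinations of these functions. *)
Definition expinv n x : R := if 0 < x then x^-1 ^+ n * expR (- x^-1) else 0.

Lemma expinv_gt0E n x : 0 < x -> expinv n x = x^-1 ^+ n * expR (- x^-1).
Proof. by rewrite /expinv => ->. Qed.

Lemma expinv_le0 n x : x <= 0 -> expinv n x = 0.
Proof. by rewrite leNgt /expinv => /negbTE ->. Qed.

Lemma expinv_ge0 n x : 0 <= expinv n x.
Proof.
by rewrite /expinv; case: ifPn => // x0; rewrite mulr_ge0 ?expR_ge0// exprn_ge0// invr_ge0 ltW.
Qed.

Lemma expinv0_le1 x : expinv 0 x <= 1.
Proof.
rewrite /expinv; case: ifPn => // x0; rewrite expr0 mul1r -expR0 ler_expR.
by rewrite oppr_le0 invr_ge0 ltW.
Qed.

(** The n-th power of x/n <= exp(x/n). *)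
Lemma exprn_expRN_le n x : 0 <= x -> x ^+ n * expR (- x) <= n%:R ^+ n.
Proof.
move=> x0; case: n => [|n]; first by rewrite !expr0 mul1r -expR0 ler_expR oppr_le0.
have n0 : 0 < n.+1%:R :> R by [].
rewrite expRN ler_pdivrMr ?expR_gt0//.
have -> : expR x = expR (x / n.+1%:R) ^+ n.+1 by rewrite -expRM_natl mulrC divfK// gt_eqF.
rewrite -exprMn ler_pXn2r// ?nnegrE ?mulr_ge0 ?expR_ge0//.
rewrite mulrC -ler_pdivrMr//; apply: le_trans (expR_ge1Dx _).
by rewrite lerDr.
Qed.

Lemma expinv_le n x : 0 <= x -> expinv n x <= n.+1%:R ^+ n.+1 * x.
Proof.
move=> x0; rewrite /expinv; case: ifPn => [{}x0|]; last by rewrite mulr_ge0 ?exprn_ge0.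
have xV : 0 <= x^-1 by rewrite invr_ge0 ltW.
have := exprn_expRN_le n.+1 xV; rewrite exprSr mulrAC -ler_pdivlMr ?invr_gt0//.
by rewrite invrK.
Qed.

Lemma is_derive_expinv n x :
  is_derive x 1 (expinv n) (expinv n.+2 x - n%:R * expinv n.+1 x).
Proof.
have [x0|x0|->] := ltgtP x 0.
- rewrite !expinv_le0 ?ltW// mulr0 subr0.
  apply: (@near_eq_is_derive _ _ _ (cst 0)).
  by near=> y; rewrite expinv_le0// ltW//; near: y; exact: lt_nbhsl.
- have dV : is_derive x 1 (fun y : R => y^-1) (- x ^- 2).
    have D := @is_deriveV R id x 1 1 (lt0r_neq0 x0) (is_derive_id _ _).
    by apply: (is_derive_eq D); rewrite /GRing.scale/= mulr1.
  have dE : is_derive x 1 (fun y : R => expR (- y^-1)) (x ^- 2 * expR (- x^-1)).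
    have D := @is_derive1_comp R expR (fun y => - y^-1) x _ _ (is_derive_expR _) (is_deriveN dV).
    by apply: (is_derive_eq D); rewrite opprK mulrC.
  have dX := @is_deriveX _ _ (fun y : R => y^-1) n x 1 _ dV.
  have dXE := is_deriveM dX dE.
  apply: (@near_eq_is_derive _ _ _ ((fun y : R => y^-1) ^+ n * (fun y : R => expR (- y^-1)))).
    near=> y; have y0 : 0 < y by near: y; exact: lt_nbhsr.
    by rewrite expinv_gt0E// !fctE.
  apply: (is_derive_eq dXE); rewrite !expinv_gt0E// /GRing.scale/= !fctE.
  case: n {dX dXE} => [|n]; first by rewrite /= !mul0r mulr0 addr0 subr0 expr0 mul1r exprVn.
  rewrite -[n.+1.-1]/n !exprS exprVn; by field; rewrite expf_neq0 ?lt0r_neq0.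
- rewrite (expinv_le0 _ (lexx 0)) (expinv_le0 _ (lexx 0)) mulr0 subr0.
  have h : h^-1 *: ((expinv n \o shift 0) (h *: 1) - expinv n 0) @[h --> 0^'] --> (0 : R).
    apply/cvgrPdist_le => e e0 /=; pose C : R := n.+2%:R ^+ n.+2.
    have C0 : 0 < C by rewrite exprn_gt0.
    near=> h; rewrite sub0r normrN (expinv_le0 _ (lexx 0)) subr0 addr0 /GRing.scale/= mulr1.
    have [h0|h0] := leP h 0; first by rewrite expinv_le0// mulr0 normr0 ltW.
    (* The difference quotient at 0 belongs to the same family with index n.+1, whose linear bound
       [expinv_le] has the constant [C]. *)
    have -> : h^-1 * expinv n h = expinv n.+1 h by rewrite !expinv_gt0E// exprS mulrA.
    rewrite ger0_norm ?expinv_ge0//; apply: (le_trans (expinv_le _ (ltW h0))).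
    rewrite -/C mulrC -ler_pdivlMr//; apply: le_trans (ler_norm _) _; apply/ltW.
    near: h; apply: dnbhs0_lt; by rewrite divr_gt0.
  apply: DeriveDef; first by apply/cvg_ex; exists 0.
  exact: cvg_lim h.
Unshelve. all: by end_near. Qed.

(** An algebra of functions stable under differentiation. Smoothness of its members then follows by
    induction on the order, with no formula for higher derivatives. *)
Inductive expinv_span : (R -> R) -> Prop :=
| ES_base n k c : expinv_span (fun x => expinv n (k * x + c))
| ES_scale a f : expinv_span f -> expinv_span (fun x => a * f x)
| ES_add f g : expinv_span f -> expinv_span g -> expinv_span (fun x => f x + g x)
| ES_mul f g : expinv_span f -> expinv_span g -> expinv_span (fun x => f x * g x).

Lemma expinv_span_derive f : expinv_span f ->
  (forall x, derivable f x 1) /\ expinv_span (derive1 f).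
Proof.
have derE h h' : (forall x, is_derive x 1 h (h' x)) -> expinv_span h' ->
    (forall x, derivable h x 1) /\ expinv_span (derive1 h).
  move=> dh Sh'; split => [x|]; first by have [] := dh x.
  suff -> : derive1 h = h' by [].
  by apply/funext => x; rewrite derive1E; have [] := dh x.
elim => {f} [n k c|a f _ [df Sf]|f g _ [df Sf] _ [dg Sg]|f g Sf0 [df Sf] Sg0 [dg Sg]].
- apply: (derE _ (fun x => k * (expinv n.+2 (k * x + c) + (- n%:R) * expinv n.+1 (k * x + c)))).
    move=> x.
    have d : is_derive x 1 (fun y => k * y + c) k.
      have D := is_deriveD (is_deriveZ k (is_derive_id x 1)) (is_derive_cst c x 1).
      by apply: (is_derive_eq D); rewrite /GRing.scale/= mulr1 addr0.
    have D := @is_derive1_comp R (expinv n) (fun y => k * y + c) x _ _ (is_derive_expinv n (k * x + c)) d.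
    by apply: (is_derive_eq D); rewrite mulrC mulNr.
  by apply: ES_scale; apply: ES_add; [exact: ES_base|apply: ES_scale; exact: ES_base].
- apply: (derE (fun x => a * f x) (fun x => a * derive1 f x)); last exact: ES_scale.
  move=> x; have dfx : is_derive x 1 f (derive1 f x) by rewrite derive1E; exact/derivableP.
  by have := is_deriveZ a dfx.
- apply: (derE (fun x => f x + g x) (fun x => derive1 f x + derive1 g x)); last exact: ES_add.
  move=> x; have dfx : is_derive x 1 f (derive1 f x) by rewrite derive1E; exact/derivableP.
  have dgx : is_derive x 1 g (derive1 g x) by rewrite derive1E; exact/derivableP.
  by have := is_deriveD dfx dgx.
- apply: (derE (fun x => f x * g x) (fun x => f x * derive1 g x + g x * derive1 f x)).
    move=> x; have dfx : is_derive x 1 f (derive1 f x) by rewrite derive1E; exact/derivableP.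
    have dgx : is_derive x 1 g (derive1 g x) by rewrite derive1E; exact/derivableP.
    by have := is_deriveM dfx dgx.
  by apply: ES_add; exact: ES_mul.
Qed.

Lemma expinv_span_smooth f : expinv_span f -> forall n x, derivable (f^`(n)) x 1.
Proof.
move=> Sf n; have : expinv_span (f^`(n)).
  by elim: n => [//|n /expinv_span_derive[]]; rewrite derive1nS.
by move=> /expinv_span_derive[].
Qed.

Definition bump (k a b x : R) := expinv 0 (k * (x - a)) * expinv 0 (k * (b - x)).

Definition dbump (k a b x : R) :=
  k * expinv 2 (k * (x - a)) * expinv 0 (k * (b - x))
  - expinv 0 (k * (x - a)) * (k * expinv 2 (k * (b - x))).

Lemma is_derive_bump_left k a x :
  is_derive x 1 (fun y => expinv 0 (k * (y - a))) (k * expinv 2 (k * (x - a))).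
Proof.
have d : is_derive x 1 (fun y => k * (y - a)) k.
  have D := is_deriveZ k (is_deriveB (is_derive_id x 1) (is_derive_cst a x 1)).
  by apply: (is_derive_eq D); rewrite /GRing.scale/= subr0 mulr1.
have D := @is_derive1_comp R (expinv 0) (fun y => k * (y - a)) x _ _ (is_derive_expinv 0 (k * (x - a))) d.
by apply: (is_derive_eq D); rewrite mul0r subr0 mulrC.
Qed.

Lemma is_derive_bump_right k b x :
  is_derive x 1 (fun y => expinv 0 (k * (b - y))) (- (k * expinv 2 (k * (b - x)))).
Proof.
have d : is_derive x 1 (fun y => k * (b - y)) (- k).
  have D := is_deriveZ k (is_deriveB (is_derive_cst b x 1) (is_derive_id x 1)).
  by apply: (is_derive_eq D); rewrite /GRing.scale/= sub0r mulrN1.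
have D := @is_derive1_comp R (expinv 0) (fun y => k * (b - y)) x _ _ (is_derive_expinv 0 (k * (b - x))) d.
by apply: (is_derive_eq D); rewrite mul0r subr0 mulrN mulrC.
Qed.

Lemma derive1_bump k a b : (bump k a b)^`() = dbump k a b.
Proof.
apply/funext => x; rewrite derive1E.
have [_ ->] := is_deriveM (is_derive_bump_left k a x) (is_derive_bump_right k b x).
by rewrite /dbump /GRing.scale/= mulrN addrC [X in X - _ = _]mulrC.
Qed.

Lemma bump_outside k a b x : 0 < k -> ~~ (a < x < b) -> bump k a b x = 0.
Proof.
move=> k0; rewrite negb_and -!leNgt /bump => /orP[xa|bx].
  by rewrite expinv_le0 ?mul0r// pmulr_rle0// subr_le0.
by rewrite [X in _ * X]expinv_le0 ?mulr0// pmulr_rle0// subr_le0.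
Qed.

Lemma test_function_bump k a b : 0 < k -> 0 < a -> b < 1 -> test_function (bump k a b).
Proof.
move=> k0 a0 b1.
have supp : closure [set x | bump k a b x != 0] `<=` `[a, b].
  rewrite closureE; apply: smallest_sub; first exact: itv_closed.
  move=> x /=; apply: contra_neqP => /= xab; apply: bump_outside => //.
  apply: contra_notN xab => /andP[ax xb]; by rewrite in_itv/= !ltW.
split.
- apply: expinv_span_smooth.
  rewrite (_ : bump k a b = fun x => expinv 0 (k * x + (- (k * a))) * expinv 0 ((- k) * x + k * b)).
    by apply: ES_mul; exact: ES_base.
  by apply/funext => x; rewrite /bump; congr (expinv _ _ * expinv _ _); ring.
- apply: (subclosed_compact _ (@segment_compact _ a b) supp); exact: closed_closure.
- by move=> x /supp/=; rewrite /I01/= !in_itv/= => /andP[ax xb]; rewrite (lt_le_trans a0)// (le_lt_trans xb).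
Qed.

Lemma cvg_expinv0 t : 0 < t -> expinv 0 (n.+1%:R * t) @[n --> \oo] --> (1 : R).
Proof.
move=> t0.
have -> : (fun n : nat => expinv 0 (n.+1%:R * t)) = fun n => expR (- (n.+1%:R^-1 * t^-1)).
  by apply/funext => n; rewrite expinv_gt0E ?mulr_gt0// expr0 mul1r invfM.
have h : n.+1%:R^-1 * t^-1 @[n --> \oo] --> (0 : R).
  rewrite -[X in _ --> X](mul0r t^-1); apply: cvgM; last exact: cvg_cst.
  exact: cvg_harmonic.
rewrite -[X in _ --> X]expR0 -[X in expR X]oppr0; apply: continuous_cvg.
  exact: continuous_expR.
exact: cvgN.
Qed.

Lemma continuous_expinv n : continuous (expinv n).
Proof. by move=> x; apply/differentiable_continuous/derivable1_diffP; have [] := is_derive_expinv n x. Qed.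

Lemma expinv2_le x : 0 < x -> expinv 2 x <= x ^- 2.
Proof.
move=> x0; rewrite expinv_gt0E// exprVn ler_piMr ?invr_ge0 ?exprn_ge0 ?ltW//.
by rewrite -expR0 ltr_expR oppr_lt0 invr_gt0.
Qed.

End expinv.

(** * Approximate identities at the ends of an interval *)

Section weak_ftc.
Context {R : realType}.
Notation mu := (@lebesgue_measure R).
Implicit Types (a b c : R) (f g u : R -> R).

Lemma itv_subset_I01 a b : 0 < a -> b < 1 -> `[a, b]%classic `<=` @I01 R.
Proof.
move=> a0 b1 x /=; rewrite /I01/= !in_itv/= => /andP[ax xb].
by rewrite (lt_le_trans a0)// (le_lt_trans xb).
Qed.

(** An approximate identity whose mass gathers at [c], possibly an endpoint outside the open
    interval. The integrand [G] varies with n to accommodate the second factor of [bump], so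
    closeness to [l] near [c] is asked for all large n at once. *)
Lemma concentration (a b c M l : R) (W G : nat -> R -> R) (w : nat -> R) :
    (forall n, mu.-integrable `]a, b[ (EFin \o W n)) ->
    (forall n, measurable_fun `]a, b[ (G n)) ->
    (forall n x, 0 <= W n x) ->
    (forall n x, x \in `]a, b[ -> W n x <= n.+1%:R^-1 / (x - c) ^+ 2) ->
    (forall n, \int[mu]_(x in `]a, b[) W n x = w n) ->
    (forall n, w n <= 1) -> w @ \oo --> (1 : R) ->
    (forall n x, x \in `]a, b[ -> `|G n x| <= M) ->
    (forall e : R, 0 < e -> exists2 d : R, 0 < d & \forall n \near \oo,
      forall x, x \in `]a, b[ -> `|x - c| < d -> `|G n x - l| <= e) ->
  \int[mu]_(x in `]a, b[) (G n x * W n x) @[n --> \oo] --> l.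
Proof.
move=> iW mG W0 Wc intW w1 cw GM Gl.
have mab : measurable (`]a, b[%classic : set (measurableTypeR R)) by exact: measurable_itv.
have mW n : measurable_fun `]a, b[ (W n) by apply/measurable_EFinP; exact: measurable_int (iW n).
pose M' := Num.max M 0 + `|l|.
have M'0 : 0 <= M' by rewrite addr_ge0// le_max lexx orbT.
have GlM n x : x \in `]a, b[ -> `|G n x - l| <= M'.
  move=> xab; apply: (le_trans (ler_normB _ _)); rewrite lerD2r le_max.
  by rewrite GM.
have iGl n : mu.-integrable `]a, b[ (EFin \o (fun x => (G n x - l) * W n x)).
  apply: (@le_integrable _ _ _ mu _ mab _ (EFin \o (fun x => M' * W n x))).
  - apply/measurable_EFinP; apply: measurable_funM; last exact: mW.
    by apply: measurable_funB; [exact: mG|exact: measurable_cst].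
  - move=> x xab.
    rewrite /comp !abse_EFin lee_fin normrM [`|W n x|]ger0_norm// [leRHS]ger0_norm ?mulr_ge0//.
    by rewrite ler_wpM2r// GlM//; exact: mem_set.
  - rewrite (_ : _ \o _ = (fun x => M'%:E * (EFin \o W n) x)%E)//.
    exact: integrableZl.
have ilW n : mu.-integrable `]a, b[ (EFin \o (fun x => l * W n x)).
  rewrite (_ : _ \o _ = (fun x => l%:E * (EFin \o W n) x)%E)//.
  exact: integrableZl.
have split n : \int[mu]_(x in `]a, b[) (G n x * W n x) =
    \int[mu]_(x in `]a, b[) ((G n x - l) * W n x) + l * w n.
  rewrite -intW -RintegralZl//; rewrite -RintegralD//.
  by apply: eq_Rintegral => x _; rewrite -mulrDl subrK.
rewrite (_ : (fun n => _) = (fun n => \int[mu]_(x in `]a, b[) ((G n x - l) * W n x) + l * w n)); last first.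
  by apply/funext.
suff h0 : \int[mu]_(x in `]a, b[) ((G n x - l) * W n x) @[n --> \oo] --> (0 : R).
  have := cvgD h0 (cvgM (cvg_cst l) cw); rewrite add0r mulr1; exact.
apply/cvgrPdist_le => e e0; have e20 : 0 < e / 2 by rewrite divr_gt0.
have [d d0 hd] := Gl _ e20.
pose K := M' / d ^+ 2 * fine (mu `]a, b[).
have hK : \forall n \near \oo, n.+1%:R^-1 * K <= e / 2.
  have : n.+1%:R^-1 * K @[n --> \oo] --> 0 * K.
    by apply: cvgM; [exact: cvg_harmonic|exact: cvg_cst].
  rewrite mul0r => /cvgrPdist_le/(_ _ e20); apply: filterS => n.
  by rewrite sub0r normrN; apply: le_trans; exact: ler_norm.
near=> n; rewrite sub0r normrN.
have hdn : forall x, x \in `]a, b[ -> `|x - c| < d -> `|G n x - l| <= e / 2 by near: n.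
apply: (le_trans (le_normr_Rintegral mab (iGl n))).
have ic : mu.-integrable `]a, b[ (EFin \o cst (n.+1%:R^-1 * (M' / d ^+ 2))).
  apply/integrableP; split; first by apply/measurable_EFinP; exact: measurable_cst.
  have := @integral_cst _ _ _ mu _ mab (`|n.+1%:R^-1 * (M' / d ^+ 2)|%:E).
  rewrite /cst/comp/= => ->; rewrite lte_mul_pinfty// ?lee_fin//.
  by rewrite lebesgue_measure_itv/=; case: ifP => _; rewrite ltry.
have ieW : mu.-integrable `]a, b[ (EFin \o (fun x => e / 2 * W n x)).
  rewrite (_ : _ \o _ = (fun x => (e / 2)%:E * (EFin \o W n) x)%E)//.
  exact: integrableZl.
(* The first term covers |x - c| < d, where G n is close to l; the second covers |x - c| >= d, where
   W n <= 1 / ((n + 1) d^2). Both are nonnegative, so their sum works everywhere. *)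
apply: (@le_trans _ _ (\int[mu]_(x in `]a, b[)
    (e / 2 * W n x + n.+1%:R^-1 * (M' / d ^+ 2)))).
  apply: le_Rintegral => //.
  - exact: integrable_norm (iGl n).
  - have := integrableD mab ieW ic; apply: eq_integrable => // x _.
  - move=> x xab; rewrite normrM [`|W n x|]ger0_norm//.
    have {}xab : x \in `]a, b[ by exact: mem_set.
    have [xd|dx] := ltP `|x - c| d.
      rewrite -[leLHS]addr0; apply: lerD; first by rewrite ler_wpM2r// hdn.
      by rewrite mulr_ge0 ?invr_ge0// divr_ge0// exprn_ge0// ltW.
    rewrite -[leLHS]add0r; apply: lerD; first by rewrite mulr_ge0// ltW.
    rewrite mulrCA; apply: ler_pM => //; first exact: GlM.
    apply: (le_trans (Wc _ _ xab)); rewrite ler_wpM2l ?invr_ge0//.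
    rewrite -(real_normK (num_real (x - c))) lef_pV2 ?posrE ?exprn_gt0//; last first.
      exact: lt_le_trans dx.
    by rewrite ler_pXn2r ?nnegrE// ltW.
rewrite RintegralD// RintegralZl// intW Rintegral_cst//.
rewrite [leRHS]splitr; apply: lerD; first by rewrite ler_piMr// ltW.
rewrite -mulrA; near: n; exact: hK.
Unshelve. all: by end_near. Qed.

Lemma expinv0_homo (x y : R) : x <= y -> expinv 0 x <= expinv 0 y.
Proof.
move=> xy; have [x0|x0] := leP x 0; first by rewrite expinv_le0// expinv_ge0.
rewrite !expinv_gt0E ?(lt_le_trans x0 xy)// !expr0 !mul1r ler_expR lerN2.
by rewrite lef_pV2 ?posrE// (lt_le_trans x0 xy).
Qed.

Lemma is_derive_expinv0_affine (k s c x : R) :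
  is_derive x 1 (fun y => expinv 0 (k * (s * (y - c)))) (s * (k * expinv 2 (k * (s * (x - c))))).
Proof.
have d : is_derive x 1 (fun y => k * (s * (y - c))) (k * s).
  have D := is_deriveZ k (is_deriveZ s (is_deriveB (is_derive_id x 1) (is_derive_cst c x 1))).
  by apply: (is_derive_eq D); rewrite /GRing.scale/= subr0 mulr1.
have D := @is_derive1_comp R (expinv 0) (fun y => k * (s * (y - c))) x _ _ (is_derive_expinv 0 (k * (s * (x - c)))) d.
by apply: (is_derive_eq D); rewrite mul0r subr0; ring.
Qed.

(** Up to the sign [s], the derivative of one factor of [bump]: s = 1 for the factor rising from a
    left end [c], s = -1 for its mirror image at a right end. The value is nonnegative in both
    cases. *)
Definition peak (s c : R) n (x : R) := n.+1%:R * expinv 2 (n.+1%:R * (s * (x - c))).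

Lemma continuous_peak s c n : continuous (peak s c n).
Proof.
move=> x; apply: cvgM; first exact: cvg_cst.
apply: continuous_cvg; first exact: continuous_expinv.
apply: cvgM; first exact: cvg_cst.
apply: cvgM; first exact: cvg_cst.
by apply: cvgB; [exact: cvg_id|exact: cvg_cst].
Qed.

Lemma integral_peak s c n a b : s ^+ 2 = 1 -> a < b ->
  (\int[mu]_(x in `[a, b]) (peak s c n x)%:E =
   (s * expinv 0 (n.+1%:R * (s * (b - c))) - s * expinv 0 (n.+1%:R * (s * (a - c))))%:E)%E.
Proof.
move=> s2 ab.
pose F x := s * expinv 0 (n.+1%:R * (s * (x - c))).
have dF (x : R) : is_derive x 1 F (peak s c n x).
  have D := is_deriveZ s (is_derive_expinv0_affine n.+1%:R s c x).
  by apply: (is_derive_eq D); rewrite /GRing.scale/= /peak -[RHS]mul1r -s2; ring.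
have dF1 (x : R) : derivable F x 1 by have [] := dF x.
have cF : continuous F.
  by move=> x; apply/differentiable_continuous/derivable1_diffP; exact: dF1.
have := @continuous_FTC2 R (peak s c n) F a b ab; rewrite EFinB => -> //.
- by apply: continuous_subspaceT; exact: continuous_peak.
- split; first by move=> x _; exact: dF1.
  + by apply: cvg_at_right_filter; exact: cF.
  + by apply: cvg_at_left_filter; exact: cF.
- by move=> x _; rewrite derive1E; have [_ ->] := dF x.
Qed.

(** Here [c'] is the endpoint opposite to [c]. The peak has mass [expinv 0] of (n + 1)(b - a),
    tending to 1, and the factor attached to [c'] tends to 1 uniformly near [c]. *)
Lemma cvg_peak (a b s c c' : R) f : a < b ->
    [/\ s = 1, c = a & c' = b] \/ [/\ s = -1, c = b & c' = a] ->
    {within `[a, b], continuous f} ->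
  \int[mu]_(x in `]a, b[)
    (f x * expinv 0 (n.+1%:R * (s * (c' - x))) * peak s c n x) @[n --> \oo] --> f c.
Proof.
move=> ab cas cf.
have [cfo cfa cfb] := (continuous_within_itvP f ab).1 cf.
have s2 : s ^+ 2 = 1 by case: cas => -[-> _ _]; rewrite ?sqrrN expr1n.
have dist x : x \in `]a, b[ -> s * (x - c) = `|x - c| /\ 0 < `|x - c|.
  rewrite inE/= in_itv/= => /andP[ax xb]; case: cas => -[-> -> _].
    by rewrite mul1r gtr0_norm ?subr_gt0.
  by rewrite mulN1r ltr0_norm ?subr_lt0// oppr_gt0 subr_lt0.
have dist' x : x \in `]a, b[ -> s * (c' - x) = (b - a) - `|x - c|.
  move=> /dist[<- _]; case: cas => -[-> -> ->]; ring.
have mab : measurable (`]a, b[%classic : set (measurableTypeR R)) by exact: measurable_itv.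
have [M fM] : exists M, forall x, x \in `[a, b] -> `|f x| <= M.
  have cnf : {within `[a, b], continuous (fun x => `|f x|)}.
    by move=> x; apply: cvg_norm; exact: cf.
  by have [x _ hx] := EVT_max (ltW ab) cnf; exists `|f x| => y; rewrite inE; exact: hx.
have fM' x : x \in `]a, b[ -> `|f x| <= M.
  by move=> xab; apply: fM; move: xab; rewrite !inE/= !in_itv/= => /andP[/ltW -> /ltW ->].
have mf : measurable_fun `]a, b[ f.
  apply: measurable_funS (subspace_continuous_measurable_fun _ cf); [by []| |by []].
  exact: subset_itv_oo_cc.
have cpk n : measurable_fun setT (peak s c n : R -> R).
  by apply: continuous_measurable_fun; exact: continuous_peak.
have ce n : measurable_fun setT (fun x : R => expinv 0 (n.+1%:R * (s * (c' - x)))).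
  apply: continuous_measurable_fun => x; apply: continuous_cvg; first exact: continuous_expinv.
  apply: cvgM; first exact: cvg_cst.
  apply: cvgM; first exact: cvg_cst.
  by apply: cvgB; [exact: cvg_cst|exact: cvg_id].
have M0 : 0 <= M.
  by apply: (le_trans (normr_ge0 (f a))); apply: fM; rewrite inE/= in_itv/= lexx ltW.
apply: (@concentration a b c M (f c) (peak s c)
  (fun n x => f x * expinv 0 (n.+1%:R * (s * (c' - x)))) (fun n => expinv 0 (n.+1%:R * (b - a)))).
- move=> n; apply: (@integrableS _ _ _ mu `[a, b]) => //; first exact: subset_itv_oo_cc.
  apply: continuous_compact_integrable; first exact: segment_compact.
  by apply: continuous_subspaceT; exact: continuous_peak.
- by move=> n; apply: measurable_funM => //; apply: measurable_funTS.
- by move=> n x; rewrite mulr_ge0// expinv_ge0.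
- move=> n x /dist[sx x0]; rewrite /peak sx.
  apply: (@le_trans _ _ (n.+1%:R * (n.+1%:R * `|x - c|) ^- 2)).
    by rewrite ler_wpM2l// expinv2_le// mulr_gt0.
  rewrite exprMn real_normK ?num_real// invfM mulrA expr2 invfM mulrA mulfV ?mul1r//.
- move=> n; rewrite /Rintegral -(@integral_itv_bndoo _ _ _ _ true false); last first.
    by apply/measurable_EFinP; exact: measurable_funTS.
  rewrite integral_peak//=.
  case: cas => -[-> -> _]; first by rewrite subrr !mulr0 !mul1r (expinv_le0 _ (lexx 0)) subr0.
  by rewrite subrr !mulr0 (expinv_le0 _ (lexx 0)) mulr0 sub0r !mulN1r opprB opprK.
- by move=> n; exact: expinv0_le1.
- by apply: cvg_expinv0; rewrite subr_gt0.
- move=> n x xab; rewrite normrM -[M]mulr1 ler_pM// ?fM'//.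
  by rewrite ger0_norm ?expinv_ge0// expinv0_le1.
- move=> e e0; have e20 : 0 < e / 2 by rewrite divr_gt0.
  have [d d0 hd] : exists2 d : R, 0 < d &
      forall x, x \in `]a, b[ -> `|x - c| < d -> `|f x - f c| <= e / 2.
    have ex P : (\forall x \near c, P x) ->
        exists2 d : R, 0 < d & forall x, `|x - c| < d -> P x.
      by move=> [d /= d0 hd]; exists d => // x xd; apply: hd; rewrite /= distrC.
    have : \forall x \near c, x \in `]a, b[ -> `|f x - f c| <= e / 2.
      case: cas => -[_ -> _].
        move/cvgrPdist_le : cfa => /(_ _ e20); rewrite near_withinE; apply: filterS => x h.
        by rewrite inE/= in_itv/= => /andP[ax _]; rewrite distrC; exact: h.
      move/cvgrPdist_le : cfb => /(_ _ e20); rewrite near_withinE; apply: filterS => x h.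
      by rewrite inE/= in_itv/= => /andP[_ xb]; rewrite distrC; exact: h.
    by move=> /ex[d d0 hd]; exists d => // x xab xd; exact: hd.
  (* In the half of the interval next to [c] the distance to [c'] is at least (b - a) / 2, so
     monotonicity of [expinv 0] bounds the opposite factor below independently of x. *)
  exists (Num.min d ((b - a) / 2)); first by rewrite lt_min d0 divr_gt0 ?subr_gt0.
  have ba2 : 0 < (b - a) / 2 by rewrite divr_gt0 ?subr_gt0.
  have : M * (1 - expinv 0 (n.+1%:R * ((b - a) / 2))) @[n --> \oo] --> M * (1 - 1).
    apply: cvgM; first exact: cvg_cst.
    by apply: cvgB; [exact: cvg_cst|exact: cvg_expinv0].
  rewrite subrr mulr0 => /cvgrPdist_le/(_ _ e20); apply: filterS => n hn x xab.
  rewrite lt_min => /andP[xd xba].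
  set L := expinv 0 _.
  have L1 : L <= 1 by exact: expinv0_le1.
  have hL : expinv 0 (n.+1%:R * ((b - a) / 2)) <= L.
    by apply: expinv0_homo; rewrite ler_wpM2l// dist'//; lra.
  have -> : f x * L - f c = (f x - f c) - f x * (1 - L) by ring.
  rewrite (splitr e) (le_trans (ler_normB _ _))// lerD//; first exact: hd.
  rewrite sub0r normrN in hn; apply: le_trans (le_trans _ (ler_norm _)) hn.
  rewrite normrM; apply: ler_pM => //; first exact: fM'.
  by rewrite ger0_norm ?subr_ge0// lerD2l lerN2.
Qed.

End weak_ftc.

(** * Weak derivatives on the unit interval *)

Section weak_derivatives.
Context {R : realType}.
Notation mu := (@lebesgue_measure R).
Implicit Types (a b c : R) (f g u : R -> R).

Lemma aeS (P Q : R -> Prop) : (forall x, P x -> Q x) ->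
  {ae mu, forall x, P x} -> {ae mu, forall x, Q x}.
Proof. by apply: filterS; exact: (ae_filter_ringOfSetsType mu). Qed.

Lemma ae_aeW (P : R -> Prop) : (forall x, P x) -> {ae mu, forall x, P x}.
Proof. by apply: filterE; exact: (ae_filter_ringOfSetsType mu). Qed.

Lemma ae01S (P Q : R -> Prop) : (forall x, I01 x -> P x -> Q x) ->
  ae01 P -> ae01 Q.
Proof. by move=> PQ; apply: aeS => x h /[dup] /h Px Ix; exact: PQ. Qed.

Lemma ae01I (P Q : R -> Prop) : ae01 P -> ae01 Q -> ae01 (fun x => P x /\ Q x).
Proof.
rewrite /ae01 => aP aQ.
have FF := ae_filter_ringOfSetsType mu.
by apply: (@filterS2 _ _ FF _ _ _ _ aP aQ) => x h h' Ix; split; [exact: h|exact: h'].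
Qed.

Lemma measurable_I01 : measurable (I01 : set (measurableTypeR R)).
Proof. exact: measurable_itv. Qed.

Lemma L1loc01_compact u (K : set R) : L1loc01 u -> K `<=` I01 -> compact K ->
  mu.-integrable K (EFin \o u).
Proof.
move=> [mu_ _ iu] KI cK; apply/integrableP; split; last exact: iu.
apply/measurable_EFinP; apply: measurable_funS mu_ => //; exact: measurable_I01.
Qed.

Lemma L1loc01_itv u a b : L1loc01 u -> 0 < a -> b < 1 ->
  mu.-integrable `[a, b] (EFin \o u).
Proof.
move=> Lu a0 b1; apply: L1loc01_compact => //; first exact: itv_subset_I01.
exact: segment_compact.
Qed.

Lemma measurable_L1loc01 u : L1loc01 u -> measurable_fun I01 u.
Proof. by case. Qed.

Lemma Rintegral_support (A B : set (measurableTypeR R)) (h : R -> R) :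
  A `<=` B -> (forall x, B x -> ~ A x -> h x = 0) ->
  \int[mu]_(x in B) h x = \int[mu]_(x in A) h x.
Proof.
move=> AB h0; rewrite Rintegral_mkcond [RHS]Rintegral_mkcond.
congr (Rintegral _ _ _); apply/funext => x; rewrite !patchE.
case: ifPn => [|/negP] xB; case: ifPn => [|/negP] xA //.
- by apply: h0; [exact: set_mem|move=> /mem_set].
- by case: xB; apply/mem_set/AB/set_mem.
Qed.

Lemma ae_eq_Rintegral (A : set (measurableTypeR R)) (h h' : R -> R) : measurable A ->
  measurable_fun A h -> measurable_fun A h' -> {ae mu, forall x, A x -> h x = h' x} ->
  \int[mu]_(x in A) h x = \int[mu]_(x in A) h' x.
Proof.
move=> mA mh mh' hh'; congr fine; apply: ae_eq_integral => //.
- exact/measurable_EFinP.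
- exact/measurable_EFinP.
- by apply: filterS hh' => x /[apply] ->.
Qed.

(** The derivative of [bump] is a peak at [a] minus a peak at [b], so the left side of the weak
    formulation tends to f a - f b, while on the right [bump] tends to 1 on the interval. The
    continuous [f] replaces [g] because the limit evaluates at single points. *)
Theorem weak_derivative_ftc g f u a b :
    is_weak_derivative g u -> {within `[a, b], continuous f} ->
    ae01 (fun x => f x = g x) -> 0 < a -> a < b -> b < 1 ->
  \int[mu]_(x in `]a, b[) u x = f b - f a.
Proof.
move=> [Lg Lu wd] cf fg a0 ab b1.
have mab : measurable (`]a, b[%classic : set (measurableTypeR R)) by exact: measurable_itv.
have abI : `]a, b[%classic `<=` @I01 R.
  by apply: subset_trans (itv_subset_I01 a0 b1); exact: subset_itv_oo_cc.
have mf : measurable_fun `]a, b[ f.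
  apply: measurable_funS (subspace_continuous_measurable_fun _ cf); [by []| |by []].
  exact: subset_itv_oo_cc.
have mg : measurable_fun `]a, b[ g.
  by apply: measurable_funS (measurable_L1loc01 Lg) => //; exact: measurable_I01.
have mu_ : measurable_fun `]a, b[ u.
  by apply: measurable_funS (measurable_L1loc01 Lu) => //; exact: measurable_I01.
have iu : mu.-integrable `]a, b[ (EFin \o u).
  apply: (@integrableS _ _ _ mu `[a, b]) => //; first exact: subset_itv_oo_cc.
  exact: L1loc01_itv.
pose k (n : nat) : R := n.+1%:R.
have k0 n : 0 < k n by [].
have out n x : ~ `]a, b[%classic x -> bump (k n) a b x = 0 /\ dbump (k n) a b x = 0.
  move=> /negP xab; rewrite /= in_itv/= in xab.
  split; first exact: bump_outside.
  move: xab; rewrite negb_and -!leNgt /dbump => /orP[xa|bx].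
    by rewrite !(@expinv_le0 _ _ (k n * (x - a))) ?mulr0 ?mul0r ?subrr// pmulr_rle0// subr_le0.
  by rewrite !(@expinv_le0 _ _ (k n * (b - x))) ?mulr0 ?mul0r ?subrr// pmulr_rle0// subr_le0.
have cb n : continuous (bump (k n) a b).
  by move=> x; apply/differentiable_continuous/derivable1_diffP;
    have [/(_ 0%N x)] := test_function_bump (k0 n) a0 b1.
(* The two terms of [dbump], in the signed form of [peak]: 1 * (b - x) and -1 * (a - x) are the
   distances to the opposite ends. *)
have lhsE n : \int[mu]_(x in I01) (g x * derive1 (bump (k n) a b) x) =
    \int[mu]_(x in `]a, b[) (f x * expinv 0 (k n * (1 * (b - x))) * peak 1 a n x) -
    \int[mu]_(x in `]a, b[) (f x * expinv 0 (k n * (-1 * (a - x))) * peak (-1) b n x).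
  rewrite derive1_bump (@Rintegral_support `]a, b[)//; last first.
    by move=> x _ /(out n)[_ ->]; rewrite mulr0.
  have cfE s c c' : {within `[a, b], continuous (fun x => f x * expinv 0 (k n * (s * (c' - x))) * peak s c n x)}.
    have cp : {within `[a, b], continuous (peak s c n)}.
      by apply: continuous_subspaceT; exact: continuous_peak.
    have ce : {within `[a, b], continuous (fun x : R => expinv 0 (k n * (s * (c' - x))))}.
      apply: continuous_subspaceT => x.
      apply: continuous_cvg; first exact: continuous_expinv.
      apply: cvgM; first exact: cvg_cst.
      apply: cvgM; first exact: cvg_cst.
      by apply: cvgB; [exact: cvg_cst|exact: cvg_id].
    by move=> x; apply: cvgM; [apply: cvgM; [exact: cf|exact: ce]|exact: cp].
  have ifE s c c' : mu.-integrable `]a, b[ (EFin \o (fun x => f x * expinv 0 (k n * (s * (c' - x))) * peak s c n x)).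
    apply: (@integrableS _ _ _ mu `[a, b]) => //; first exact: subset_itv_oo_cc.
    by apply: continuous_compact_integrable => //; exact: segment_compact.
  rewrite -RintegralB//; transitivity (\int[mu]_(x in `]a, b[) (f x * dbump (k n) a b x)).
    apply: ae_eq_Rintegral => //.
    - apply: measurable_funM => //; apply: measurable_funTS.
      rewrite -derive1_bump; apply: continuous_measurable_fun => x.
      apply/differentiable_continuous/derivable1_diffP.
      by have [/(_ 1%N x)] := test_function_bump (k0 n) a0 b1.
    - apply: measurable_funM => //; apply: measurable_funTS.
      rewrite -derive1_bump; apply: continuous_measurable_fun => x.
      apply/differentiable_continuous/derivable1_diffP.
      by have [/(_ 1%N x)] := test_function_bump (k0 n) a0 b1.
    - by apply: aeS fg => x fgx /abI/fgx ->.
  apply: eq_Rintegral => x _; rewrite /dbump /peak !mul1r !mulN1r !opprB -/(k n); ring.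
have rhsE n : \int[mu]_(x in I01) (u x * bump (k n) a b x) =
    \int[mu]_(x in `]a, b[) (u x * bump (k n) a b x).
  by apply: Rintegral_support => // x _ /(out n)[-> _]; rewrite mulr0.
have lhs_cvg : \int[mu]_(x in I01) (g x * derive1 (bump (k n) a b) x) @[n --> \oo] --> f a - f b.
  under eq_fun do rewrite lhsE.
  apply: cvgB; apply: cvg_peak => //; first by left.
  by right.
have rhs_cvg : \int[mu]_(x in I01) (u x * bump (k n) a b x) @[n --> \oo] -->
    \int[mu]_(x in `]a, b[) u x.
  under eq_fun do rewrite rhsE.
  have b01 n x : 0 <= bump (k n) a b x <= 1.
    by rewrite /bump mulr_ge0 ?expinv_ge0//= mulr_ile1 ?expinv_ge0 ?expinv0_le1.
  have h : (\int[mu]_(x in `]a, b[) (u x * bump (k n) a b x)%:E @[n --> \oo] -->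
      \int[mu]_(x in `]a, b[) (u x)%:E)%E.
    apply: (@dominated_cvg _ _ _ mu _ mab _ _ (abse \o (EFin \o u))).
    - move=> n; apply/measurable_EFinP; apply: measurable_funM => //.
      by apply: measurable_funTS; exact: continuous_measurable_fun.
    - move=> x; rewrite /= in_itv/= => /andP[ax xb]; apply/cvg_EFin; first exact: nearW.
      rewrite -[X in _ --> X]mulr1; apply: cvgM; first exact: cvg_cst.
      rewrite -[X in _ --> X]mulr1.
      by apply: cvgM; apply: cvg_expinv0; rewrite subr_gt0.
    - by [].
    - exact: integrable_abse.
    - move=> n x _ /=; rewrite lee_fin normrM ler_piMr//.
      by case/andP: (b01 n x) => b_0 b_1; rewrite ger0_norm.
  have fin : (\int[mu]_(x in `]a, b[) (u x)%:E)%E \is a fin_num by exact: integrable_fin_num.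
  by move: h; rewrite -(fineK fin) => /fine_cvgP[_].
have lhs_cvg' : \int[mu]_(x in I01) (g x * derive1 (bump (k n) a b) x) @[n --> \oo] -->
    - \int[mu]_(x in `]a, b[) u x.
  rewrite (_ : (fun n => _) = fun n => - \int[mu]_(x in I01) (u x * bump (k n) a b x)).
    exact: cvgN.
  by apply/funext => n; apply: wd; exact: test_function_bump.
have := cvg_unique _ lhs_cvg lhs_cvg'; move=> /(_ (@Rhausdorff R)) h.
by rewrite -[LHS]opprK -h opprB.
Qed.

Lemma compact_normr_bounded (K : set R) f : compact K -> {within K, continuous f} ->
  exists2 M : R, 0 <= M & forall x, K x -> `|f x| <= M.
Proof.
move=> cK cf; have /compact_bounded[M [_ hM]] := continuous_compact cf cK.
exists (`|M| + 1); first by rewrite addr_ge0.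
by move=> x Kx; apply: (hM (`|M| + 1)); [rewrite ltr_pwDr// ler_norm|exists x].
Qed.

(** This lower bound lets a weighted L^1 bound be used as an unweighted one on [K], whatever the
    sign of the exponent. *)
Lemma powR_compact_bounded (K : set R) (e : R) : compact K -> K `<=` I01 ->
  exists2 C : R, 0 <= C & forall x, K x -> 1 <= C * x `^ e.
Proof.
move=> cK KI; have I0 x : K x -> 0 < x by move=> /KI; rewrite /I01/= in_itv/= => /andP[].
have cp : {within K, continuous (fun x : R => x `^ (- e))}.
  apply: continuous_in_subspaceT => x /set_mem Kx.
  apply/differentiable_continuous/derivable1_diffP.
  by apply: derivable_powR; rewrite in_itv/= andbT I0.
have [C C0 hC] := compact_normr_bounded cK cp; exists C => // x Kx.
have := hC _ Kx; rewrite ger0_norm ?powR_ge0// powRN.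
by rewrite -ler_pdivrMr ?powR_gt0 ?I0// div1r.
Qed.

Lemma test_functionP (phi : R -> R) : test_function phi ->
  exists2 K : set R, compact K /\ K `<=` I01 &
    exists2 M : R, 0 <= M & forall x, (K x -> `|phi x| <= M /\ `|derive1 phi x| <= M) /\
                                     (~ K x -> phi x = 0 /\ derive1 phi x = 0).
Proof.
move=> [dphi cK KI]; set K := closure _ in cK KI; exists K => //.
have c0 : continuous phi.
  by move=> x; apply/differentiable_continuous/derivable1_diffP; exact: (dphi 0%N).
have c1 : continuous (derive1 phi).
  by move=> x; apply/differentiable_continuous/derivable1_diffP; exact: (dphi 1%N).
have [M0 M00 hM0] := compact_normr_bounded cK (continuous_subspaceT c0).
have [M1 M10 hM1] := compact_normr_bounded cK (continuous_subspaceT c1).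
exists (M0 + M1); first by rewrite addr_ge0.
have z x : ~ K x -> phi x = 0.
  move=> nKx; apply/eqP; apply: contrapT => /negP h; apply: nKx.
  exact: subset_closure.
move=> x; split => [Kx|nKx].
  by split; [rewrite (le_trans (hM0 _ Kx))// lerDl|rewrite (le_trans (hM1 _ Kx))// lerDr].
split; first exact: z.
have nK : \forall y \near x, phi y = cst 0 y.
  have : nbhs x (~` K) by apply: open_nbhs_nbhs; split => //; exact/closed_openC/closed_closure.
  by apply: filterS => y /z.
by rewrite derive1E (near_eq_derive _ nK) derive_cst.
Qed.

Lemma test_function_continuous (phi : R -> R) : test_function phi ->
  continuous phi /\ continuous (derive1 phi).
Proof.
move=> [dphi _ _]; split => x; apply/differentiable_continuous/derivable1_diffP.
  exact: (dphi 0%N).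
exact: (dphi 1%N).
Qed.

(** What a test function and its derivative have in common and what makes their products with
    locally integrable functions integrable. *)
Definition cutoff (psi : R -> R) := measurable_fun setT psi /\
  exists2 K : set R, compact K /\ K `<=` I01 &
  exists2 M : R, 0 <= M & forall x, `|psi x| <= M /\ (~ K x -> psi x = 0).

Lemma test_function_cutoff (phi : R -> R) : test_function phi ->
  cutoff phi /\ cutoff (derive1 phi).
Proof.
move=> tphi; have [c0 c1] := test_function_continuous tphi.
have [K KP [M M0 hM]] := test_functionP tphi.
split; (split; [exact: continuous_measurable_fun|exists K => //; exists M => // x];
    have [h h'] := hM x; split => [|/h'[]//]).
  by have [/h[]//|/h'[-> _]] := pselect (K x); rewrite normr0.
by have [/h[]//|/h'[_ ->]] := pselect (K x); rewrite normr0.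
Qed.

Lemma integrable_cutoff u psi : L1loc01 u -> cutoff psi ->
  mu.-integrable I01 (EFin \o (fun x => u x * psi x)).
Proof.
move=> Lu [mpsi [K [cK KI] [M M0 hM]]].
have iu := L1loc01_compact Lu KI cK.
have mK : measurable (K : set (measurableTypeR R)) by exact: compact_measurable.
have mI : measurable (I01 : set (measurableTypeR R)) by exact: measurable_I01.
apply: (@le_integrable _ _ _ mu _ mI _ (fun x => M%:E * (EFin \o (u \_ K)) x)%E).
- apply/measurable_EFinP; apply: measurable_funM; first exact: measurable_L1loc01.
  exact: measurable_funTS.
- move=> x Ix; rewrite /comp -EFinM !abse_EFin lee_fin !normrM patchE.
  have [h h'] := hM x; case: ifPn => [_|/negP xK].
    by rewrite mulrC ler_wpM2r// (le_trans h)// ler_norm.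
  by rewrite h' ?normr0 ?mulr0// => /mem_set.
- apply: integrableZl => //.
  apply: (@integrableS _ _ _ mu setT) => //.
  rewrite -restrict_EFin.
  have := @integrable_mkcond _ _ _ mu K (EFin \o u) mK.
 move=> [h _]. exact: (h iu).
Qed.

Lemma L1loc01_lin (s t : R) f g : L1loc01 f -> L1loc01 g ->
  L1loc01 (fun x => s * f x + t * g x).
Proof.
move=> Lf Lg; have [mf oI _] := Lf; have [mg _ _] := Lg; split => //.
  by apply: measurable_funD; apply: measurable_funM => //; exact: measurable_cst.
move=> K KI cK.
have mK : measurable (K : set (measurableTypeR R)) by exact: compact_measurable.
have iK := integrableD mK
  (integrableZl mK s (L1loc01_compact Lf KI cK))
  (integrableZl mK t (L1loc01_compact Lg KI cK)).
by have /integrableP[_] := iK.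
Qed.

Lemma is_weak_derivative_lin (s t : R) f u g w :
  is_weak_derivative f u -> is_weak_derivative g w ->
  is_weak_derivative (fun x => s * f x + t * g x) (fun x => s * u x + t * w x).
Proof.
move=> [Lf Lu fu] [Lg Lw gw]; split; [exact: L1loc01_lin..|].
move=> phi tphi; have [c0 c1] := test_function_cutoff tphi.
have mI : measurable (I01 : set (measurableTypeR R)) by exact: measurable_I01.
have lin (h k psi : R -> R) : L1loc01 h -> L1loc01 k -> cutoff psi ->
    \int[mu]_(x in I01) ((s * h x + t * k x) * psi x) =
    s * \int[mu]_(x in I01) (h x * psi x) + t * \int[mu]_(x in I01) (k x * psi x).
  move=> Lh Lk cpsi.
  have ih := integrable_cutoff Lh cpsi; have ik := integrable_cutoff Lk cpsi.
  have iZ (r : R) (l : R -> R) : mu.-integrable I01 (EFin \o l) ->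
      mu.-integrable I01 (EFin \o (fun x => r * l x)).
    move=> il; rewrite (_ : _ \o _ = (fun x => r%:E * (EFin \o l) x)%E)//.
    exact: integrableZl.
  rewrite -!RintegralZl// -RintegralD//.
  - by apply: eq_Rintegral => x _; rewrite mulrDl !mulrA.
  - exact: iZ.
  - exact: iZ.
by rewrite !lin// fu// gw//; ring.
Qed.

Lemma L1loc01_ae f g : L1loc01 f -> measurable_fun I01 g -> ae01 (fun x => f x = g x) ->
  L1loc01 g.
Proof.
move=> [mf oI lf] mg fg; split => // K KI cK.
have mK : measurable (K : set (measurableTypeR R)) by exact: compact_measurable.
have mI : measurable (I01 : set (measurableTypeR R)) by exact: measurable_I01.
rewrite (@ae_eq_integral _ (measurableTypeR R) _ mu K (fun x => `|f x|%:E))//; first exact: lf.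
- by apply/measurable_EFinP; apply: measurableT_comp => //; exact: measurable_funS mg.
- by apply/measurable_EFinP; apply: measurableT_comp => //; exact: measurable_funS mf.
- by apply: aeS fg => x fgx /KI/fgx ->.
Qed.

Lemma is_weak_derivative_ae f g u w : is_weak_derivative f u ->
    measurable_fun I01 g -> measurable_fun I01 w ->
    ae01 (fun x => f x = g x) -> ae01 (fun x => u x = w x) ->
  is_weak_derivative g w.
Proof.
move=> [Lf Lu fu] mg mw fg uw.
have mI : measurable (I01 : set (measurableTypeR R)) by exact: measurable_I01.
have ae (h k psi : R -> R) : measurable_fun I01 h -> measurable_fun I01 k -> ae01 (fun x => h x = k x) ->
    cutoff psi -> \int[mu]_(x in I01) (k x * psi x) = \int[mu]_(x in I01) (h x * psi x).
  move=> mh mk hk [mpsi _]; apply: ae_eq_Rintegral => //.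
  - by apply: measurable_funM => //; exact: measurable_funTS.
  - by apply: measurable_funM => //; exact: measurable_funTS.
  - by apply: aeS hk => x /[apply] ->.
split; [exact: L1loc01_ae fg|exact: L1loc01_ae uw|].
move=> phi tphi; have [c0 c1] := test_function_cutoff tphi.
rewrite (ae f g)//; last exact: measurable_L1loc01.
rewrite (ae u w)//; last exact: measurable_L1loc01.
exact: fu.
Qed.

Lemma L1loc01_weighted_limit (e : R) f g : L1loc01 f -> measurable_fun I01 g ->
  (\int[mu]_(x in I01) `|f x * x `^ e - g x * x `^ e|%:E < +oo)%E -> L1loc01 g.
Proof.
move=> Lf mg fin; have [mf oI lf] := Lf; split => // K KI cK.
have mK : measurable (K : set (measurableTypeR R)) by exact: compact_measurable.
have mI : measurable (I01 : set (measurableTypeR R)) by exact: measurable_I01.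
have [C C0 hC] := powR_compact_bounded e cK KI.
have mfK : measurable_fun K f by exact: measurable_funS mf.
have mgK : measurable_fun K g by exact: measurable_funS mg.
have mr (D : set (measurableTypeR R)) : measurable_fun D (fun x : R => x `^ e).
  by apply: measurable_funTS; exact: measurable_powR.
have md (D : set (measurableTypeR R)) : measurable_fun D f -> measurable_fun D g ->
    measurable_fun D (fun x => `|f x * x `^ e - g x * x `^ e|%:E).
  move=> mfD mgD; apply/measurable_EFinP; apply: measurableT_comp => //.
  by apply: measurable_funB; apply: measurable_funM.
apply: (@le_lt_trans _ _ (\int[mu]_(x in K)
   (`|f x|%:E + C%:E * `|f x * x `^ e - g x * x `^ e|%:E)))%E.
  apply: ge0_le_integral => //.
  - by apply/measurable_EFinP; apply: measurableT_comp.
  - apply: emeasurable_funD; last by apply: measurable_funeM; exact: md.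
    by apply/measurable_EFinP; apply: measurableT_comp.
  - move=> x Kx; rewrite -EFinM -EFinD lee_fin -mulrBl normrM (ger0_norm (powR_ge0 _ _)).
    have h : `|f x - g x| <= C * (`|f x - g x| * x `^ e).
      by rewrite mulrCA -[leLHS]mulr1 ler_wpM2l// hC.
    have := ler_normB (f x) (f x - g x); rewrite subKr => h'; lra.
rewrite ge0_integralD//; last 3 first.
- by apply/measurable_EFinP; apply: measurableT_comp.
- by move=> x _; rewrite -EFinM lee_fin mulr_ge0.
- by apply: measurable_funeM; exact: md.
rewrite ge0_integralZl//; last exact: md.
apply: lte_add_pinfty; first exact: lf.
apply: lte_mul_pinfty => //.
apply: le_lt_trans fin; apply: ge0_subset_integral => //; exact: md.
Qed.

Lemma weighted_cutoff_cvg (e : R) (f_ : nat -> R -> R) f psi :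
    (forall n, L1loc01 (f_ n)) -> L1loc01 f -> cutoff psi ->
    (\int[mu]_(x in I01) `|f_ n x * x `^ e - f x * x `^ e|%:E @[n --> \oo] --> 0)%E ->
  \int[mu]_(x in I01) (f_ n x * psi x) @[n --> \oo] --> \int[mu]_(x in I01) (f x * psi x).
Proof.
move=> Lf_ Lf cpsi cf.
have mI : measurable (I01 : set (measurableTypeR R)) by exact: measurable_I01.
have [mpsi [K [cK KI] [M M0 hM]]] := cpsi.
have [C C0 hC] := powR_compact_bounded e cK KI.
have i_ n := integrable_cutoff (Lf_ n) cpsi; have i := integrable_cutoff Lf cpsi.
have mr : measurable_fun I01 (fun x : R => x `^ e).
  by apply: measurable_funTS; exact: measurable_powR.
have md n : measurable_fun I01 (fun x => `|f_ n x * x `^ e - f x * x `^ e|%:E).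
  apply/measurable_EFinP; apply: measurableT_comp => //.
  by apply: measurable_funB; apply: measurable_funM => //; exact: measurable_L1loc01.
have bound n : (`|\int[mu]_(x in I01) (f_ n x * psi x) - \int[mu]_(x in I01) (f x * psi x)|%:E
    <= (M * C)%:E * \int[mu]_(x in I01) `|f_ n x * x `^ e - f x * x `^ e|%:E)%E.
  rewrite -RintegralB//.
  have iB : mu.-integrable I01 (EFin \o (fun x => f_ n x * psi x - f x * psi x)).
    exact: (integrableB mI (i_ n) i).
  rewrite EFin_normr_Rintegral//; apply: le_trans (le_abse_integral _ _ _) _ => //.
    exact: measurable_int iB.
  rewrite -ge0_integralZl//; [|exact: md|by rewrite lee_fin mulr_ge0].
  apply: ge0_le_integral => //.
  - by apply: measurableT_comp => //; exact: measurable_int iB.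
  - by apply: measurable_funeM; exact: md.
  - move=> x Ix; rewrite abse_EFin -EFinM lee_fin -!mulrBl !normrM (ger0_norm (powR_ge0 _ _)).
    have [h h'] := hM x; have [Kx|/h' ->] := pselect (K x).
      apply: (@le_trans _ _ (`|f_ n x - f x| * M)); first by rewrite ler_wpM2l.
      rewrite [leRHS](_ : _ = `|f_ n x - f x| * M * (C * x `^ e)); last by ring.
      by rewrite ler_peMr ?mulr_ge0// hC.
    by rewrite normr0 mulr0 !mulr_ge0// powR_ge0.
have : ((M * C)%:E * \int[mu]_(x in I01) `|f_ n x * x `^ e - f x * x `^ e|%:E @[n --> \oo] --> 0)%E.
  by rewrite -[X in _ --> X](mule0 (M * C)%:E); apply: cvgeZl.
move=> /fine_cvgP[finN lim0].
apply/cvgrPdist_le => eps eps0.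
move/cvgrPdist_le : lim0 => /(_ _ eps0) lim0; near=> n.
have h : `|0 - fine ((M * C)%:E * \int[mu]_(x in I01) `|f_ n x * x `^ e - f x * x `^ e|%:E)%E| <= eps.
  by near: n; exact: lim0.
rewrite distrC; apply: le_trans h; rewrite sub0r normrN.
apply: le_trans (ler_norm _); rewrite -lee_fin fineK; first exact: bound.
by near: n; exact: finN.
Unshelve. all: by end_near. Qed.

(** The two weights are independent: each side of the weak formulation passes to the limit by
    itself, on the compact support of the test function, where its own power of x is bounded
    below. *)
Lemma is_weak_derivative_limit (e1 e2 : R) (f_ u_ : nat -> R -> R) f u :
    (forall n, is_weak_derivative (f_ n) (u_ n)) ->
    measurable_fun I01 f -> measurable_fun I01 u ->
    (\int[mu]_(x in I01) `|f_ n x * x `^ e1 - f x * x `^ e1|%:E @[n --> \oo] --> 0)%E ->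
    (\int[mu]_(x in I01) `|u_ n x * x `^ e2 - u x * x `^ e2|%:E @[n --> \oo] --> 0)%E ->
  is_weak_derivative f u.
Proof.
move=> fu mf mu_ cf cu.
have Lf_ n : L1loc01 (f_ n) by have [] := fu n.
have Lu_ n : L1loc01 (u_ n) by have [] := fu n.
have lim (e : R) (g_ : nat -> R -> R) g : (forall n, L1loc01 (g_ n)) -> measurable_fun I01 g ->
    (\int[mu]_(x in I01) `|g_ n x * x `^ e - g x * x `^ e|%:E @[n --> \oo] --> 0)%E -> L1loc01 g.
  move=> Lg_ mg /fine_cvgP[[n _ hn] _].
  apply: (@L1loc01_weighted_limit e (g_ n)) => //.
  by rewrite -ge0_fin_numE ?integral_ge0//; exact: hn n (leqnn n).
have Lf := lim _ _ _ Lf_ mf cf; have Lu := lim _ _ _ Lu_ mu_ cu.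
split => // phi tphi; have [c0 c1] := test_function_cutoff tphi.
have h1 := weighted_cutoff_cvg Lf_ Lf c1 cf.
have h0 : (- (\int[mu]_(x in I01) (u_ n x * phi x))) @[n --> \oo] -->
    - (\int[mu]_(x in I01) (u x * phi x)).
  by apply: cvgN; exact: weighted_cutoff_cvg cu.
have E : (fun n => \int[mu]_(x in I01) (f_ n x * derive1 phi x)) =
    (fun n => - \int[mu]_(x in I01) (u_ n x * phi x)).
  by apply/funext => n; have [_ _ ->] := fu n.
rewrite E in h1; rewrite -(cvg_lim (@Rhausdorff R) h1).
exact: (cvg_lim (@Rhausdorff R) h0).
Qed.

Let mI : measurable (I01 : set (measurableTypeR R)).
Proof. exact: measurable_I01. Qed.

Lemma near_I01 x : I01 x -> \forall y \near x, (I01 : set R) y.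
Proof. by move=> Ix; apply: open_nbhs_nbhs; split => //; exact: itv_open. Qed.

(** A disagreement at an interior point would persist on a ball, which has positive measure; the
    endpoints follow as one-sided limits. *)
Lemma continuous_ae01_eq f g :
    {within `[0, 1], continuous f} -> {within `[0, 1], continuous g} ->
    ae01 (fun x => f x = g x) ->
  forall x, 0 <= x <= 1 -> f x = g x.
Proof.
move=> cf cg fg.
have [cfo cf0 cf1] := (continuous_within_itvP f (@ltr01 R)).1 cf.
have [cgo cg0 cg1] := (continuous_within_itvP g (@ltr01 R)).1 cg.
have inner x : I01 x -> f x = g x.
  move=> Ix; apply: contrapT => /eqP fgx.
  have Ix' : x \in `]0, 1[%R by exact: Ix.
  have cd : (fun y => `|f y - g y|) y @[y --> x] --> `|f x - g x|.
    by apply: cvg_norm; apply: cvgB; [exact: cfo|exact: cgo].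
  have d0 : 0 < `|f x - g x| by rewrite normr_gt0 subr_eq0.
  have ne : \forall y \near x, f y != g y.
    move/cvgrPdist_lt : cd => /(_ _ d0); apply: filterS => y.
    apply: contraTneq => ->; rewrite subrr normr0 subr0 ger0_norm// ltxx //.
  have [e /= e0 he] : \forall y \near x, f y != g y /\ I01 y.
    by near=> y; split; near: y => //; exact: near_I01.
  have [N [mN N0 sN]] := fg.
  have sub : ball x e `<=` N.
    by move=> y /he[fgy Iy]; apply: sN => /= /(_ Iy) fgy'; rewrite fgy' eqxx in fgy.
  have mB : measurable (ball x e : set (measurableTypeR R)) by exact: measurable_ball.
  have /eqP := etrans (esym (lebesgue_measure_ball x (ltW e0))) (subset_measure0 mB mN sub N0).
  by rewrite eqe gt_eqF// mulrn_wgt0.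
move=> x /andP[]; rewrite le_eqVlt => /predU1P[<- _|x0].
  apply: (cvg_unique (@Rhausdorff R) cf0); apply: cvg_trans cg0.
  apply: near_eq_cvg; near=> y; symmetry; apply: inner.
  by rewrite /I01/= in_itv/=; apply/andP; split; near: y; [exact: nbhs_right_gt|exact: nbhs_right_lt].
rewrite le_eqVlt => /predU1P[->|x1].
  apply: (cvg_unique (@Rhausdorff R) cf1); apply: cvg_trans cg1.
  apply: near_eq_cvg; near=> y; symmetry; apply: inner.
  by rewrite /I01/= in_itv/=; apply/andP; split; near: y; [exact: nbhs_left_gt|exact: nbhs_left_lt].
by apply: inner; rewrite /I01/= in_itv/= x0.
Unshelve. all: by end_near. Qed.

(** Lebesgue differentiation on [d n, 1 - d n], where [w] is integrable: the identically zero
    integral from d n to x has derivative w x for almost every x. These intervals exhaust ]0, 1[. *)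
Lemma ae01_eq0 w : L1loc01 w ->
    (forall a b, 0 < a -> a < b -> b < 1 -> \int[mu]_(x in `]a, b[) w x = 0) ->
  ae01 (fun x => w x = 0).
Proof.
move=> Lw w0; pose d n : R := n.+1%:R^-1.
have d0 n : 0 < d n by rewrite invr_gt0.
have main n : {ae mu, forall x, x \in `]d n, 1 - d n[%R -> w x = 0}.
  pose D : set (measurableTypeR R) := `[d n, 1 - d n]%classic.
  have mD : measurable D by exact: measurable_itv.
  have iw : mu.-integrable D (EFin \o w).
    by apply: L1loc01_itv => //; rewrite ltrBlDr ltrDl.
  pose W := w \_ D.
  have iW : mu.-integrable setT (EFin \o W).
    have [h _] := @integrable_mkcond _ _ _ mu D (EFin \o w) mD.
    by have := h iw; rewrite restrict_EFin.
  have lW := integrable_locally_restrict mD iw.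
  have iWs (i : interval R) : mu.-integrable [set` i] (EFin \o W).
    by apply: (@integrableS _ _ _ mu setT).
  have := FTC1 (a := BRight (d n)) (fun y => iWs _) lW.
  apply: aeS => x h; rewrite in_itv/= => /andP[dx xd].
  have [_] := h dx; rewrite /W patchE mem_set; last first.
    by rewrite /D/= in_itv/= !ltW.
  move=> <-; rewrite derive1E -(derive_cst (0 : R) x 1); apply: near_eq_derive.
  near=> y; rewrite /cst /=.
  have dy : d n < y by near: y; exact: lt_nbhsr.
  have yd : y < 1 - d n by near: y; exact: lt_nbhsl.
  rewrite -Rintegral_itv_bndo_bndc; last exact: iWs.
  rewrite -(w0 _ _ (d0 n) dy (lt_trans yd _)) ?ltrBlDr ?ltrDl//.
  apply: eq_Rintegral => z; rewrite inE/= in_itv/= => /andP[dz zy].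
  by rewrite patchE mem_set// /D/= in_itv/= !ltW// (lt_trans zy).
apply: aeS (ae_foralln main) => x h; rewrite /I01/= in_itv/= => /andP[x0 x1].
have m0 : 0 < Num.min x (1 - x) by rewrite lt_min x0 subr_gt0.
have [n hn] : exists n, d n < Num.min x (1 - x).
  have /cvgrPdist_lt/(_ _ m0)[n _ hn] := @cvg_harmonic R.
  exists n; have := hn n (leqnn n); rewrite /= sub0r normrN ger0_norm//.
apply: (h n); move: hn; rewrite lt_min in_itv/= => /andP[-> /=].
by rewrite ltrBrDr addrC -ltrBrDr.
Unshelve. all: by end_near. Qed.

(** The difference u - w is a weak derivative of f - f, whose continuous representative is 0, so all
    its integrals over intervals vanish. *)
Lemma weak_derivative_unique f u w : is_weak_derivative f u -> is_weak_derivative f w ->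
  ae01 (fun x => u x = w x).
Proof.
move=> fu fw; have fuw := is_weak_derivative_lin 1 (-1) fu fw.
have [_ Luw _] := fuw.
have : ae01 (fun x => 1 * u x + -1 * w x = 0).
  apply: ae01_eq0 => // a b a0 ab b1.
  rewrite (@weak_derivative_ftc _ (cst 0) _ a b fuw) ?subrr//.
    by apply: continuous_subspaceT => x; exact: cvg_cst.
  by apply: ae_aeW => x _; rewrite /cst; ring.
by apply: ae01S => x _; rewrite mul1r mulN1r => /eqP; rewrite subr_eq0 => /eqP.
Qed.

Lemma wderivP f u : is_weak_derivative f u ->
  is_weak_derivative f (wderiv f) /\ ae01 (fun x => wderiv f x = u x).
Proof.
move=> fu; have fw : is_weak_derivative f (wderiv f).
  by apply: (@xgetPex _ (fun=> 0) [set u | is_weak_derivative f u]); exists u.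
by split => //; exact: weak_derivative_unique fw fu.
Qed.

Lemma crepP f (c : R -> R) : {within `[0, 1], continuous c} -> ae01 (fun x => c x = f x) ->
  [/\ {within `[0, 1], continuous (crep f)}, ae01 (fun x => crep f x = f x) &
      forall x, 0 <= x <= 1 -> crep f x = c x].
Proof.
move=> cc cf; have [h1 h2] : {within `[0, 1], continuous (crep f)} /\ ae01 (fun x => crep f x = f x).
  apply: (@xgetPex _ (fun=> 0) [set u : R -> R | {within `[0, 1], continuous u} /\ ae01 (fun x => u x = f x)]).
  by exists c.
split => //; apply: continuous_ae01_eq => //.
by apply: ae01S (ae01I h2 cf) => x _ [-> ->].
Qed.

(** The default of [crep] is the zero function, so one nonzero value certifies that a continuous
    representative exists. The boundary value lambda > 0 provides such a value. *)
Lemma crep_neq0 f x : crep f x != 0 ->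
  {within `[0, 1], continuous (crep f)} /\ ae01 (fun x => crep f x = f x).
Proof.
move=> fx; have [[c [cc cf]]|no] := pselect (exists c : R -> R, {within `[0, 1], continuous c} /\ ae01 (fun x => c x = f x)).
  by have [] := crepP cc cf.
by case/eqP: fx; rewrite /crep xgetPN// => u uP; apply: no; exists u.
Qed.

Definition primitive u (x : R) := \int[mu]_(t in `[0, x]) (u \_ I01) t.

Section primitive.
Variable u : R -> R.
Hypothesis iu : mu.-integrable I01 (EFin \o u).

Let iU (i : interval R) : mu.-integrable [set` i] (EFin \o (u \_ I01)).
Proof.
apply: (@integrableS _ _ _ mu setT) => //.
have [h _] := @integrable_mkcond _ _ _ mu I01 (EFin \o u) mI.
by have := h iu; rewrite restrict_EFin.
Qed.

Lemma continuous_primitive : {within `[0, 1], continuous (primitive u)}.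
Proof. exact: parameterized_integral_continuous. Qed.

Lemma primitive0 : primitive u 0 = 0.
Proof. by rewrite /primitive set_itv1 Rintegral_set1. Qed.

Lemma primitiveB (x y : R) : 0 <= x -> x <= y -> y <= 1 ->
  primitive u y - primitive u x = \int[mu]_(t in `]x, y[) u t.
Proof.
move=> x0 xy y1; rewrite /primitive (Rintegral_itvB (iU _)) ?bnd_simp//.
rewrite -Rintegral_itv_bndo_bndc; last exact: iU.
apply: eq_Rintegral => t; rewrite inE/= in_itv/= => /andP[xt ty].
by rewrite patchE mem_set// /I01/= in_itv/= (le_lt_trans x0)// (lt_le_trans ty).
Qed.

(** By [weak_derivative_ftc] the functions [c] and [primitive u] have equal increments inside ]0,
    1[; normalizing at 1/2, they differ by the constant [k] there, and continuity carries this to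
    both endpoints. *)
Lemma weak_derivative_primitive f (c : R -> R) : is_weak_derivative f u ->
    {within `[0, 1], continuous c} -> ae01 (fun x => c x = f x) ->
  forall x, 0 <= x <= 1 -> c x = c 1 - \int[mu]_(t in `]x, 1[) u t.
Proof.
move=> fu cc cf.
have h1 : 0 < 2^-1 :> R by [].
have h2 : 2^-1 < 1 :> R by rewrite invf_lt1// ltr1n.
pose k := c 2^-1 - primitive u 2^-1.
have cP : {within `[0, 1], continuous (fun x => primitive u x + k)}.
  by move=> x; apply: cvgD; [exact: continuous_primitive|exact: cvg_cst].
have step x y : 0 < x -> x < y -> y < 1 -> primitive u y - primitive u x = c y - c x.
  move=> x0 xy y1; rewrite primitiveB ?ltW//; apply: (weak_derivative_ftc fu) => //.
  apply: continuous_subspaceW cc => t /=; rewrite !in_itv/= => /andP[xt ty].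
  by rewrite (le_trans (ltW x0) xt) (le_trans ty (ltW y1)).
have cE x : 0 <= x <= 1 -> c x = primitive u x + k.
  apply: (@continuous_ae01_eq c (fun x => primitive u x + k)) => //; apply: ae_aeW => {}x.
  rewrite /I01/= in_itv/= => /andP[x0 x1]; rewrite /k.
  have [xh|hx|->] := ltgtP x 2^-1; last by rewrite subrKC.
  - by have := step _ _ x0 xh h2; lra.
  - by have := step _ _ h1 hx x1; lra.
move=> x /andP[x0 x1]; rewrite -primitiveB// !cE ?x0 ?x1 ?ler01 ?lexx//.
by ring.
Qed.

End primitive.

End weak_derivatives.

(** * The constitutive functions *)

Section constitutive.
Context {R : realType}.
Implicit Types (f h : R -> R) (s t : R).

(** The hypotheses are confined to the segment between [s] and [t] so that the lemma also applies to
    [h], which is smooth only on the positive axis. *)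
Lemma midpoint_convex f s t :
    (forall x, Num.min s t <= x <= Num.max s t ->
       [/\ derivable f x 1, derivable (derive1 f) x 1 & 0 <= (f^`(2)) x]) ->
  f ((s + t) / 2) <= (f s + f t) / 2.
Proof.
wlog st : s t / s <= t.
  move=> wl df; have [st|/ltW ts] := leP s t; first exact: wl.
  by rewrite addrC [f s + _]addrC; apply: wl => //; rewrite minC maxC.
rewrite (min_idPl st) (max_idPr st) => df.
have der1 : derive1 f = 'D_1 f by apply/funext => x; rewrite derive1E.
have cf x : s <= x <= t -> {for x, continuous f}.
  by move=> /df[d _ _]; apply/differentiable_continuous/derivable1_diffP.
have -> : (s + t) / 2 = 2^-1 * s + (1 - 2^-1) * t by field.
have -> : (f s + f t) / 2 = 2^-1 * f s + (1 - 2^-1) * f t by field.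
have half_ge0 : 0 <= 2^-1 :> R by rewrite invr_ge0.
have half_le1 : 2^-1 <= 1 :> R by rewrite invf_le1// ler1n.
have H := @second_derivative_convex R f s t _ _ _ _ _ (Itv01 half_ge0 half_le1) st.
have df' x : s < x < t -> [/\ derivable f x 1, derivable (derive1 f) x 1 & 0 <= (f^`(2)) x].
  by move=> /andP[sx xt]; apply: df; rewrite !ltW.
apply: H.
- by move=> x /df'[_ _]; rewrite -der1 -derive1E.
- by apply: cvg_at_left_filter; apply: cf; rewrite st lexx.
- by apply: cvg_at_right_filter; apply: cf; rewrite st lexx.
- by move=> x; rewrite in_itv/= => /df'[d _ _]; exact: d.
- by move=> x; rewrite in_itv/= -der1 => /df'[_ d _]; exact: d.
Qed.

Lemma le_powR_eps (r e : R) : 1 < r -> 0 < e ->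
  exists M : R, forall s, 0 <= s -> s <= M + e * s `^ r.
Proof.
(* Beyond this threshold e * s^(r - 1) >= 1. *)
move=> r1 e0; pose T := (e^-1) `^ (r - 1)^-1; exists T => s s0.
have r10 : 0 < r - 1 by rewrite subr_gt0.
have [sT|Ts] := leP s T; first by rewrite (le_trans sT)// lerDl mulr_ge0 ?powR_ge0// ltW.
have T0 : 0 <= T by exact: powR_ge0.
have s0' : 0 < s by exact: le_lt_trans T0 Ts.
rewrite -(mulr_powRB1 s0 (lt_trans ltr01 r1)) -[leLHS]add0r lerD//.
rewrite mulrCA -[leLHS]mulr1 ler_wpM2l// -ler_pdivrMl// mulr1.
have -> : e^-1 = T `^ (r - 1).
  by rewrite /T -powRrM mulVf ?gt_eqF// powRr1// invr_ge0 ltW.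
by rewrite ge0_ler_powR ?nnegrE// ltW.
Qed.

Definition power_coercive (r : R) f := exists M C : R, [/\ 0 <= M, 0 <= C &
  forall s, `|s| `^ r <= M + C * f s].

(** Far out the ratio is at least c / 2; the remaining bounded region is absorbed in the additive
    constant. *)
Lemma power_coercive_lim (r c : R) f : 0 < c -> 0 <= r -> (forall s, 0 <= f s) ->
  f x / `|x| `^ r @[x --> abs_infty] --> c -> power_coercive r f.
Proof.
move=> c0 r0 f0 lim; have c2 : 0 < c / 2 by rewrite divr_gt0.
have nc : nbhs c [set y | c / 2 <= y].
  apply: (@filterS _ _ _ [set y | c / 2 < y]); first by move=> y /= /ltW.
  by apply: lt_nbhsr; rewrite ltr_pdivrMr// ltr_pMr// ltr1n.
have [N _ hN] := lim _ nc.
exists ((Num.max N 1) `^ r), (c / 2)^-1; split; [exact: powR_ge0|by rewrite invr_ge0 ltW|].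
move=> s; have [sN|] := leP `|s| (Num.max N 1).
  rewrite -[leLHS]addr0 lerD//; last by rewrite mulr_ge0// invr_ge0 ltW.
  by rewrite ge0_ler_powR ?nnegrE// le_max ler01 orbT.
rewrite gt_max => /andP[Ns s1]; have /= := hN _ Ns.
have sr0 : 0 < `|s| `^ r by rewrite powR_gt0// (lt_trans _ s1).
rewrite ler_pdivlMr// => h; rewrite -[leLHS]add0r lerD ?powR_ge0//.
by rewrite -ler_pdivrMl ?invr_gt0// invrK.
Qed.

Lemma superlinear_power_coercive (r : R) f : 1 < r -> (forall s, 0 <= f s) ->
  power_coercive r f -> superlinear (EFin \o f).
Proof.
move=> r1 f0 [M [C [M0 C0 hf]]] e e0.
have C1 : 0 < C + 1 by rewrite ltr_wpDl.
have e'0 : 0 < e / (C + 1) by rewrite divr_gt0.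
have [N hN] := le_powR_eps r1 e'0; exists (N + e / (C + 1) * M) => s.
rewrite /= lee_fin; apply: le_trans (hN _ (normr_ge0 s)) _; rewrite -addrA lerD2l.
apply: (@le_trans _ _ (e / (C + 1) * (M + C * f s))); first by rewrite ler_wpM2l// ltW.
rewrite mulrDr lerD2l mulrA ler_wpM2r// mulrAC -mulrA ler_piMr ?(ltW e0)//.
by rewrite ler_pdivrMr// mul1r lerDl.
Qed.

Lemma superlinear_scale2 f : (forall s, 0 <= f s) ->
  superlinear (EFin \o f) -> superlinear (fun s => (2 * f s)%:E).
Proof.
move=> f0 sf e e0; have [M hM] := sf e e0; exists M => s.
have := hM s; rewrite /= !lee_fin => h; apply: (le_trans h).
by rewrite lerD2l ler_wpM2l ?(ltW e0)// ler_peMl// ler1n.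
Qed.

Lemma power_coercive_sqr : power_coercive 2 (fun s => 1 / 2 * s ^+ 2).
Proof.
exists 0, 2; split => // s; rewrite powR_mulrn// real_normK ?num_real//.
by rewrite add0r mul1r mulrA divff ?mul1r.
Qed.

Definition extend_pos h (s : R) : \bar R := if 0 < s then (h s)%:E else +oo%E.

Lemma superlinear_extend_pos h : (forall s, 0 < s -> 0 <= h s) ->
  h d / d @[d --> +oo] --> +oo -> superlinear (extend_pos h).
Proof.
move=> h0 lim e e0.
have [N [_ hN]] := (cvgryPge _).1 lim e^-1.
exists (Num.max N 0) => s; rewrite /extend_pos; case: ifPn => [s0|_]; last first.
  by rewrite gt0_muley ?lte_fin// addey ?leey.
rewrite gtr0_norm// -EFinM -EFinD lee_fin.
have [sN|Ns] := leP s N.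
  by rewrite -[leLHS]addr0 lerD ?le_max ?sN// mulr_ge0 ?h0// ltW.
rewrite -[leLHS]add0r lerD// ?le_max ?lexx ?orbT//.
by have := hN _ Ns; rewrite /= ler_pdivlMr// -ler_pdivrMl ?invr_gt0// invrK.
Qed.

Lemma cvg_EFin_comp (T : Type) (F : set_system T) {FF : Filter F} (f : T -> R) (a : R) :
  f @ F --> a -> (f x)%:E @[x --> F] --> a%:E.
Proof. by move=> fa; apply/fine_cvgP; split; [exact: nearW|exact: fa]. Qed.

(** The blow-up of [h] at 0+ is what joins the finite branch continuously to the value +oo. *)
Lemma continuous_extend_pos h : (forall s, 0 < s -> {for s, continuous h}) ->
  h d @[d --> 0^'+] --> +oo -> continuous (extend_pos h).
Proof.
move=> ch lim s; rewrite /continuous_at; have [s0|s0|->] := ltgtP s 0.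
- have -> : extend_pos h s = +oo%E by rewrite /extend_pos ltNge (ltW s0).
  apply: cvg_near_cst; near=> x; rewrite /extend_pos ltNge ltW//=.
  by near: x; exact: lt_nbhsl.
- have -> : extend_pos h s = (h s)%:E by rewrite /extend_pos s0.
  apply: (@cvg_trans _ ((h x)%:E @[x --> s])).
    apply: near_eq_cvg; near=> x; rewrite /extend_pos ifT//.
    by near: x; exact: lt_nbhsr.
  exact: (@cvg_EFin_comp R (nbhs s) _ h (h s) (ch s s0)).
- have -> : extend_pos h 0 = +oo%E by rewrite /extend_pos ltxx.
  apply/cvgeyPge => A.
  have H := (cvgryPge _).1 lim A; rewrite near_withinE in H.
  near=> x; rewrite /extend_pos; case: ifPn => [x0|_]; last by rewrite leey.
  by rewrite lee_fin; move: x0; near: x; exact: H.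
Unshelve. all: by end_near. Qed.

Lemma extend_pos_midpoint h s t :
  (forall x, 0 < x -> [/\ derivable h x 1, derivable (derive1 h) x 1 & 0 <= (h^`(2)) x]) ->
  (forall x, 0 < x -> 0 <= h x) ->
  (2%:E * extend_pos h ((s + t) / 2) <= extend_pos h s + extend_pos h t)%E.
Proof.
move=> dh h0; rewrite /extend_pos; case: (ltP 0 s) => s0; last first.
  by rewrite addye ?leey//; case: ifPn.
case: (ltP 0 t) => t0; last by rewrite addey ?leey.
rewrite divr_gt0 ?addr_gt0// -EFinM -EFinD lee_fin.
have := @midpoint_convex h s t; rewrite ler_pdivlMr// mulrC; apply => x /andP[mx _].
by apply: dh; apply: lt_le_trans mx; rewrite lt_min s0.
Qed.

Lemma continuous_ereal_measurable (Phi : R -> \bar R) : continuous Phi ->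
  measurable_fun setT Phi.
Proof.
move=> cPhi; apply: lower_semicontinuous_measurable; apply/lower_semicontinuousP => a.
have := (continuousP Phi).1 cPhi _ (@open_ereal_gt_ereal R a%:E).
by congr open.
Qed.

(** Indices 0 to 5 follow the order of the summands in [functional]. All later indices repeat the
    last density, so properties required of every index hold without a bound on i. *)
Definition densities (phi psi g h : R -> R) (i : nat) : R -> \bar R :=
  match i with
  | 0%N => EFin \o (fun s => 1 / 2 * s ^+ 2)
  | 1%N => EFin \o phi
  | 2%N => fun s => (2 * psi s)%:E
  | 3%N => EFin \o g
  | 4%N => fun s => (2 * g s)%:E
  | _ => extend_pos h
  end.

End constitutive.

Section densities.
Context {R : realType}.
Variables (p q : R) (phi g h : R -> R).
Hypotheses (p1 : 1 < p) (q1 : 1 < q).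
Hypotheses (hA1 : A1 h) (hA2 : A2 phi g h) (hA3 : A3 p q phi g).

Let psi := psi_of phi.
Let Phi := densities phi psi g h.

Let phi0 (s : R) : 0 <= phi s. Proof. by case: hA2 => _ []. Qed.
Let psi0 (s : R) : 0 <= psi s. Proof. by case: hA2 => _ []. Qed.
Let g0 (s : R) : 0 <= g s. Proof. by case: hA2 => _ []. Qed.
Let h0 (s : R) : 0 < s -> 0 <= h s. Proof. by case: hA2 => _ [_ _ _ hh] _ _; exact: hh. Qed.

Let C2_continuous (f : R -> R) : C2_on [set: R] f -> continuous f.
Proof.
by move=> Cf x; have [d _ _] := Cf x I; apply/differentiable_continuous/derivable1_diffP.
Qed.

Lemma densities_ge0 i (s : R) : (0 <= Phi i s)%E.
Proof.
case: i => [|[|[|[|[|i]]]]]; rewrite /Phi/= ?lee_fin.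
- by rewrite mulr_ge0// sqr_ge0.
- exact: phi0.
- by rewrite mulr_ge0//; exact: psi0.
- exact: g0.
- by rewrite mulr_ge0//; exact: g0.
- by rewrite /extend_pos; case: ifPn => // s0; rewrite lee_fin h0.
Qed.

Lemma continuous_densities i : continuous (Phi i).
Proof.
have [[Cphi Cpsi Cg Ch] _ _ _] := hA2.
have cE (f : R -> R) : continuous f -> continuous (EFin \o f).
  by move=> cf x; exact: (@cvg_EFin_comp R R (nbhs x) _ f (f x) (cf x)).
have c2 (f : R -> R) : continuous f -> continuous (fun s : R => 2 * f s).
  by move=> cf x; apply: cvgM; [exact: cvg_cst|exact: cf].
case: i => [|[|[|[|[|i]]]]]; rewrite /Phi/=.
- by apply: cE => x; apply: cvgM; [exact: cvg_cst|exact: exprn_continuous].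
- exact: (cE _ (C2_continuous Cphi)).
- exact: (cE _ (c2 _ (C2_continuous Cpsi))).
- exact: (cE _ (C2_continuous Cg)).
- exact: (cE _ (c2 _ (C2_continuous Cg))).
- apply: continuous_extend_pos; last by case: hA1.
  move=> s s0; have s0I : `]0, +oo[%classic s by rewrite /= in_itv/= andbT.
  have [d _ _] := Ch s s0I.
  exact/differentiable_continuous/derivable1_diffP.
Qed.

Lemma measurable_densities i : measurable_fun setT (Phi i).
Proof. by apply: continuous_ereal_measurable; exact: continuous_densities. Qed.

Lemma coercive_densities : [/\ power_coercive (3 * p) phi, power_coercive p psi &
  power_coercive q g].
Proof.
have [c1 [c2 [c10 [c20 [l1 l2 l3]]]]] := hA3.
have p0 : 0 <= p by rewrite ltW// (lt_trans ltr01).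
have q0 : 0 <= q by rewrite ltW// (lt_trans ltr01).
split.
- by apply: power_coercive_lim l1 => //; rewrite mulr_ge0.
- exact: power_coercive_lim l2.
- exact: power_coercive_lim l3.
Qed.

Lemma superlinear_densities i : superlinear (Phi i).
Proof.
have [k1 k2 k3] := coercive_densities.
have p3 : 1 < 3 * p by move: p1; lra.
have sphi := superlinear_power_coercive p3 phi0 k1.
have spsi := superlinear_power_coercive p1 psi0 k2.
have sg := superlinear_power_coercive q1 g0 k3.
case: i => [|[|[|[|[|i]]]]]; rewrite /Phi/=.
- apply: superlinear_power_coercive power_coercive_sqr; first by rewrite ltr1n.
  by move=> s; rewrite mulr_ge0 ?sqr_ge0.
- exact: sphi.
- exact: superlinear_scale2.
- exact: sg.
- exact: superlinear_scale2.
- by apply: superlinear_extend_pos => //; case: hA1.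
Qed.

Lemma midpoint_densities i (s t : R) :
  (2%:E * Phi i ((s + t) / 2) <= Phi i s + Phi i t)%E.
Proof.
have [[Cphi Cpsi Cg Ch] _ [vphi vpsi vg] vh] := hA2.
have mid (f : R -> R) : C2_on [set: R] f -> (forall x, 0 <= (f^`(2)) x) ->
    2 * f ((s + t) / 2) <= f s + f t.
  move=> Cf vf; rewrite mulrC -ler_pdivlMr//; apply: midpoint_convex => x _.
  by have [d d2 _] := Cf x I.
have one (f : R -> R) : 2 * f ((s + t) / 2) <= f s + f t ->
    (2%:E * (f ((s + t) / 2))%:E <= (f s)%:E + (f t)%:E)%E.
  by move=> hf; rewrite -EFinM -EFinD lee_fin.
have two (f : R -> R) : 2 * f ((s + t) / 2) <= f s + f t ->
    (2%:E * (2 * f ((s + t) / 2))%:E <= (2 * f s)%:E + (2 * f t)%:E)%E.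
  by move=> hf; rewrite -EFinM -EFinD lee_fin; lra.
case: i => [|[|[|[|[|i]]]]]; rewrite /Phi/=.
- by apply: (one (fun s => 1 / 2 * s ^+ 2)); have := sqr_ge0 (s - t); nra.
- exact: (one _ (mid _ Cphi vphi)).
- exact: (two _ (mid _ Cpsi vpsi)).
- exact: (one _ (mid _ Cg vg)).
- exact: (two _ (mid _ Cg vg)).
- apply: extend_pos_midpoint => // x x0.
  have x0I : `]0, +oo[%classic x by rewrite /= in_itv/= andbT.
  have [d d2 _] := Ch x x0I.
  by split => //; rewrite ltW// vh.
Qed.

End densities.

(** * Lebesgue spaces on the unit interval and coercivity *)

Section Lp01.
Context {R : realType}.
Notation mu := (@lebesgue_measure R).
Implicit Types (f g u : R -> R) (r : R).

Let mI : measurable (I01 : set (measurableTypeR R)).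
Proof. exact: measurable_I01. Qed.

Lemma mu_I01 : (mu (I01 : set (measurableTypeR R)) < +oo)%E.
Proof. by rewrite /I01 lebesgue_measure_itv/= lte_fin ltr01 oppr0 adde0 ltry. Qed.

Lemma Lp01P r f : 1 <= r -> Lp01 r f <->
  measurable_fun I01 f /\ (\int[mu]_(x in I01) (`|f x| `^ r)%:E < +oo)%E.
Proof.
move=> r1; have r0 : r != 0 by rewrite gt_eqF// (lt_le_trans ltr01).
have E : (\int[mu]_(x in I01) (`|f x| `^ r)%:E = ('N[mu]_r%:E [EFin \o (f \_ I01)]) `^ r)%E.
  rewrite powR_Lnorm// [LHS]integral_mkcond; congr (integral _ _ _); apply/funext => x.
  rewrite /= !patchE; case: ifPn => // _.
  by rewrite -[X in `|X|]/(0 : R) normr0 powR0.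
have mE : (f \_ I01 \in mfun) <-> measurable_fun I01 f.
  rewrite inE; split => [h|h].
    by apply/(measurable_restrictT _ _).2.
  by apply/(measurable_restrictT _ _).1.
rewrite E /Lp01; split.
  rewrite inE/= => /andP[mf /[!inE] fin]; split; first exact/mE.
  move: fin; rewrite /finite_norm /= -ge0_fin_numE ?Lnorm_ge0// => fin.
  by rewrite -(fineK fin) poweR_EFin ltry.
move=> [mf fin]; rewrite inE/=; apply/andP; split; first exact/mE.
rewrite inE /finite_norm /=; apply: contraT; rewrite -leNgt leye_eq => /eqP N_oo.
by move: fin; rewrite N_oo poweRyr.
Qed.

Lemma Lp01_ae r f g : 1 <= r -> Lp01 r f -> measurable_fun I01 g ->
  ae01 (fun x => f x = g x) -> Lp01 r g.
Proof.
move=> r1 /(Lp01P _ r1)[mf fin] mg fg; apply/(Lp01P _ r1); split => //.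
have mp (h : R -> R) : measurable_fun I01 h -> measurable_fun I01 (fun x => (`|h x| `^ r)%:E).
  move=> mh; apply/measurable_EFinP.
  apply: (measurableT_comp (measurable_powR r)); exact: measurableT_comp.
rewrite (@ae_eq_integral _ (measurableTypeR R) _ mu I01 (fun x => (`|f x| `^ r)%:E))//.
- exact: mp.
- exact: mp.
- by apply: aeS fg => x /[apply] ->.
Qed.

Lemma Lp01_lin r (s t : R) f g : 1 <= r -> Lp01 r f -> Lp01 r g ->
  Lp01 r (fun x => s * f x + t * g x).
Proof.
move=> r1 Lf Lg; have r1' : (1 <= r%:E)%E by rewrite lee_fin.
have [h0 h] := Lfun_submod_closed mu r1'.
rewrite /Lp01 (_ : _ \_ _ = s *: (f \_ I01) + (t *: (g \_ I01) + 0)); last first.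
  apply/funext => x.
  rewrite -[RHS]/(s * (f \_ I01) x + (t * (g \_ I01) x + 0)) addr0 !patchE.
  by case: ifPn => // _; rewrite -[point]/(0 : R) !mulr0 addr0.
exact: h s _ _ Lf (h t _ _ Lg h0).
Qed.

Lemma Lp01_integrable f : mu.-integrable I01 (EFin \o f) -> Lp01 1 f.
Proof.
move=> /integrableP[mf fin]; apply/(Lp01P _ (lexx 1)); split.
  exact/measurable_EFinP.
move: fin; congr (_ < _)%E; apply: eq_integral => x _ /=.
by rewrite powRr1.
Qed.

Lemma integrable_Lp01 f : Lp01 1 f -> mu.-integrable I01 (EFin \o f).
Proof.
move=> /(Lp01P _ (lexx 1))[mf fin]; apply/integrableP; split.
  exact/measurable_EFinP.
move: fin; congr (_ < _)%E; apply: eq_integral => x _ /=.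
by rewrite powRr1.
Qed.

Lemma Lp01_coercive r (psi : R -> R) f : 1 <= r -> power_coercive r psi ->
  measurable_fun setT psi -> (forall s, 0 <= psi s) ->
  measurable_fun I01 f -> (\int[mu]_(x in I01) (psi (f x))%:E < +oo)%E -> Lp01 r f.
Proof.
move=> r1 [M [C [M0 C0 hM]]] mpsi psi0 mf fin; apply/(Lp01P _ r1); split => //.
have mp : measurable_fun I01 (fun x => (psi (f x))%:E).
  by apply/measurable_EFinP; exact: measurableT_comp.
apply: (@le_lt_trans _ _ (\int[mu]_(x in I01) (M%:E + C%:E * (psi (f x))%:E)))%E.
  apply: ge0_le_integral => //.
  - apply/measurable_EFinP; apply: (measurableT_comp (measurable_powR r)).
    exact: measurableT_comp.
  - by apply: emeasurable_funD; [exact: measurable_cst|exact: measurable_funeM].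
  - by move=> x _; rewrite -EFinM -EFinD lee_fin.
rewrite ge0_integralD//; last 2 first.
- by move=> x _; rewrite -EFinM lee_fin mulr_ge0.
- exact: measurable_funeM.
rewrite ge0_integralZl//; last by move=> x _; rewrite lee_fin.
apply: lte_add_pinfty; last exact: lte_mul_pinfty.
by rewrite integral_cst// lte_mul_pinfty// mu_I01.
Qed.

End Lp01.

(** * The variational problem *)

Section strain_fields.
Context {R : realType}.
Notation mu := (@lebesgue_measure R).
Variables (lambda tau : R) (alpha0 beta0 gamma0 v0 : R -> R).
Hypothesis tau_gt0 : 0 < tau.
Hypothesis mbeta0 : measurable_fun I01 beta0.
Hypothesis mv0 : measurable_fun I01 v0.

Let mI : measurable (I01 : set (measurableTypeR R)).
Proof. exact: measurable_I01. Qed.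

Implicit Types F : nat -> R -> R.

(** The arguments of the six densities, in the order of [densities]. *)
Definition strain_fields (s : @state R) (i : nat) : R -> R :=
  let: (alpha, beta, gamma, v) := s in
  match i with
  | 0%N => fun x => v x - v0 x
  | 1%N => fun x => beta x * x `^ (2 / 3)
  | 2%N => fun x => alpha x / x
  | 3%N => fun x => gamma x / x `^ (2 / 3)
  | 4%N => fun x => 3 / 2 * wderiv gamma x * x `^ (1 / 3)
  | _ => wderiv alpha
  end.

Definition velocity F x := F 0%N x + v0 x.
Definition beta_of F x := F 1%N x * x `^ (- (2 / 3)).
Definition alpha_of F x := F 2%N x * x.
Definition gamma_of F x := F 3%N x * x `^ (2 / 3).
Definition dgamma_of F x := 2 / 3 * (F 4%N x * x `^ (- (1 / 3))).
(** The constraint (beta - beta0) / tau = 3 v' solved for v'. Asking that this be the weak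
    derivative of the velocity encodes both that constraint and the weak differentiability of v. *)
Definition dvelocity F x := (beta_of F x - beta0 x) / (3 * tau).

(* The conditions on F under which (velocity, beta_of, alpha_of, gamma_of) is an
   admissible state with strain fields F, except for finite energy.  Since
   alpha(x) = lambda - \int_x^1 alpha', the condition alpha(0) >= 0 reads
   lambda - \int_0^1 alpha' >= 0. *)
Definition compatible F :=
  [/\ forall i, measurable_fun I01 (F i),
      [/\ is_weak_derivative (velocity F) (dvelocity F),
          is_weak_derivative (alpha_of F) (F 5%N) &
          is_weak_derivative (gamma_of F) (dgamma_of F)],
      ae01 (fun x => alpha_of F x = alpha0 x + tau * (3 * alpha0 x `^ (2 / 3) * velocity F x)) /\
      ae01 (fun x => gamma_of F x = gamma0 x + tau * (2 * alpha0 x `^ (1 / 3) * velocity F x)) &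
      [/\ mu.-integrable I01 (EFin \o F 5%N),
          0 <= lambda - \int[mu]_(x in I01) F 5%N x &
          ae01 (fun x => alpha_of F x = lambda - \int[mu]_(t in `]x, 1[) F 5%N t)]].

Lemma I01_gt0 x : I01 x -> 0 < x :> R.
Proof. by rewrite /I01/= in_itv/= => /andP[]. Qed.

Lemma subset_tail x : I01 x -> `]x, 1[%classic `<=` @I01 R.
Proof.
move=> /I01_gt0 x0 t; rewrite /I01/= !in_itv/= => /andP[xt ->].
by rewrite (lt_trans x0 xt).
Qed.

Lemma compatible_midpoint F F' : compatible F -> compatible F' ->
  compatible (midpoint F F').
Proof.
move=> [mF [wv wa wg] [ea eg] [ia la ba]] [mF' [wv' wa' wg'] [ea' eg'] [ia' la' ba']].
have mid f u f' u' h w : is_weak_derivative f u -> is_weak_derivative f' u' ->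
    (forall x, h x = 1 / 2 * f x + 1 / 2 * f' x) ->
    (forall x, w x = 1 / 2 * u x + 1 / 2 * u' x) -> is_weak_derivative h w.
  move=> fu fu' hE wE; have := is_weak_derivative_lin (1 / 2) (1 / 2) fu fu'.
  by congr is_weak_derivative; apply/funext => x; rewrite ?hE ?wE.
have t0 : 3 * tau != 0 by rewrite mulf_neq0// gt_eqF.
have iR D : `]0, 1[%classic `<=` @I01 R -> measurable (D : set (measurableTypeR R)) -> D `<=` I01 ->
    \int[mu]_(t in D) midpoint F F' 5%N t =
    1 / 2 * \int[mu]_(t in D) F 5%N t + 1 / 2 * \int[mu]_(t in D) F' 5%N t.
  move=> _ mD DI; have iD := integrableS mI mD DI ia; have iD' := integrableS mI mD DI ia'.
  have iZ (r : R) (l : R -> R) : mu.-integrable D (EFin \o l) ->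
      mu.-integrable D (EFin \o (fun x => r * l x)).
    move=> il; rewrite (_ : _ \o _ = (fun x => r%:E * (EFin \o l) x)%E)//.
    exact: integrableZl.
  rewrite -!RintegralZl// -RintegralD//; [|exact: iZ..].
  by apply: eq_Rintegral => x _; rewrite /midpoint; field.
split.
- by move=> i; apply: measurable_funM; [exact: measurable_funD|exact: measurable_cst].
- split; [apply: mid wv wv' _ _|apply: mid wa wa' _ _|apply: mid wg wg' _ _] => x;
    rewrite /velocity /dvelocity /alpha_of /beta_of /gamma_of /dgamma_of /midpoint;
    by field; rewrite ?gt_eqF.
- split.
    apply: ae01S (ae01I ea ea') => x _ []; rewrite /alpha_of /velocity /midpoint.
    by move=> h h'; rewrite mulrAC mulrDl h h'; field.
  apply: ae01S (ae01I eg eg') => x _ []; rewrite /gamma_of /velocity /midpoint.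
  by move=> h h'; rewrite mulrAC mulrDl h h'; field.
- split.
  + have := integrableZl mI (1 / 2) (integrableD mI ia ia').
    congr (mu.-integrable _ _); apply/funext => x.
    by rewrite /= /midpoint -EFinM; congr EFin; field.
  + by rewrite iR//; lra.
  + apply: ae01S (ae01I ba ba') => x Ix []; rewrite /alpha_of => h h'.
    rewrite iR//; last exact: subset_tail.
    by rewrite /midpoint mulrAC mulrDl h h'; field.
Qed.

Lemma L1_cvg_scale (r : R) (f_ g_ : nat -> R -> R) (f g : R -> R) :
    (forall n, measurable_fun I01 (f_ n)) -> measurable_fun I01 f ->
    (\int[mu]_(x in I01) `|f_ n x - f x|%:E @[n --> \oo] --> 0)%E ->
    (forall n x, I01 x -> g_ n x - g x = r * (f_ n x - f x)) ->
  (\int[mu]_(x in I01) `|g_ n x - g x|%:E @[n --> \oo] --> 0)%E.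
Proof.
move=> mf_ mf cf gE.
have -> : (fun n => \int[mu]_(x in I01) `|g_ n x - g x|%:E)%E =
    (fun n => `|r|%:E * \int[mu]_(x in I01) `|f_ n x - f x|%:E)%E.
  apply/funext => n; rewrite -ge0_integralZl//.
  - apply: eq_integral => x /set_mem Ix; rewrite gE// normrM EFinM //.
  - apply/measurable_EFinP; apply: measurableT_comp => //; apply: measurable_funB; [exact: mf_|exact: mf].
by rewrite -[X in _ --> X](mule0 (`|r|%:E)); apply: cvgeZl.
Qed.

(** L^1 convergence of the fields is weighted L^1 convergence of the state and its weak derivatives,
    which preserves the weak-derivative relations. The two algebraic constraints pass to the limit
    pointwise; the boundary relation uses both modes. *)
Lemma compatible_closed (F_ : nat -> nat -> R -> R) F :
    (forall n, compatible (F_ n)) -> (forall i, measurable_fun I01 (F i)) ->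
    (forall i, (i < 6)%N -> {ae mu, forall x, I01 x -> F_ n i x @[n --> \oo] --> F i x}) ->
    (forall i, (i < 6)%N ->
      (\int[mu]_(x in I01) `|F_ n i x - F i x|%:E @[n --> \oo] --> 0)%E) ->
  compatible F.
Proof.
move=> CF mF aeF L1F.
have mF_ n i : measurable_fun I01 (F_ n i) by have [] := CF n.
have mpow (e : R) : measurable_fun I01 (fun x : R => x `^ e).
  by apply: measurable_funTS; exact: measurable_powR.
have t0 : 3 * tau != 0 by rewrite mulf_neq0// gt_eqF.
have powV (e x : R) : I01 x -> x `^ (- e) * x `^ e = 1.
  by move=> /I01_gt0 x0; rewrite powRN mulVf// gt_eqF// powR_gt0.
(* Used with D = ]0, 1[ for the sign of alpha(0) and with D = ]x, 1[ for the values of alpha. *)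
have lim5 (D : set (measurableTypeR R)) : measurable D -> D `<=` I01 ->
    (forall n, mu.-integrable I01 (EFin \o F_ n 5%N)) -> mu.-integrable I01 (EFin \o F 5%N) ->
    \int[mu]_(t in D) F_ n 5%N t @[n --> \oo] --> \int[mu]_(t in D) F 5%N t.
  move=> mD DI i_ i.
  have bound n : (`|\int[mu]_(t in D) F_ n 5%N t - \int[mu]_(t in D) F 5%N t|%:E
      <= \int[mu]_(t in I01) `|F_ n 5%N t - F 5%N t|%:E)%E.
    have iD_ := integrableS mI mD DI (i_ n); have iD := integrableS mI mD DI i.
    rewrite -RintegralB//.
    have iB : mu.-integrable D (EFin \o (fun x => F_ n 5%N x - F 5%N x)).
      exact: (integrableB mD iD_ iD).
    rewrite EFin_normr_Rintegral//; apply: le_trans (le_abse_integral _ _ _) _ => //.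
      exact: measurable_int iB.
    apply: ge0_subset_integral => //.
    by apply/measurable_EFinP; apply: measurableT_comp => //; apply: measurable_funB; [exact: mF_|exact: mF].
  have /fine_cvgP[finN lim0] := L1F 5%N erefl.
  apply/cvgrPdist_le => eps eps0; move/cvgrPdist_le : lim0 => /(_ _ eps0) lim0; near=> n.
  have h : `|0 - fine (\int[mu]_(t in I01) `|F_ n 5%N t - F 5%N t|%:E)%E| <= eps.
    by near: n; exact: lim0.
  rewrite distrC; apply: le_trans h; rewrite sub0r normrN.
  apply: le_trans (ler_norm _); rewrite -lee_fin fineK; first exact: bound.
  by near: n; exact: finN.
have i5_ n : mu.-integrable I01 (EFin \o F_ n 5%N) by have [_ _ _ []] := CF n.
have i5 : mu.-integrable I01 (EFin \o F 5%N).
  have /fine_cvgP[[n _ hn] _] := L1F 5%N erefl.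
  have fin := hn n (leqnn n).
  have iB : mu.-integrable I01 (EFin \o (fun x => F_ n 5%N x - F 5%N x)).
    apply/integrableP; split; first by apply/measurable_EFinP; apply: measurable_funB; [exact: mF_|exact: mF].
    by move: fin; rewrite /= ge0_fin_numE// integral_ge0.
  have := integrableB mI (i5_ n) iB; congr (mu.-integrable _ _).
  by apply/funext => x; rewrite /= -EFinB subKr.
split => //.
- split.
  (* In each of the three uses the exponents are those that turn the function and its derivative
     back into strain fields, up to constant factors and fixed terms that cancel in differences. *)
  + apply: (@is_weak_derivative_limit _ 0 (2 / 3) (fun n => velocity (F_ n)) (fun n => dvelocity (F_ n))).
    * by move=> n; have [_ []] := CF n.
    * exact: measurable_funD.
    * apply: measurable_funM; last exact: measurable_cst.
      by apply: measurable_funB => //; exact: measurable_funM.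
    * apply: (@L1_cvg_scale 1 _ _ _ _ _ _ (L1F 0%N erefl)) => // n x Ix.
      by rewrite !powRr0 /velocity; ring.
    * apply: (@L1_cvg_scale (3 * tau)^-1 _ _ _ _ _ _ (L1F 1%N erefl)) => // n x Ix.
      have E G : dvelocity G x * x `^ (2 / 3) =
          (3 * tau)^-1 * (G 1%N x - beta0 x * x `^ (2 / 3)).
        transitivity ((3 * tau)^-1 *
            (G 1%N x * (x `^ (- (2 / 3)) * x `^ (2 / 3)) - beta0 x * x `^ (2 / 3))).
          by rewrite /dvelocity /beta_of; ring.
        by rewrite powV// mulr1.
      by rewrite !E; ring.
  + apply: (@is_weak_derivative_limit _ (- 1) 0 (fun n => alpha_of (F_ n)) (fun n => F_ n 5%N)) => //.
    * by move=> n; have [_ []] := CF n.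
    * exact: measurable_funM.
    * apply: (@L1_cvg_scale 1 _ _ _ _ _ _ (L1F 2%N erefl)) => // n x Ix.
      rewrite -mulrBl /alpha_of -mulrBl powR_inv1 ?ltW ?I01_gt0// mulfK ?mul1r//.
      by rewrite gt_eqF// I01_gt0.
    * apply: (@L1_cvg_scale 1 _ _ _ _ _ _ (L1F 5%N erefl)) => // n x Ix.
      by rewrite !powRr0; ring.
  + apply: (@is_weak_derivative_limit _ (- (2 / 3)) (1 / 3) (fun n => gamma_of (F_ n)) (fun n => dgamma_of (F_ n))) => //.
    * by move=> n; have [_ []] := CF n.
    * exact: measurable_funM.
    * by apply: measurable_funM; [exact: measurable_cst|exact: measurable_funM].
    * apply: (@L1_cvg_scale 1 _ _ _ _ _ _ (L1F 3%N erefl)) => // n x Ix.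
      by rewrite /gamma_of -mulrBl -mulrBl mul1r -mulrA [X in _ * X]mulrC powV// mulr1.
    * apply: (@L1_cvg_scale (2 / 3) _ _ _ _ _ _ (L1F 4%N erefl)) => // n x Ix.
      by rewrite /dgamma_of -mulrBl -mulrBr -mulrBl -!mulrA powV// mulr1.
- have lim (c : R -> R) (e : R -> R) (i : nat) (w : R -> R) : (i < 6)%N ->
      (forall n, ae01 (fun x => F_ n i x * w x = c x + tau * (e x * velocity (F_ n) x))) ->
      ae01 (fun x => F i x * w x = c x + tau * (e x * velocity F x)).
    move=> i6 H; have H' := ae_foralln H.
    have H2 : ae01 (fun x => forall n, F_ n i x * w x = c x + tau * (e x * velocity (F_ n) x)).
      by apply: aeS H' => x h Ix n; exact: h.
    apply: ae01S (ae01I (aeF 0%N erefl) (ae01I (aeF i i6) H2)) => x Ix [c0 [ci hE]].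
    apply: (cvg_unique (@Rhausdorff R) (F := F_ n i x * w x @[n --> \oo])).
      by apply: cvgM => //; exact: cvg_cst.
    rewrite (_ : (fun n => _) = (fun n => c x + tau * (e x * velocity (F_ n) x))); last first.
      by apply/funext => n; exact: hE.
    apply: cvgD; first exact: cvg_cst.
    apply: cvgM; first exact: cvg_cst.
    apply: cvgM; first exact: cvg_cst.
    by apply: cvgD => //; exact: cvg_cst.
  split; [apply: (lim alpha0 _ 2%N)|apply: (lim gamma0 _ 3%N)] => // n;
    by have [_ _ []] := CF n.
- split => //.
  + have c5 := lim5 I01 mI (fun _ => id) i5_ i5.
    have c5' : lambda - \int[mu]_(t in I01) F_ n 5%N t @[n --> \oo] --> lambda - \int[mu]_(t in I01) F 5%N t.
      by apply: cvgB => //; exact: cvg_cst.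
    rewrite -(cvg_lim (@Rhausdorff R) c5'); apply: limr_ge; first by apply/cvg_ex; eexists; exact: c5'.
    by apply: nearW => n; have [_ _ _ []] := CF n.
  + have H n : ae01 (fun x => alpha_of (F_ n) x = lambda - \int[mu]_(t in `]x, 1[) F_ n 5%N t).
      by have [_ _ _ []] := CF n.
    have H' := ae_foralln H.
    have H2 : ae01 (fun x => forall n, alpha_of (F_ n) x = lambda - \int[mu]_(t in `]x, 1[) F_ n 5%N t).
      by apply: aeS H' => x h Ix n; exact: h.
    apply: ae01S (ae01I (aeF 2%N erefl) H2) => x Ix [c2 hE].
    apply: (cvg_unique (@Rhausdorff R) (F := alpha_of (F_ n) x @[n --> \oo])).
      by apply: cvgM => //; exact: cvg_cst.
    rewrite (_ : (fun n => _) = (fun n => lambda - \int[mu]_(t in `]x, 1[) F_ n 5%N t)); last first.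
      by apply/funext => n; exact: hE.
    apply: cvgB; first exact: cvg_cst.
    by apply: lim5 => //; exact: subset_tail.
Unshelve. all: by end_near. Qed.

End strain_fields.

(** * Correspondence between admissible states and compatible strain fields *)

Section minimization.
Context {R : realType}.
Notation mu := (@lebesgue_measure R).
Variables (p q lambda tau : R) (phi g h : R -> R).
Variables (alpha0 beta0 gamma0 v0 : R -> R).
Hypotheses (p1 : 1 < p) (q1 : 1 < q) (lambda_gt0 : 0 < lambda) (tau_gt0 : 0 < tau).
Hypotheses (hA1 : A1 h) (hA2 : A2 phi g h) (hA3 : A3 p q phi g).
Hypothesis hD : data_condition p q lambda phi g h (alpha0, beta0, gamma0, v0).

Let mI : measurable (I01 : set (measurableTypeR R)).
Proof. exact: measurable_I01. Qed.

Let s0 : @state R := (alpha0, beta0, gamma0, v0).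
Let Adm := admissible p q lambda tau phi g h s0.
Let Phi := densities phi (psi_of phi) g h.
Let G := convex_integral mu I01 6 Phi.
Let fields := @strain_fields R v0.
Let Compat := compatible lambda tau alpha0 beta0 gamma0 v0.

Let X0 : X p q s0. Proof. by case: hD. Qed.

Let Lbeta0 : L1loc01 beta0. Proof. by case: X0 => _ [+ _] _ _; apply. Qed.

Let Lv0 : L1loc01 v0.
Proof. by case: X0 => _ _ _ [[u [+ _ _]] _ _]; apply. Qed.

Let mbeta0 : measurable_fun I01 beta0. Proof. exact: measurable_L1loc01 Lbeta0. Qed.
Let mv0 : measurable_fun I01 v0. Proof. exact: measurable_L1loc01 Lv0. Qed.

Let mpow (e : R) : measurable_fun I01 (fun x : R => x `^ e).
Proof. by apply: measurable_funTS; exact: measurable_powR. Qed.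

Let Phi_ge0 i (s : R) : (0 <= Phi i s)%E.
Proof. exact: densities_ge0 hA2 i s. Qed.

Let mPhi i : measurable_fun [set: R] (Phi i).
Proof. exact: measurable_densities hA1 hA2 i. Qed.

Let mPhiF (F : nat -> R -> R) : (forall i, measurable_fun I01 (F i)) ->
  forall i, measurable_fun I01 (fun x => Phi i (F i x)).
Proof. by move=> mF i; apply: (measurableT_comp (mPhi i)); exact: mF. Qed.

Implicit Types F : nat -> R -> R.

(** [fine] sends +oo to 0, exactly the value that the restriction of [h] to the positive axis takes
    elsewhere; so this matches the integrand of [functional] without a sign condition on alpha'. *)
Definition fine_density (F : nat -> R -> R) (x : R) := \sum_(i < 6) fine (Phi i (F i x)).

Lemma functionalE s : functional phi g h v0 s =
  (\int[mu]_(x in I01) (fine_density (fields s) x)%:E)%E.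
Proof.
case: s => [[[alpha beta] gamma] v]; apply: eq_integral => x _; congr EFin.
rewrite /fine_density /energy !big_ord_recl big_ord0 addr0 /= !addrA.
congr (_ + _); rewrite patchE /extend_pos; case: ifPn => [/set_mem/=|/negP a_le0].
  by rewrite in_itv/= andbT => ->.
by case: ifPn => // a_gt0; case: a_le0; apply/mem_set; rewrite /= in_itv/= a_gt0.
Qed.

Lemma measurable_fine_density F : (forall i, measurable_fun I01 (F i)) ->
  measurable_fun I01 (fine_density F).
Proof.
move=> mF; apply: measurable_sum => i; apply: measurableT_comp => //; exact: mPhiF.
Qed.

Lemma fine_density_integral F : (forall i, measurable_fun I01 (F i)) ->
  ae01 (fun x => 0 < F 5%N x) ->
  (\int[mu]_(x in I01) (fine_density F x)%:E)%E = G F.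
Proof.
move=> mF F5; apply: ae_eq_integral => //.
- by apply/measurable_EFinP; exact: measurable_fine_density.
- by apply: emeasurable_sum => i; exact: mPhiF.
- apply: aeS F5 => x /[apply] F5x; rewrite -sumEFin; apply: eq_bigr => i _.
  rewrite fineK//; case: i => [[|[|[|[|[|[|i]]]]]] i6] //=.
  by rewrite /Phi/= /extend_pos F5x.
Qed.

Lemma integral_density_le F i : (forall i, measurable_fun I01 (F i)) -> (i < 6)%N ->
  (\int[mu]_(x in I01) Phi i (F i x) <= G F)%E.
Proof.
move=> mF i6; apply: ge0_le_integral => //.
- exact: mPhiF.
- by apply: emeasurable_sum => j; exact: mPhiF.
- move=> x _; rewrite (bigD1 (Ordinal i6))//= leeDl// sume_ge0// => j _; exact: Phi_ge0.
Qed.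

(** An integrable density is finite a.e., and [extend_pos] is finite only at positive arguments. *)
Lemma finite_energy_pos F : (forall i, measurable_fun I01 (F i)) -> (G F < +oo)%E ->
  ae01 (fun x => 0 < F 5%N x).
Proof.
move=> mF GF.
have i5 : mu.-integrable I01 (fun x => Phi 5 (F 5%N x)).
  apply/integrableP; split; first exact: mPhiF.
  apply: le_lt_trans GF; under eq_integral do rewrite gee0_abs//.
  exact: integral_density_le.
apply: ae01S (integrable_ae mI i5) => x _.
by rewrite /Phi/= /extend_pos; case: ifPn.
Qed.

Lemma admissible_compatible s : Adm s -> Compat (fields s) /\
  functional phi g h v0 s = G (fields s).
Proof.
case: s => [[[alpha beta] gamma] v] [[Xa Xb Xc Xv] [[a0 a1 da fin] [eb ea eg]]].
have [Wv _ _] := Xv; have [wv /wderivP[dv _]] := Wv.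
have [[Wa _ La] _] := Xa; have [wa /wderivP[dal _]] := Wa.
have [Wg _ _] := Xc; have [wg /wderivP[dga _]] := Wg.
have [Lb _] := Xb.
have [Lv Lw _] := dv; have [Lal Lda _] := dal; have [Lga Ldg _] := dga.
have mV : measurable_fun I01 (fun x : R => x^-1).
  apply: (eq_measurable_fun (fun x : R => x `^ (-1))); last exact: mpow.
  by move=> x /set_mem Ix; rewrite powR_inv1// ltW// I01_gt0.
have mF i : measurable_fun I01 (fields (alpha, beta, gamma, v) i).
  case: i => [|[|[|[|[|i]]]]]; rewrite /fields/strain_fields/=.
  - by apply: measurable_funB => //; exact: measurable_L1loc01.
  - by apply: measurable_funM => //; exact: measurable_L1loc01.
  - by apply: measurable_funM => //; exact: measurable_L1loc01.
  - apply: measurable_funM; first exact: measurable_L1loc01.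
    by under eq_fun do rewrite -powRN; exact: mpow.
  - apply: measurable_funM => //; apply: measurable_funM => //.
    exact: measurable_L1loc01.
  - exact: measurable_L1loc01.
split; last by rewrite functionalE fine_density_integral.
have powN (e x : R) : I01 x -> x `^ e != 0.
  by move=> /I01_gt0 x0; rewrite gt_eqF// powR_gt0.
set F := fields _ in mF *.
have velE x : velocity v0 F x = v x by rewrite /velocity /F/= subrK.
have alE x : I01 x -> alpha_of F x = alpha x.
  by move=> Ix; rewrite /alpha_of /F/= divfK// gt_eqF// I01_gt0.
have betaE x : I01 x -> beta_of F x = beta x.
  by move=> Ix; rewrite /beta_of /F/= powRN mulfK// powN.
have gaE x : I01 x -> gamma_of F x = gamma x.
  by move=> Ix; rewrite /gamma_of /F/= divfK// powN.
have dgaE x : I01 x -> dgamma_of F x = wderiv gamma x.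
  by move=> Ix; rewrite /dgamma_of /F/= powRN mulfK ?powN//; field.
have t0 : tau != 0 by rewrite gt_eqF.
have m_al : measurable_fun I01 (alpha_of F) by exact: measurable_funM.
have m_ga : measurable_fun I01 (gamma_of F) by exact: measurable_funM.
have m_dga : measurable_fun I01 (dgamma_of F).
  by apply: measurable_funM; [exact: measurable_cst|exact: measurable_funM].
have m_w : measurable_fun I01 (dvelocity tau beta0 F).
  apply: measurable_funM; last exact: measurable_cst.
  by apply: measurable_funB => //; exact: measurable_funM.
split; first exact: mF.
- split.
  + apply: is_weak_derivative_ae dv _ m_w _ _.
    * exact: measurable_funD.
    * by apply: ae_aeW => x _; rewrite velE.
    * apply: ae01S eb => x Ix hx; rewrite /dvelocity betaE//.
      by apply: (@mulfI _ 3) => //; rewrite -hx; field; rewrite ?t0.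
  + apply: is_weak_derivative_ae dal m_al (mF 5%N) _ _.
    * by apply: ae_aeW => x Ix; rewrite alE.
    * by apply: ae_aeW => x Ix.
  + apply: is_weak_derivative_ae dga m_ga m_dga _ _.
    * by apply: ae_aeW => x Ix; rewrite gaE.
    * by apply: ae_aeW => x Ix; rewrite dgaE.
- split.
    apply: ae01S ea => x Ix hx; rewrite alE// velE -hx mulrC divfK//; ring.
  apply: ae01S eg => x Ix hx; rewrite gaE// velE -hx mulrC divfK//; ring.
- have ia : mu.-integrable I01 (EFin \o F 5%N) by exact: integrable_Lp01 La.
  (* Since lambda is nonzero, [crep alpha] is not the default value. *)
  have [cc ca] : {within `[0, 1], continuous (crep alpha)} /\
      ae01 (fun x => crep alpha x = alpha x).
    by apply: (@crep_neq0 _ _ 1); rewrite a1 gt_eqF.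
  have prim := weak_derivative_primitive ia dal cc ca.
  split => //.
  + by move: a0; rewrite prim ?lexx ?ler01// a1.
  + apply: ae01S ca => x Ix hx; rewrite alE// -hx prim ?a1//.
    by move: Ix; rewrite /I01/= in_itv/= => /andP[/ltW -> /ltW ->].
Qed.

Definition state_of (F : nat -> R -> R) : @state R :=
  (alpha_of F, beta_of F, gamma_of F, velocity v0 F).

(** Finite energy supplies what [compatible] omits: positivity of alpha', and by coercivity of the
    densities the integrability conditions that define [X]. *)
Lemma compatible_admissible F : Compat F -> (G F < +oo)%E ->
  Adm (state_of F) /\ functional phi g h v0 (state_of F) = G F.
Proof.
move=> [mF [dv dal dga] [ea eg] [ia la ba]] GF.
have F5 := finite_energy_pos mF GF.
have t0 : tau != 0 by rewrite gt_eqF.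
have [dv' wv] := wderivP dv; have [dal' wal] := wderivP dal.
have [dga' wga] := wderivP dga.
have [Lv Lw _] := dv; have [Lal Lda _] := dal; have [Lga Ldg _] := dga.
have powN (e x : R) : I01 x -> x `^ e != 0.
  by move=> /I01_gt0 x0; rewrite gt_eqF// powR_gt0.
have [k1 k2 k3] := coercive_densities p1 q1 hA2 hA3.
have [[Cphi Cpsi Cg _] [phi_ge0 psi_ge0 g_ge0 _] _ _] := hA2.
have C2m (f : R -> R) : C2_on [set: R] f -> measurable_fun [set: R] f.
  move=> Cf; apply: continuous_measurable_fun => x; have [d _ _] := Cf x Logic.I.
  exact/differentiable_continuous/derivable1_diffP.
have fin i : (i < 6)%N -> (\int[mu]_(x in I01) Phi i (F i x) < +oo)%E.
  by move=> i6; apply: le_lt_trans GF; exact: integral_density_le.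
have p3 : 1 <= 3 * p by move: p1; lra.
have p1' : 1 <= p by exact: ltW.
have q1' : 1 <= q by exact: ltW.
have half (r : R) (f : R -> R) i : 1 <= r -> power_coercive r f -> measurable_fun [set: R] f ->
    (forall s, 0 <= f s) -> (i < 6)%N -> Phi i = (fun s => (2 * f s)%:E) -> Lp01 r (F i).
  move=> r1 kf mf f0 i6 E; apply: (Lp01_coercive r1 kf mf f0 (mF i)).
  apply: le_lt_trans (fin i i6); rewrite E; apply: ge0_le_integral => //.
  - by move=> x _; rewrite lee_fin.
  - by apply/measurable_EFinP; exact: (measurableT_comp mf (mF i)).
  - apply/measurable_EFinP; apply: measurable_funM; first exact: measurable_cst.
    exact: (measurableT_comp mf (mF i)).
  - by move=> x _; rewrite lee_fin ler_peMl// ler1n.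
have L0 : Lp01 2 (F 0%N).
  apply: (Lp01_coercive _ power_coercive_sqr _ _ (mF 0%N) (fin 0%N erefl)) => //.
  - by rewrite ler1n.
  - by apply: measurable_funM; [exact: measurable_cst|exact: measurable_funX].
  - by move=> s; rewrite mulr_ge0 ?sqr_ge0.
have L1 : Lp01 (3 * p) (F 1%N).
  exact: (Lp01_coercive p3 k1 (C2m _ Cphi) phi_ge0 (mF 1%N) (fin 1%N erefl)).
have L2 : Lp01 p (F 2%N) by exact: (half _ _ 2%N p1' k2 (C2m _ Cpsi) psi_ge0 erefl erefl).
have L3 : Lp01 q (F 3%N).
  exact: (Lp01_coercive q1' k3 (C2m _ Cg) g_ge0 (mF 3%N) (fin 3%N erefl)).
have L4 : Lp01 q (F 4%N) by exact: (half _ _ 4%N q1' k3 (C2m _ Cg) g_ge0 erefl erefl).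
(* From beta = 3 tau v' + beta0, a sum of locally integrable functions. *)
have Lbeta : L1loc01 (beta_of F).
  have := L1loc01_lin (3 * tau) 1 Lw Lbeta0; congr L1loc01.
  by apply/funext => x; rewrite /dvelocity mul1r mulrC divfK ?subrK// mulf_neq0.
have m_al := measurable_L1loc01 Lal; have m_ga := measurable_L1loc01 Lga.
have mV : measurable_fun I01 (fun x : R => x^-1).
  apply: (eq_measurable_fun (fun x : R => x `^ (-1))); last exact: mpow.
  by move=> x /set_mem Ix; rewrite powR_inv1// ltW// I01_gt0.
have mVp (e : R) : measurable_fun I01 (fun x : R => (x `^ e)^-1).
  by under eq_fun do rewrite -powRN; exact: mpow.
have m_wv : measurable_fun I01 (wderiv (velocity v0 F)) by have [_ /measurable_L1loc01] := dv'.
have m_wal : measurable_fun I01 (wderiv (alpha_of F)) by have [_ /measurable_L1loc01] := dal'.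
have m_wga : measurable_fun I01 (wderiv (gamma_of F)) by have [_ /measurable_L1loc01] := dga'.
(* Only a.e., since [wderiv] is a chosen weak derivative that need not coincide everywhere with the
   one given by [F]. *)
have fE : ae01 (fun x => forall i, (i < 6)%N -> fields (state_of F) i x = F i x).
  apply: ae01S (ae01I wal wga) => x Ix [hal hga] i.
  have x0 : x != 0 by rewrite gt_eqF// I01_gt0.
  case: i => [|[|[|[|[|[|i]]]]]] // _; rewrite /fields/=.
  - by rewrite /velocity addrK.
  - by rewrite /beta_of powRN divfK// powN.
  - by rewrite /alpha_of mulfK.
  - by rewrite /gamma_of mulfK// powN.
  - by rewrite hga /dgamma_of powRN; field; rewrite powN.
have mfields i : measurable_fun I01 (fields (state_of F) i).
  case: i => [|[|[|[|[|i]]]]]; rewrite /fields/=.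
  - by apply: measurable_funB => //; exact: measurable_L1loc01.
  - by apply: measurable_funM => //; exact: measurable_L1loc01.
  - exact: measurable_funM.
  - exact: measurable_funM.
  - by apply: measurable_funM => //; apply: measurable_funM => //; exact: measurable_cst.
  - exact: m_wal.
have funE : functional phi g h v0 (state_of F) = G F.
  rewrite functionalE fine_density_integral//; last first.
    by apply: ae01S (ae01I fE F5) => x _ [-> //].
  apply: ae_eq_integral => //.
  - by apply: emeasurable_sum => i; exact: mPhiF.
  - by apply: emeasurable_sum => i; exact: mPhiF.
  - by apply: aeS fE => x /[apply] hx; apply: eq_bigr => i _; rewrite hx.
split; last exact: funE.
have ae_field i (r : R) : (i < 6)%N -> 1 <= r -> Lp01 r (F i) -> Lp01 r (fields (state_of F) i).
  move=> i6 r1 LF; apply: (Lp01_ae r1 LF (mfields i)).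
  by apply: ae01S fE => x _ /(_ i i6).
have [Xal0 Xbeta0 _ Yv0] := X0.
have Lv0_2 : Lp01 2 v0 by have [] := Yv0.
have Lbeta0_p : Lp01 (3 * p) (fun x => beta0 x * x `^ (2 / 3)) by have [] := Xbeta0.
have r2 : 1 <= 2 :> R by rewrite ler1n.
split; last split.
- split.
  + split; last exact: (ae_field 2%N p erefl p1' L2).
    split; first by exists (F 5%N).
    * apply: Lp01_integrable.
      (* On ]0, 1[ one has |alpha| <= |alpha / x|, so integrability of alpha reduces to that of this
         field, which superlinearity with e = 1 gives on a set of finite measure. *)
      have i2 : mu.-integrable I01 (EFin \o F 2%N).
        have [M hM] := superlinear_densities p1 q1 hA1 hA2 hA3 2%N ltr01.
        apply/integrableP; split; first by apply/measurable_EFinP; exact: mF.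
        apply: (@le_lt_trans _ _ (\int[mu]_(x in I01) (`|M|%:E + Phi 2 (F 2%N x))))%E.
          apply: ge0_le_integral => //.
          + by apply/measurable_EFinP; apply: measurableT_comp => //; exact: mF.
          + by apply: emeasurable_funD; [exact: measurable_cst|exact: mPhiF].
          + move=> x _; apply: (le_trans (hM (F 2%N x))); rewrite mul1e leeD2r//.
            by rewrite lee_fin ler_norm.
        rewrite ge0_integralD//; last exact: mPhiF.
        apply: lte_add_pinfty; last exact: fin.
        by rewrite integral_cst// lte_mul_pinfty// mu_I01.
      apply: (le_integrable mI _ _ i2); first exact/measurable_EFinP.
      move=> x; rewrite /I01/= in_itv/= => /andP[x0 x1]; rewrite lee_fin /alpha_of normrM.
      by rewrite ler_piMr// gtr0_norm// ltW.
    * apply: (Lp01_ae (lexx 1) (Lp01_integrable ia) m_wal).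
      by apply: ae01S wal => x _ ->.
  + by split => //; exact: (ae_field 1%N _ erefl p3 L1).
  + split; first by exists (dgamma_of F).
    * exact: (ae_field 3%N _ erefl q1' L3).
    * have := Lp01_lin (2 / 3) 0 q1' (ae_field 4%N _ erefl q1' L4) (ae_field 4%N _ erefl q1' L4).
      by congr Lp01; apply/funext => x; rewrite /fields/= mul0r addr0; field.
  + split; first by exists (dvelocity tau beta0 F).
    * have := Lp01_lin 1 1 r2 L0 Lv0_2.
      by congr Lp01; apply/funext => x; rewrite !mul1r.
    (* Indeed v' x^(2/3) = (F_1 - beta0 x^(2/3)) / (3 tau). *)
    * have := Lp01_lin (3 * tau)^-1 (- (3 * tau)^-1) p3 L1 Lbeta0_p.
      move=> /(Lp01_ae p3); apply; first exact: measurable_funM.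
      apply: ae01S wv => x Ix ->; rewrite /dvelocity /beta_of powRN.
      by field; rewrite powN// t0.
(* An explicit continuous representative of alpha: this expression is lambda minus the integral of
   [F 5] over ]x, 1[. *)
- have cc : {within `[0, 1], continuous (fun x => primitive (F 5%N) x + (lambda - primitive (F 5%N) 1))}.
    by move=> x; apply: cvgD; [exact: continuous_primitive|exact: cvg_cst].
  have ca : ae01 (fun x => primitive (F 5%N) x + (lambda - primitive (F 5%N) 1) = alpha_of F x).
    apply: ae01S ba => x Ix ->.
    move: Ix; rewrite /I01/= in_itv/= => /andP[/ltW x0 /ltW x1].
    by rewrite -primitiveB//; ring.
  have [_ _ cE] := crepP cc ca.
  split.
  + rewrite cE ?lexx ?ler01// primitive0.
    by move: la; rewrite -[X in lambda - X](primitiveB ia)// primitive0; lra.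
  + by rewrite cE ?lexx ?ler01//; ring.
  + by apply: ae01S (ae01I wal F5) => x _ [-> //].
  + by rewrite -/(state_of F) funE.
- split.
  + apply: ae01S wv => x Ix ->; rewrite /dvelocity.
    by field; rewrite t0.
  + by apply: ae01S ea => x Ix ->; field; rewrite t0.
  + by apply: ae01S eg => x Ix ->; field; rewrite t0.
Qed.

Lemma weak_derivative0 : is_weak_derivative (fun=> 0 : R) (fun=> 0 : R).
Proof.
have L : L1loc01 (fun=> 0 : R).
  split; [exact: measurable_cst|exact: itv_open|move=> K _ _].
  by under eq_integral do rewrite normr0; rewrite integral0.
split => // f _; under eq_Rintegral do rewrite mul0r.
under [in RHS]eq_Rintegral do rewrite mul0r.
by rewrite /Rintegral integral0 oppr0.
Qed.

(** With v = 0 the three constraints ask for no change of alpha, beta, gamma, and the kinetic term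
    (0 - v0)^2 / 2 is the one already finite in the data. This gives a competitor of finite
    energy. *)
Lemma admissible_initial : Adm (alpha0, beta0, gamma0, cst 0%R).
Proof.
have [[Xal Xb Xg Xv] [a1 a_ge0 da fin]] := hD.
have [d0 w0] := wderivP weak_derivative0.
have t0 : tau != 0 by rewrite gt_eqF.
have L0 (r : R) : 1 <= r -> Lp01 r (fun=> 0 : R).
  move=> r1; apply/(Lp01P _ r1); split; first exact: measurable_cst.
  under eq_integral do rewrite normr0 powR0 ?gt_eqF ?(lt_le_trans ltr01)//.
  by rewrite integral0.
have p3 : 1 <= 3 * p by move: p1; lra.
split; last split.
- split => //; split; first by exists (fun=> 0); exact: weak_derivative0.
  + by apply: L0; rewrite ler1n.
  + apply: (Lp01_ae p3 (L0 _ p3)).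
      by apply: measurable_funM => //; have [_ /measurable_L1loc01] := d0.
    by apply: ae01S w0 => x _ ->; rewrite mul0r.
- have [cc ca] : {within `[0, 1], continuous (crep alpha0)} /\
      ae01 (fun x => crep alpha0 x = alpha0 x).
    by apply: (@crep_neq0 _ _ 1); rewrite a1 gt_eqF.
  split => //.
  + have cn : {within `[0, 1], continuous (fun x => `|crep alpha0 x|)}.
      by move=> x; apply: cvg_norm; exact: cc.
    (* The representative equals its own absolute value a.e., hence also at the endpoint 0 by
       continuity. *)
    rewrite (@continuous_ae01_eq _ _ _ cc cn) ?lexx ?ler01//.
    by apply: ae01S (ae01I ca a_ge0) => x _ [-> a0]; rewrite ger0_norm.
  + apply: le_lt_trans fin; rewrite le_eqVlt; apply/orP; left; apply/eqP.
    by apply: eq_integral => x _; rewrite sub0r sqrrN.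
- split.
  + by apply: ae01S w0 => x _ ->; rewrite subrr mul0r mulr0.
  + by apply: ae_aeW => x _; rewrite subrr mul0r mulr0.
  + by apply: ae_aeW => x _; rewrite subrr mul0r mulr0.
Qed.

(** Only the minimizing fields are turned back into a state; for every other admissible state it
    suffices that its fields compete in the abstract problem with the same energy. *)
Theorem minimizer_exists : exists2 s, Adm s &
  functional phi g h v0 s = ereal_inf (functional phi g h v0 @` Adm).
Proof.
have [C0 E0] := admissible_compatible admissible_initial.
have G0 : (G (fields (alpha0, beta0, gamma0, cst 0%R)) < +oo)%E.
  by rewrite -E0; have [_ [[]]] := admissible_initial.
have [F CF minF] : exists2 F, Compat F & forall F', Compat F' -> (G F <= G F')%E.
  apply: (@convex_integral_attains _ _ _ mu I01 mI mu_I01 6 Phi) => //.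
  - exact: continuous_densities.
  - exact: (superlinear_densities p1 q1).
  - exact: midpoint_densities.
  - by move=> F [].
  - exact: compatible_midpoint.
  - exact: compatible_closed.
  - by exists (fields (alpha0, beta0, gamma0, cst 0%R)).
(* Comparison with the initial competitor makes the minimal energy finite. *)
have [AF FE] := compatible_admissible CF (le_lt_trans (minF _ C0) G0).
exists (state_of F) => //; apply/eqP; rewrite eq_le; apply/andP; split.
  apply: le_ereal_inf_tmp => _ [s As <-].
  by have [Cs ->] := admissible_compatible As; rewrite FE; exact: minF.
by apply: ereal_inf_lbound; exists (state_of F).
Qed.

End minimization.

Theorem theorem2 (R : realType) (p q lambda tau : R) (phi g h : R -> R)
    (alpha0 beta0 gamma0 v0 : R -> R)
    (p1 : 1 < p) (q1 : 1 < q) (lambda_gt0 : 0 < lambda) (tau_gt0 : 0 < tau)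
    (hA1 : A1 h) (hA2 : A2 phi g h) (hA3 : A3 p q phi g) (hA4 : A4 p q phi g)
    (hD : data_condition p q lambda phi g h (alpha0, beta0, gamma0, v0)) :
  exists alpha beta gamma v : R -> R,
    admissible p q lambda tau phi g h (alpha0, beta0, gamma0, v0)
      (alpha, beta, gamma, v) /\
    functional phi g h v0 (alpha, beta, gamma, v) =
      ereal_inf (functional phi g h v0 @`
        admissible p q lambda tau phi g h (alpha0, beta0, gamma0, v0)).
Proof.
have [[[[alpha beta] gamma] v] As Es] :=
  minimizer_exists p1 q1 lambda_gt0 tau_gt0 hA1 hA2 hA3 hD.
by exists alpha, beta, gamma, v.
Qed.
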